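(* Let $k\ge1$ be an integer, $\lambda_1,\lambda_2>0$, $0<\alpha\le1$ and $a,b>0$. Let $\{Z(t)\}_{t\ge0}$ be the gamma subordinator with probability density function $g(x,t)=\frac{a^{bt}}{\Gamma(bt)}x^{bt-1}e^{-ax}$, $x>0$, independent of the fractional Skellam process of order $k$, $\{\mathcal{S}^{k}_{\alpha}(t)\}_{t\ge0}$, with parameters $\lambda_1,\lambda_2,\alpha$. Let $p^{k}_{\alpha}(n,t)=\mathrm{Pr}\{\mathcal{S}^{k}_{\alpha}(t)=n\}$ and $p_{\alpha}^{f_{1}}(n,t)=\mathrm{Pr}\{\mathcal{S}^{k}_{\alpha}(Z(t))=n\}$, $n\in\mathbb{Z}$. Let $\gamma\ge1$ and let $\psi(x)=\Gamma'(x)/\Gamma(x)$ be the digamma function. Then the probability mass function $p_{\alpha}^{f_{1}}(n,t)$ solves the following equation: $$D_t^{\gamma}p_{\alpha}^{f_{1}}(n,t)=b\,D_t^{\gamma-1}\Big[\left(\log (a)-\psi(bt)\right)p_{\alpha}^{f_{1}}(n,t)\Big]+b\int_{0}^{\infty}p^{k}_{\alpha}(n,x)\log (x)\,D_t^{\gamma-1}g(x,t)\,\mathrm{d}x,$$ where $D_t^{\gamma}$ denotes the Riemann-Liouville fractional derivative.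
   Context: Poisson process of order $k$ (PPoK) with intensity $\lambda>0$: $N^k(t)=\sum_{i=1}^{N(t)}X_i$, where $\{N(t)\}_{t\ge0}$ is a Poisson process with intensity $k\lambda$, and $\{X_i\}_{i\ge1}$ are iid, uniform on $\{1,2,\dots,k\}$, and independent of $\{N(t)\}_{t\ge0}$. Skellam process of order $k$ (SPoK): $S^k(t)=N_1^k(t)-N_2^k(t)$, where $\{N_1^k(t)\}_{t\ge0}$ and $\{N_2^k(t)\}_{t\ge0}$ are independent PPoK with intensities $\lambda_1>0$ and $\lambda_2>0$, respectively. Inverse stable subordinator: for $0<\alpha<1$, the stable subordinator $\{D_\alpha(t)\}_{t\ge0}$ is the subordinator with $\mathbb{E}(e^{-sD_\alpha(t)})=e^{-ts^\alpha}$, $s>0$, and $Y_\alpha(t)=\inf\{r\ge0: D_\alpha(r)>t\}$, $t\ge 0$. Fractional Skellam process of order $k$ (FSPoK): $\mathcal{S}^k_\alpha(t)=S^k(Y_\alpha(t))$ for $0<\alpha<1$, where $\{Y_\alpha(t)\}_{t\ge0}$ is independent of $\{S^k(t)\}_{t\ge0}$, and $\mathcal{S}^k_1(t)=S^k(t)$ for $\alpha=1$. Gamma subordinator: the subordinator $\{Z(t)\}_{t\ge0}$ with Bernstein function $f_1(s)=b\log(1+s/a)$, i.e. $\mathbb{E}(e^{-sZ(t)})=e^{-tf_1(s)}$, $s>0$. Riemann-Liouville derivative: for a positive integer $m$, $D_t^{\gamma}f(t)=\frac{1}{\Gamma(m-\gamma)}\frac{\mathrm{d}^{m}}{\mathrm{d}t^{m}}\int_0^t\frac{f(s)}{(t-s)^{\gamma+1-m}}\,\mathrm{d}s$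 if $m-1<\gamma<m$, and $D_t^{\gamma}f(t)=\frac{\mathrm{d}^{m}}{\mathrm{d}t^{m}}f(t)$ if $\gamma=m$; $D_t^0$ is the identity. The derivative always acts in the variable $t$.
   Formalization: At n=0 with non-integer γ the right-hand side is undefined (the Riemann-Liouville integral of (log a − ψ(bt))p(0,t) diverges at 0), so the equation is asserted, for t>0, for all n≠0 with any γ≥1 and for n=0 with integer γ only. *)

(* Defs.v *)
From HB Require Import structures.
From mathcomp Require Import all_boot all_order all_algebra.
From mathcomp Require Import all_classical all_reals all_analysis.
Set Implicit Arguments.
Unset Strict Implicit.
Unset Printing Implicit Defensive.
Import Order.TTheory GRing.Theory Num.Theory.
Import numFieldNormedType.Exports.
Local Open Scope classical_set_scope.
Local Open Scope ring_scope.

(* Processes are functions X : R -> T -> R whose values at negative times are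
   irrelevant.  Path properties (value 0 at time 0, monotonicity, right
   continuity) are required for every outcome, so that a process evaluated at
   an independent random time is again a random variable. *)

Section independence.
Context (d : measure_display) (T : measurableType d) (R : realType).
Variable P : probability T R.

Definition family_sigma_algebra (d' : measure_display)
    (T' : measurableType d') (I : Type) (D : set I) (X : I -> T -> T') :
    set (set T) :=
  <<s [set A | exists i, D i /\
         exists B, measurable B /\ A = X i @^-1` B] >>.

Definition independent_sigma_algebras (F G : set (set T)) : Prop :=
  forall A B, F A -> G B -> P (A `&` B) = (P A * P B)%E.

Definition independent_processes (X Y : R -> T -> R) : Prop :=
  independent_sigma_algebras
    (family_sigma_algebra [set t | 0 <= t] X)
    (family_sigma_algebra [set t | 0 <= t] Y).

Definition mutually_independent (d' : measure_display)
    (T' : measurableType d') (X : nat -> T -> T') : Prop :=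
  forall (J : seq nat) (B : nat -> set T'), uniq J ->
    (forall i, measurable (B i)) ->
    P (\big[setI/setT]_(i <- J) (X i @^-1` B i)) =
    (\prod_(i <- J) P (X i @^-1` B i))%E.

End independence.

Section processes.
Context (d : measure_display) (T : measurableType d) (R : realType).
Variable P : probability T R.

Record subordinator (X : R -> T -> R) : Prop := Subordinator {
  subordinator_measurable : forall t, 0 <= t -> measurable_fun setT (X t) ;
  subordinator_start : forall w, X 0 w = 0 ;
  subordinator_monotone :
    forall w s t, 0 <= s -> s <= t -> X s w <= X t w ;
  subordinator_right_continuous :
    forall w t, 0 <= t -> X s w @[s --> t^'+] --> X t w ;
  subordinator_independent_increments :
    forall t : nat -> R, 0 <= t 0%N -> (forall i, t i <= t i.+1) ->
      mutually_independent P (fun i w => X (t i.+1) w - X (t i) w) ;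
  subordinator_stationary_increments :
    forall s t (B : set R), 0 <= s -> 0 <= t -> measurable B ->
      P [set w | B (X (s + t) w - X s w)] = P [set w | B (X t w)] }.

(* The marginal law is only prescribed for t > 0, because [poisson_pmf 0] is
   the constant 1; the value at t = 0 is fixed by [subordinator_start]. *)
Definition poisson_process (rate : R) (N : R -> T -> nat) : Prop :=
  [/\ forall t, 0 <= t -> measurable_fun setT (N t),
      subordinator (fun t w => (N t w)%:R) &
      forall t (j : nat), 0 < t ->
        P [set w | N t w = j] = (poisson_pmf (rate * t) j)%:E].

Definition uniform_1_to (k : nat) (X : T -> nat) : Prop :=
  measurable_fun setT X /\
  forall j : nat, (1 <= j <= k)%N -> P [set w | X w = j] = (k%:R^-1)%:E.

(* The summands X_1, X_2, ... are indexed from 0. *)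
Definition PPoK (k : nat) (lam : R) (M : R -> T -> R) : Prop :=
  exists (N : R -> T -> nat) (X : nat -> T -> nat),
    [/\ poisson_process (k%:R * lam) N,
        forall i, uniform_1_to k (X i),
        mutually_independent P X,
        independent_sigma_algebras P
          (family_sigma_algebra [set t | 0 <= t] N)
          (family_sigma_algebra setT X) &
        forall t w, 0 <= t -> M t w = \sum_(i < N t w) (X i w)%:R].

Definition SPoK (k : nat) (lam1 lam2 : R) (S : R -> T -> R) : Prop :=
  exists M1 M2 : R -> T -> R,
    [/\ PPoK k lam1 M1, PPoK k lam2 M2, independent_processes P M1 M2 &
        forall t w, 0 <= t -> S t w = M1 t w - M2 t w].

Definition stable_subordinator (alpha : R) (D : R -> T -> R) : Prop :=
  subordinator D /\
  forall s t, 0 < s -> 0 <= t ->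
    ('E_P[fun w => expR (- (s * D t w))])%E = (expR (- (t * s `^ alpha)))%:E.

Definition path_inverse (D : R -> T -> R) (t : R) (w : T) : R :=
  inf [set r | 0 <= r /\ t < D r w].

Definition FSPoK (k : nat) (lam1 lam2 alpha : R) (FS : R -> T -> R) : Prop :=
  (alpha = 1 /\ SPoK k lam1 lam2 FS) \/
  (0 < alpha < 1 /\
   exists S D : R -> T -> R,
     [/\ SPoK k lam1 lam2 S, stable_subordinator alpha D,
         independent_processes P (path_inverse D) S &
         forall t w, 0 <= t -> FS t w = S (path_inverse D t w) w]).

Definition gamma_subordinator (a b : R) (Z : R -> T -> R) : Prop :=
  subordinator Z /\
  forall s t, 0 < s -> 0 <= t ->
    ('E_P[fun w => expR (- (s * Z t w))])%E =
      (expR (- (t * (b * ln (1 + s / a)))))%:E.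

Definition has_density_on_pos (X : T -> R) (f : R -> R) : Prop :=
  forall B : set R, measurable B ->
    P [set w | B (X w)] =
    (\int[lebesgue_measure]_(x in B `&` `]0%R, +oo[) (f x)%:E)%E.

Definition pmf_at (X : T -> R) (n : int) : R :=
  fine (P [set w | X w = n%:~R]).

End processes.

Section special_functions.
Context (R : realType).

Definition Gamma (x : R) : R :=
  (\int[lebesgue_measure]_(y in `]0%R, +oo[) (y `^ (x - 1) * expR (- y)))%R.

Definition digamma (x : R) : R := derive1 Gamma x / Gamma x.

Definition gamma_density (a b x t : R) : R :=
  a `^ (b * t) / Gamma (b * t) * x `^ (b * t - 1) * expR (- (a * x)).

End special_functions.

Section riemann_liouville.
Context (R : realType).

(* \int_0^u f(s) / (u - s)^(gam + 1 - m) ds and its integrand; for gam >= 0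
   not an integer, m = truncn gam + 1. *)
Definition RL_kernel (gam : R) (f : R -> R) (u s : R) : R :=
  f s / (u - s) `^ (gam + 1 - (Num.truncn gam).+1%:R).

Definition RL_integral (gam : R) (f : R -> R) (u : R) : R :=
  (\int[lebesgue_measure]_(s in `]0%R, u[) RL_kernel gam f u s)%R.

Definition RL_derive (gam : R) (f : R -> R) (t : R) : R :=
  if gam \is a Num.nat then derive1n (Num.truncn gam) f t
  else (Gamma ((Num.truncn gam).+1%:R - gam))^-1 *
       derive1n (Num.truncn gam).+1 (RL_integral gam f) t.

Definition n_derivable_pos (m : nat) (f : R -> R) : Prop :=
  forall (i : nat) (t : R), (i < m)%N -> 0 < t -> derivable (derive1n i f) t 1.

(* [RL_derive] is total (divergent integrals and missing derivatives get
   default values); this says that it is meaningful at every t > 0. *)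
Definition RL_derivable (gam : R) (f : R -> R) : Prop :=
  if gam \is a Num.nat then n_derivable_pos (Num.truncn gam) f
  else (forall u, 0 < u ->
          lebesgue_measure.-integrable `]0%R, u[
            (fun s => (RL_kernel gam f u s)%:E)) /\
       n_derivable_pos (Num.truncn gam).+1 (RL_integral gam f).

End riemann_liouville.

(* Main.v *)
Require Import Defs.
From HB Require Import structures.
From mathcomp Require Import all_boot all_order all_algebra.
From mathcomp Require Import all_classical all_reals all_analysis.
From mathcomp Require Import measurable_realfun lebesgue_integral_under ring lra.
Set Implicit Arguments.
Unset Strict Implicit.
Unset Printing Implicit Defensive.
Import Order.TTheory GRing.Theory Num.Theory.
Import numFieldNormedType.Exports.
Local Open Scope ring_scope.
Local Open Scope classical_set_scope.

(** The probability [pf t] is a mixture: conditioning on the independent time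
    [Z t] gives [pf t] as the integral of [p x * g x t] over [x > 0]
    ([pmf_at_random_time]). The time [t] enters only through the gamma density,
    whose logarithmic derivative in [t] is [b (log a - psi (b t) + log x)]
    ([derive1_gamma_density]). Differentiating under the integral sign gives the
    equation of order [1]
      [pf' t = b (log a - psi (b t)) pf t + b (integral of p x log x g x t)],
    and the equation of order [gam] follows by applying the derivative of order
    [gam - 1] to both sides and moving it inside the integral over [x]. For an
    integer [gam] this is again differentiation under the integral sign
    ([equation_integer_order]).

    For a fractional [gam] the behaviour at [t = 0] matters in three places: the
    fractional integrals have to converge although [psi] has a pole at [0],
    they have to be smooth in their upper end, and the derivative of order
    [gam] of [pf] is that of order [gam - 1] of [pf'] only if [pf] vanishes at
    [0]. All three are settled by one remark. The density is
      [b t / Gamma (b t + 1) * a ^ (b t) * x ^ (b t - 1) * exp (- a x)],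
    so if [p x = O (x ^ delta)] with [0 < delta <= 1], then the mixture makes
    sense and is smooth for [t > - delta / b], and the factor [b t] makes it
    vanish at [0] ([mixture_smooth], [mixture0]). The fractional integral
    becomes an Abel integral of a function that is smooth across [0], rescaled
    to a fixed domain, where differentiation and Fubini's theorem apply
    ([derive1_abel], [abel_exchange], [equation_fractional_order]).

    The bound on [p] for [n <> 0] comes from the processes ([FSPoK_regular]): a
    nonzero value at a small time [x] requires a jump of one of the Poisson
    processes, and for [alpha < 1] the inverse stable clock at [x] rarely
    exceeds [x ^ (alpha / 2)], by a Chernoff bound. For [n = 0] the same
    estimate shows that [pf] tends to [1] at [0]; the pole of [psi] then makes
    the fractional integral of the first term on the right diverge
    ([terms_undefined]), so that the equation of fractional order has then no
    meaning. *)

(** * Smooth functions on a half-line *)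

Section smooth_functions.
Context {R : realType}.
Implicit Types (f g : R -> R) (l t : R) (n i : nat).

(** The left endpoint [l] is tracked because everything hinges on functions of
    a positive time that stay smooth a little to the left of [0]. *)
Record smooth l f : Prop := Smooth {
  derivable_derive1n : forall i t, l < t -> derivable (derive1n i f) t 1 }.

Lemma nbhs_gt l t : l < t -> \forall s \near t, l < s.
Proof. by move=> lt; exact: lt_nbhsr. Qed.

Lemma derive1_eq l f g : (forall t, l < t -> f t = g t) ->
  forall t, l < t -> (derive1 f) t = (derive1 g) t.
Proof.
move=> fg t lt; rewrite !derive1E; apply: near_eq_derive.
by near=> s; apply: fg; near: s; exact: nbhs_gt.
Unshelve. all: by end_near. Qed.

Lemma derive1n_eq l f g : (forall t, l < t -> f t = g t) ->
  forall i t, l < t -> (derive1n i f) t = (derive1n i g) t.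
Proof.
move=> fg i; elim: i => [|i IH] t lt; first exact: fg.
by rewrite !derive1nS; exact: derive1_eq lt.
Qed.

Lemma derivable_eq l f g t : (forall t, l < t -> f t = g t) -> l < t ->
  derivable f t 1 -> derivable g t 1.
Proof.
move=> fg lt; apply: near_eq_derivable; rewrite ?oner_eq0//.
by near=> s; apply: fg; near: s; exact: nbhs_gt.
Unshelve. all: by end_near. Qed.

Lemma smooth_eq l f g : (forall t, l < t -> f t = g t) ->
  smooth l f -> smooth l g.
Proof.
move=> fg [sf]; split=> i t lt.
apply: (@derivable_eq l (derive1n i f)) => //; last exact: sf.
exact: derive1n_eq.
Qed.

Lemma smooth_widen l l' f : l <= l' -> smooth l f -> smooth l' f.
Proof. by move=> ll' [sf]; split=> i t lt; apply: sf; exact: le_lt_trans lt. Qed.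

Lemma smooth_derivable l f : smooth l f -> forall t, l < t -> derivable f t 1.
Proof. by move=> [sf]; exact: (sf 0%N). Qed.

Lemma smooth_continuous l f : smooth l f -> forall t, l < t -> {for t, continuous f}.
Proof.
move=> sf t lt; apply: differentiable_continuous.
exact/derivable1_diffP/(smooth_derivable sf).
Qed.

Lemma smooth_derive1n l f i : smooth l f -> smooth l (derive1n i f).
Proof.
move=> [sf]; split=> j t lt; have := sf (j + i)%N t lt.
by rewrite /derive1n iterD.
Qed.

Lemma smooth_derive1 l f : smooth l f -> smooth l (derive1 f).
Proof. exact: (@smooth_derive1n l f 1%N). Qed.

Lemma smooth_is_derive l f : smooth l f ->
  forall t, l < t -> is_derive t 1 f ((derive1 f) t).
Proof.
by move=> sf t lt; rewrite derive1E; apply: derivableP; exact: smooth_derivable sf _ lt.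
Qed.

(** Coinduction: in a class of functions stable under differentiation, the
    derivatives of every order stay in the class. Exponentials, inverses and
    integrals with a parameter are all handled by choosing such a class. *)
Lemma smooth_coind l (A : (R -> R) -> Prop) :
  (forall f, A f -> exists2 g, A g & forall t, l < t -> is_derive t 1 f (g t)) ->
  forall f, A f -> smooth l f.
Proof.
move=> HA f Af; split=> i.
suff [h Ah hE] : exists2 h, A h & forall t, l < t -> (derive1n i f) t = h t.
  move=> t lt; have [g _ /(_ _ lt) [dg _]] := HA _ Ah.
  by apply: derivable_eq lt dg => s ls; rewrite hE.
elim: i => [|i [h Ah hE]]; first by exists f.
have [g Ag gE] := HA _ Ah; exists g => // t lt.
rewrite derive1nS (derive1_eq hE lt) derive1E.
by have := gE _ lt => -[_ ->].
Qed.

Lemma smooth_cst l (c : R) : smooth l (fun=> c).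
Proof.
apply: (@smooth_coind l (fun f => exists c, f = fun=> c)); last by exists c.
move=> _ [{}c ->]; exists (fun=> 0); first by exists 0.
move=> t lt; exact: is_derive_cst.
Qed.

Lemma smooth_lin l f g (c : R) : smooth l f -> smooth l g ->
  smooth l (fun t => f t + c * g t).
Proof.
move=> sf sg; pose A h := exists f g, [/\ smooth l f, smooth l g &
  h = fun t => f t + c * g t].
apply: (@smooth_coind l A); last by exists f, g.
move=> _ [{sf}f [{sg}g [sf sg ->]]]; exists (fun t => (derive1 f) t + c * (derive1 g) t).
  exists (derive1 f), (derive1 g); split => //; exact: smooth_derive1.
move=> t lt; have df := smooth_is_derive sf lt.
have dg := smooth_is_derive sg lt.
have -> : (fun t => f t + c * g t) = f + (c \*: g) by exact/funext.
by apply: is_derive_eq => /=; rewrite /GRing.scale.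
Qed.

Lemma derive1n_lin l f g (c : R) : smooth l f -> smooth l g -> forall i t, l < t ->
  (fun t => f t + c * g t)^`(i) t = (derive1n i f) t + c * (derive1n i g) t.
Proof.
move=> sf sg i; elim: i => [//|i IH] t lt.
rewrite !derive1nS (derive1_eq IH lt) derive1E.
have df := smooth_is_derive (smooth_derive1n i sf) lt.
have dg := smooth_is_derive (smooth_derive1n i sg) lt.
have -> : (fun t => (derive1n i f) t + c * (derive1n i g) t) = (derive1n i f) + (c \*: (derive1n i g)) by exact/funext.
by rewrite derive_val.
Qed.

Lemma smoothD l f g : smooth l f -> smooth l g -> smooth l (fun t => f t + g t).
Proof.
move=> sf sg; apply: (smooth_eq _ (smooth_lin 1 sf sg)) => t _.
by rewrite mul1r.
Qed.

Lemma derive1nD l f g : smooth l f -> smooth l g -> forall i t, l < t ->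
  (fun t => f t + g t)^`(i) t = (derive1n i f) t + (derive1n i g) t.
Proof.
move=> sf sg i t lt; have := derive1n_lin 1 sf sg i lt; rewrite mul1r => <-.
by congr (derive1n _ _ _); apply/funext => s; rewrite mul1r.
Qed.

Lemma derive1nZ l f (c : R) : smooth l f -> forall i t, l < t ->
  (fun t => c * f t)^`(i) t = c * (derive1n i f) t.
Proof.
move=> sf i t lt; have := derive1n_lin c (smooth_cst l 0) sf i lt.
have -> : (fun t => 0 + c * f t) = (fun t => c * f t).
  by apply/funext => s; rewrite add0r.
move=> ->; rewrite [X in X + _](_ : _ = 0) ?add0r//.
case: i => [//|i]; rewrite derive1Sn (@derive1n_eq l _ (fun=> 0))//.
  by elim: i t lt => [//|i IH] t lt; rewrite derive1nS (derive1_eq IH lt) derive1_cst.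
by move=> s _; rewrite derive1_cst.
Qed.

(** A finite order of differentiability, for proofs by induction on it. *)
Definition nsmooth l n f := forall i t, (i < n)%N -> l < t -> derivable ((derive1n i f)) t 1.

Lemma nsmoothS l n f g : (forall t, l < t -> is_derive t 1 f (g t)) ->
  nsmooth l n g -> nsmooth l n.+1 f.
Proof.
move=> fg sg [|i] t i_n lt; first by have [] := fg _ lt.
rewrite derive1Sn.
apply: (@derivable_eq l (derive1n i g) _ _ _ lt); last exact: sg.
move=> s ls; apply: (derive1n_eq (l := l)) => // r lr.
by rewrite derive1E; have [_ <-] := fg _ lr.
Qed.

Lemma nsmoothD l n f g : nsmooth l n f -> nsmooth l n g -> nsmooth l n (f + g).
Proof.
elim: n f g => [|n IH] f g sf sg; first by move=> i t.
have [df dg] : (forall t, l < t -> derivable f t 1) /\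
    forall t, l < t -> derivable g t 1.
  by split => t lt; [exact: (sf 0%N)|exact: (sg 0%N)].
apply: (@nsmoothS l n _ ((derive1 f) + (derive1 g))).
  move=> t lt; have /derivableP dft := df _ lt; have /derivableP dgt := dg _ lt.
  by apply: is_derive_eq; rewrite [RHS]/= !fctE !derive1E.
by apply: IH => i t i_n lt; rewrite -derive1Sn; [exact: sf|exact: sg].
Qed.

(** The derivative of a product is a sum of two products, so the coinductive
    class would have to contain all sums of products; an induction on a finite
    order avoids it. *)
Lemma smoothM l f g : smooth l f -> smooth l g -> smooth l (fun t => f t * g t).
Proof.
move=> sf sg.
suff : forall n, nsmooth l n (f * g) by move=> H; split=> i t lt; exact: (H i.+1).
move=> n; elim: n f g sf sg => [|n IH] f g sf sg; first by move=> i t.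
apply: (@nsmoothS l n _ (f * (derive1 g) + g * (derive1 f))).
  move=> t lt; have df := smooth_is_derive sf lt.
  have dg := smooth_is_derive sg lt.
  by apply: is_derive_eq; rewrite /GRing.scale /=.
by apply: nsmoothD; apply: IH => //; exact: smooth_derive1.
Qed.

Lemma derive1M l f g : smooth l f -> smooth l g -> forall t, l < t ->
  (fun t => f t * g t)^`() t = (derive1 f) t * g t + f t * (derive1 g) t.
Proof.
move=> sf sg t lt; have df := smooth_is_derive sf lt.
have dg := smooth_is_derive sg lt.
have -> : (fun t => f t * g t) = f * g by exact/funext.
by rewrite derive1E derive_val /GRing.scale/= addrC (mulrC (g t)).
Qed.

Lemma smooth_expR l f : smooth l f -> smooth l (fun t => expR (f t)).
Proof.
move=> sf; pose A h := exists2 g, smooth l g & h = fun t => g t * expR (f t).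
apply: (@smooth_eq l (fun t => 1 * expR (f t))).
  by move=> t _; rewrite mul1r.
apply: (@smooth_coind l A); last by exists (fun=> 1) => //; exact: smooth_cst.
move=> _ [g sg ->].
exists (fun t => ((derive1 g) t + g t * (derive1 f) t) * expR (f t)).
  eexists; last by [].
  apply: smoothD; first exact: smooth_derive1.
  by apply: smoothM => //; exact: smooth_derive1.
move=> t lt; have df := smooth_is_derive sf lt.
have dg := smooth_is_derive sg lt.
have -> : (fun t => g t * expR (f t)) = g * (expR \o f) by exact/funext.
by apply: is_derive_eq; rewrite /GRing.scale /=; ring.
Qed.

Lemma smoothV l f : (forall t, l < t -> f t != 0) -> smooth l f ->
  smooth l (fun t => (f t)^-1).
Proof.
(* a class stable under differentiation: smooth numerators over powers of [f] *)
move=> f0 sf; pose A h := exists2 g, smooth l g & exists n,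
  h = fun t => g t * (f t)^-1 ^+ n.
apply: (@smooth_eq l (fun t => 1 * (f t)^-1 ^+ 1)).
  by move=> t _; rewrite mul1r.
apply: (@smooth_coind l A); last first.
  by exists (fun=> 1); [exact: smooth_cst|exists 1%N].
move=> _ [g sg [n ->]].
exists (fun t => ((derive1 g) t * f t - n%:R * g t * (derive1 f) t) * (f t)^-1 ^+ n.+1).
  exists (fun t => (derive1 g) t * f t + - n%:R * (g t * (derive1 f) t)); last first.
    by exists n.+1; apply/funext => t; congr (_ * _); ring.
  apply: smooth_lin; apply: smoothM => //; exact: smooth_derive1.
move=> t lt; have df := smooth_is_derive sf lt.
have dg := smooth_is_derive sg lt.
have dV := is_deriveV (f0 _ lt) df.
have -> : (fun t => g t * (f t)^-1 ^+ n) = g * (fun t => (f t)^-1) ^+ n.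
  by apply/funext => s; rewrite fctE; congr (_ * _); elim: n => [//|n IH]; rewrite !exprS IH.
apply: is_derive_eq; rewrite /GRing.scale /= /GRing.scale /=.
have -> : ((fun t => (f t)^-1) ^+ n) t = (f t)^-1 ^+ n.
  by elim: n => [//|n IH]; rewrite !exprS -IH.
have fw : f t * (f t)^-1 = 1 by rewrite mulfV// f0.
case: n => [|n]; rewrite -exprVn/= !exprS ?expr0.
  by ring: fw.
by ring: fw.
Qed.

Lemma smooth_id l : smooth l id.
Proof.
pose A h := h = id \/ exists c : R, h = fun=> c.
apply: (@smooth_coind l A); last by left.
move=> _ [->|[c ->]].
  by exists (fun=> 1); [right; exists 1|move=> t _; exact: is_derive_id].
by exists (fun=> 0); [right; exists 0|move=> t _; exact: is_derive_cst].
Qed.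

Lemma is_derive_affine (c e t : R) : is_derive t 1 (fun s => c * s + e) c.
Proof.
have -> : (fun s => c * s + e) = (c \*: id) + cst e by exact/funext.
by apply: is_derive_eq; rewrite /GRing.scale /= mulr1 addr0.
Qed.

Lemma smooth_affine l l' f (c e : R) : (forall t, l' < t -> l < c * t + e) ->
  smooth l f -> smooth l' (fun t => f (c * t + e)).
Proof.
move=> ll' sf; pose A h := exists2 g, smooth l g & h = fun t => g (c * t + e).
apply: (@smooth_coind l' A); last by exists f.
move=> _ [g sg ->].
exists (fun t => c * (derive1 g) (c * t + e)).
  exists (fun t => 0 + c * (derive1 g) t).
    by apply: smooth_lin; [exact: smooth_cst|exact: smooth_derive1].
  by apply/funext => t; rewrite add0r.
move=> t lt; have dg := smooth_is_derive sg (ll' _ lt).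
have da := is_derive_affine c e t.
have := @is_derive1_comp _ g (fun t => c * t + e) t _ _ dg da.
by rewrite mulrC.
Qed.

Lemma derive1n_scale l l' f (c : R) : (forall t, l' < t -> l < c * t) ->
  smooth l f -> forall i t, l' < t ->
  (fun t => f (c * t))^`(i) t = c ^+ i * (derive1n i f) (c * t).
Proof.
move=> ll' sf i; elim: i => [|i IH] t lt; first by rewrite expr0 mul1r.
rewrite derive1nS (derive1_eq IH lt) derive1E.
have dg := smooth_is_derive (smooth_derive1n i sf) (ll' _ lt).
have da : is_derive t 1 (fun t => c * t) c.
  have -> : (fun t : R => c * t) = fun t => c * t + 0.
    by apply/funext => s; rewrite addr0.
  exact: is_derive_affine.
have dc := @is_derive1_comp _ (derive1n i f) (fun t => c * t) t _ _ dg da.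
have -> : (fun t => c ^+ i * (derive1n i f) (c * t)) = c ^+ i \*: ((derive1n i f) \o (fun t => c * t)).
  exact/funext.
rewrite derive_val /GRing.scale/= exprSr -derive1nS; ring.
Qed.

Lemma smooth_ln : smooth 0 (@ln R).
Proof.
split=> -[|i] t lt.
  by have [] := is_derive1_ln lt.
rewrite derive1Sn; apply: (@derivable_eq 0 (fun s => s^-1)^`(i) _ _ _ lt).
  apply: derive1n_eq => s ls; rewrite derive1E.
  by have := is_derive1_ln ls => -[_ ->].
apply: (derivable_derive1n (l := 0)) => //; apply: (@smoothV 0 id) => //.
  by move=> s ls; rewrite gt_eqF.
exact: smooth_id.
Qed.

Lemma smooth_powR (e : R) : smooth 0 (fun t => t `^ e).
Proof.
apply: (@smooth_eq 0 (fun t => expR (e * ln t))).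
  by move=> t lt; rewrite /powR gt_eqF.
by apply: smooth_expR; apply: smoothM; [exact: smooth_cst|exact: smooth_ln].
Qed.

End smooth_functions.

(** * Smooth families and differentiation under the integral sign *)

Section smooth_families.
Context {R : realType} {d : measure_display} {Y : measurableType d}.
Variables (mu : {measure set Y -> \bar R}) (D : set Y).
Hypothesis mD : measurable D.
Implicit Types (F : Y -> R -> R) (f : R -> R) (l t : R).

Definition dominated l F := forall c e : R, l < c ->
  exists2 G : Y -> R, mu.-integrable D (EFin \o G) &
    forall x t, D x -> c <= t <= e -> `|F x t| <= G x.

(** Domination of every derivative, locally uniformly in [t], is what lets the
    integral over [x] be differentiated any number of times. *)
Record smooth_family l F : Prop := SmoothFamily {
  family_measurable : forall t, l < t -> measurable_fun D (F ^~ t) ;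
  family_smooth : forall x, D x -> smooth l (F x) ;
  family_dominated : forall i, dominated l (fun x => derive1n i (F x)) }.

Lemma dominated_eq l F F' : (forall x t, D x -> l < t -> F x t = F' x t) ->
  dominated l F -> dominated l F'.
Proof.
move=> FF' dF c e lc; have [G iG GF] := dF c e lc; exists G => // x t Dx /andP[ct te].
by rewrite -FF' ?(lt_le_trans lc ct)// GF// ct.
Qed.

Lemma dominatedD l F F' : dominated l F -> dominated l F' ->
  dominated l (fun x t => F x t + F' x t).
Proof.
move=> dF dF' c e lc; have [G iG GF] := dF c e lc.
have [G' iG' GF'] := dF' c e lc; exists (fun x => G x + G' x).
  exact: (integrableD mD iG iG').
move=> x t Dx cte; rewrite (le_trans (ler_normD _ _))// lerD//; [exact: GF|exact: GF'].
Qed.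

Lemma continuous_bounded l f : (forall t, l < t -> {for t, continuous f}) ->
  forall c e : R, l < c -> exists2 M, 0 <= M & forall t, c <= t <= e -> `|f t| <= M.
Proof.
move=> cf c e lc; have [ce|ec] := leP c e; last first.
  exists 0 => // t /andP[ct te]; have := le_lt_trans (le_trans ct te) ec.
  by rewrite ltxx.
have cfce : {within `[c, e], continuous (fun t => `|f t|)}.
  apply: continuous_in_subspaceT => t; rewrite inE/= in_itv/= => /andP[ct te].
  apply: (continuous_comp (cf t (lt_le_trans lc ct))).
  exact: norm_continuous.
have [m _ mM] := EVT_max ce cfce.
exists `|f m| => // t cte; apply: mM; by rewrite in_itv.
Qed.

Lemma dominatedM l f F : (forall t, l < t -> {for t, continuous f}) ->
  dominated l F -> dominated l (fun x t => f t * F x t).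
Proof.
move=> cf dF c e lc; have [G iG GF] := dF c e lc.
have [M M0 fM] := continuous_bounded cf e lc.
exists (fun x => M * G x); first exact: (integrableZl mD M iG).
move=> x t Dx cte; rewrite normrM ler_pM//; [exact: fM|exact: GF].
Qed.

Lemma family_eq l F F' : (forall x t, D x -> l < t -> F x t = F' x t) ->
  smooth_family l F -> smooth_family l F'.
Proof.
move=> FF' [mF sF dF]; split.
- move=> t lt; apply: eq_measurable_fun (mF t lt) => x; rewrite inE => Dx.
  exact: FF'.
- by move=> x Dx; apply: smooth_eq (sF x Dx) => t lt; exact: FF'.
- move=> i; apply: dominated_eq (dF i) => x t Dx lt.
  by apply: derive1n_eq lt => s ls; exact: FF'.
Qed.

Lemma family_widen l l' F : l <= l' -> smooth_family l F -> smooth_family l' F.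
Proof.
move=> ll' [mF sF dF]; split.
- by move=> t lt; apply: mF; exact: le_lt_trans lt.
- by move=> x Dx; apply: smooth_widen (sF x Dx).
- by move=> i c e lc; apply: dF; exact: le_lt_trans lc.
Qed.

(** Counterpart of [smooth_coind]: the members of a class stable under
    differentiation need a dominating function only for themselves, since their
    derivatives are members too. *)
Lemma family_coind l (A : (Y -> R -> R) -> Prop) :
  (forall F, A F -> forall t, l < t -> measurable_fun D (F ^~ t)) ->
  (forall F, A F -> dominated l F) ->
  (forall F, A F -> exists2 F', A F' & forall x t, D x -> l < t ->
     is_derive t 1 (F x) (F' x t)) ->
  forall F, A F -> smooth_family l F.
Proof.
move=> Am Ad As F AF.
have H i : exists2 F', A F' & forall x t, D x -> l < t ->
    derive1n i (F x) t = F' x t.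
  elim: i => [|i [F' AF' F'E]]; first by exists F.
  have [F2 AF2 F2E] := As _ AF'; exists F2 => // x t Dx lt.
  rewrite derive1nS (@derive1_eq _ l _ (F' x))//; last by move=> s ls; exact: F'E.
  by rewrite derive1E; have [_ ->] := F2E x t Dx lt.
split; first exact: Am.
- move=> x Dx; apply: (@smooth_coind _ l (fun f => exists2 F', A F' & f = F' x)).
    move=> _ [F' AF' ->]; have [F2 AF2 F2E] := As _ AF'.
    by exists (F2 x); [exists F2|move=> t lt; exact: F2E].
  by exists F.
- move=> i; have [F' AF' F'E] := H i; apply: (@dominated_eq _ F'); last exact: Ad.
  by move=> x t Dx lt; rewrite F'E.
Qed.

Lemma dominated_derive1nM l F f : smooth l f ->
  (forall x, D x -> smooth l (F x)) ->
  (forall i, dominated l (fun x => derive1n i (F x))) ->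
  forall i, dominated l (fun x => derive1n i (fun t => f t * F x t)).
Proof.
move=> sf sF dF i; elim: i F f sf sF dF => [|i IH] F f sf sF dF.
  apply: dominatedM (dF 0%N) => t; exact: smooth_continuous.
pose F1 x t := derive1 f t * F x t; pose F2 x t := f t * derive1 (F x) t.
have sF1 x : D x -> smooth l (F1 x).
  by move=> Dx; apply: smoothM; [exact: smooth_derive1|exact: sF].
have sF2 x : D x -> smooth l (F2 x).
  by move=> Dx; apply: smoothM => //; apply: smooth_derive1; exact: sF.
apply: (@dominated_eq _ (fun x t => derive1n i (F1 x) t + derive1n i (F2 x) t)).
  move=> x t Dx lt; rewrite derive1Sn -(derive1nD (sF1 x Dx) (sF2 x Dx))//.
  apply: derive1n_eq lt => s ls; rewrite /F1 /F2 (@derive1M _ l)//.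
  exact: sF.
apply: dominatedD; apply: IH => //; first exact: smooth_derive1.
  by move=> x Dx; apply: smooth_derive1; exact: sF.
move=> j; apply: dominated_eq (dF j.+1) => x t Dx lt.
by rewrite derive1Sn.
Qed.

(** Continuous functions of [t] are bounded on compact intervals, so by the
    Leibniz rule a factor depending on [t] alone preserves domination. *)
Lemma familyM l F f : smooth l f -> smooth_family l F ->
  smooth_family l (fun x t => f t * F x t).
Proof.
move=> sf [mF sF dF]; split; last exact: dominated_derive1nM.
  by move=> t lt; apply: measurable_funM => //; exact: mF.
by move=> x Dx; apply: smoothM => //; exact: sF.
Qed.

(** The difference quotients are measurable, hence so is their limit. *)
Lemma measurable_derive1 l F : (forall t, l < t -> measurable_fun D (F ^~ t)) ->
  (forall x, D x -> forall t, l < t -> derivable (F x) t 1) ->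
  forall t, l < t -> measurable_fun D (fun x => derive1 (F x) t).
Proof.
move=> mF dF t lt.
pose h (n : nat) : R := n.+1%:R^-1.
have h0 n : h n != 0 by rewrite invr_eq0 pnatr_eq0.
have hc : h n @[n --> \oo] --> (0 : R) by exact: cvg_harmonic.
apply: (@measurable_fun_cvg _ _ _ _ (fun n x => (h n)^-1 * (F x (h n + t) - F x t))).
- move=> n; apply: measurable_funM => //.
  apply: measurable_funB; last exact: mF.
  by apply: mF; rewrite (lt_le_trans lt)// lerDr invr_ge0.
- move=> x Dx; have /cvg_ex[/= L HL] := dF x Dx t lt.
  have -> : derive1 (F x) t = L.
    rewrite derive1E; apply/cvg_lim => //.
  move: HL; under eq_fun do rewrite scaler1.
  move/cvgr_dnbhsP => /(_ h); apply; split => //.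
Qed.

Lemma family_measurable_derive1n l F : smooth_family l F ->
  forall i t, l < t -> measurable_fun D (fun x => derive1n i (F x) t).
Proof.
move=> [mF sF _]; elim=> [|i IH] t lt; first exact: mF.
apply: (@measurable_derive1 l (fun x => derive1n i (F x))) => //.
by move=> x Dx s ls; apply: (derivable_derive1n (l := l)) => //; exact: sF.
Qed.

Lemma family_derive1 l F : smooth_family l F ->
  smooth_family l (fun x => derive1 (F x)).
Proof.
move=> sF; have [mF sF' dF] := sF; split.
- exact: (family_measurable_derive1n sF 1%N).
- by move=> x Dx; apply: smooth_derive1; exact: sF'.
- by move=> i; apply: dominated_eq (dF i.+1) => x t _ _; rewrite derive1Sn.
Qed.

Lemma family_integrable l F : smooth_family l F -> forall t, l < t ->
  mu.-integrable D (fun x => (F x t)%:E).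
Proof.
move=> [mF _ dF] t lt; have [G iG GF] := dF 0%N t t lt.
apply: (le_integrable mD) iG; first exact/measurable_EFinP/mF.
move=> x Dx; rewrite lee_fin (le_trans (GF x t Dx _)) ?lexx//.
exact: ler_norm.
Qed.

Lemma family_integral_is_derive l F : smooth_family l F -> forall t, l < t ->
  is_derive t 1 (fun t => \int[mu]_(x in D) F x t)%R
                (\int[mu]_(x in D) derive1 (F x) t)%R.
Proof.
move=> sF t lt; have [mF sF' dF] := sF.
(* domination is only available on compact intervals, so stay away from [l] *)
pose u := (l + t) / 2; have lu : l < u by rewrite /u midf_lt.
have ut : u < t by rewrite /u midf_lt.
pose v := t + 1; have tv : t < v by rewrite ltrDl.
have [G iG GF] := dF 1%N u v lu.
have It : `]u, v[%classic t by rewrite /= in_itv/= ut tv.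
have intf : forall x, `]u, v[%classic x ->
    mu.-integrable D (EFin \o ((fun t x => F x t) x)).
  move=> s; rewrite /= in_itv/= => /andP[us _].
  by apply: family_integrable sF _ _; exact: lt_trans us.
have der1 : forall s x, `]u, v[%classic s -> D x ->
    derivable ((fun t x => F x t) ^~ x) s 1.
  move=> s x; rewrite /= in_itv/= => /andP[us _] Dx.
  by apply: smooth_derivable (sF' x Dx) _ _; exact: lt_trans us.
have G0 : forall x, 0 <= `|G x| by [].
have iG' : mu.-integrable D (EFin \o (fun x => `|G x|)).
  by have := integrable_norm iG.
have GF' : forall s x, `]u, v[%classic s -> D x ->
    `|partial1of2 (fun t x => F x t) s x| <= `|G x|.
  move=> s x; rewrite /= in_itv/= => /andP[us sv] Dx.
  by rewrite (le_trans (GF x s Dx _)) ?ler_norm// !ltW.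
apply: DeriveDef.
  exact: (@derivable_under_integral _ _ _ mu _ _ mD t u v It intf der1 _ G0 iG' GF').
rewrite -derive1E.
exact: (@differentiation_under_integral _ _ _ mu _ _ mD t u v It intf der1 _ G0 iG' GF').
Qed.

(** Differentiation under the integral sign, to every order. *)
Lemma derive1n_family_integral l F : smooth_family l F -> forall i t, l < t ->
  derive1n i (fun t => \int[mu]_(x in D) F x t)%R t =
  (\int[mu]_(x in D) derive1n i (F x) t)%R.
Proof.
move=> sF i; elim: i F sF => [//|i IH] F sF t lt.
rewrite derive1Sn.
under [in RHS]eq_Rintegral do rewrite derive1Sn.
rewrite -IH //; last exact: family_derive1.
apply: derive1n_eq lt => s ls; rewrite derive1E.
by have [_ ->] := family_integral_is_derive sF ls.
Qed.

Lemma family_integral_smooth l F : smooth_family l F ->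
  smooth l (fun t => \int[mu]_(x in D) F x t)%R.
Proof.
move=> sF; apply: (@smooth_coind _ l (fun f => exists2 F, smooth_family l F &
    f = fun t => \int[mu]_(x in D) F x t)%R); last by exists F.
move=> _ [{}F {}sF ->].
exists (fun t => \int[mu]_(x in D) derive1 (F x) t)%R.
  by exists (fun x => derive1 (F x)) => //; exact: family_derive1.
exact: family_integral_is_derive.
Qed.

End smooth_families.

(** * Improper integrals of derivatives *)

Section exhaustion.
Context {R : realType}.
Notation mu := (@lebesgue_measure R).
Variables (D : set R) (a b : nat -> R).
Hypothesis ab : forall n, a n < b n.
Hypothesis a_ni : forall m n, (m <= n)%N -> a n <= a m.
Hypothesis b_nd : forall m n, (m <= n)%N -> b m <= b n.
Hypothesis DE : D = \bigcup_n `[a n, b n].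

Let A n : set R := `[a n, b n]%classic.

Let A_nd : nondecreasing_seq A.
Proof.
move=> m n mn; rewrite subsetEset => x; rewrite /A /= !in_itv/= => /andP[amx xbm].
by rewrite (le_trans (a_ni mn) amx) (le_trans xbm (b_nd mn)).
Qed.

Let mA n : measurable (A n). Proof. exact: measurable_itv. Qed.

Let AD n : A n `<=` D. Proof. by rewrite DE; exact: bigcup_sup. Qed.

Let mD : measurable D.
Proof. by rewrite DE; exact: bigcup_measurable. Qed.

Variables (f F : R -> R).
Hypothesis cf : forall x, D x -> {for x, continuous f}.
Hypothesis dF : forall x, D x -> is_derive x 1 F (f x).

Let continuousF x : D x -> {for x, continuous F}.
Proof.
by move=> Dx; apply: differentiable_continuous; apply/derivable1_diffP; have [] := dF Dx.
Qed.

Let cfA n : {within A n, continuous f}.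
Proof. by apply: continuous_in_subspaceT => x; rewrite inE => /AD /cf. Qed.

Let mf : measurable_fun D f.
Proof.
rewrite DE; apply/measurable_fun_bigcup => //.
by move=> n; apply: (subspace_continuous_measurable_fun (mA n)); exact: cfA.
Qed.

Lemma exhaustion_FTC n : (\int[mu]_(x in A n) (f x)%:E = (F (b n) - F (a n))%:E)%E.
Proof.
have Aab : A n (a n) /\ A n (b n) by rewrite /A /= !in_itv/= !lexx !(ltW (ab n)).
have aD := AD Aab.1; have bD := AD Aab.2.
rewrite EFinB; apply: (continuous_FTC2 (ab n) (@cfA n)).
- split.
  + move=> x /subset_itv_oo_cc xab; have [] // := dF (@AD n x xab).
  + exact/cvg_at_right_filter/continuousF.
  + exact/cvg_at_left_filter/continuousF.
- move=> x /subset_itv_oo_cc xab; rewrite derive1E.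
  by have [_ ->] := dF (@AD n x xab).
Qed.

(** By monotone convergence: the integrals over the compact pieces are
    increments of the bounded antiderivative. *)
Lemma bounded_antiderivative_integrable (B : R) :
  (forall x, D x -> 0 <= f x) -> (forall x, D x -> `|F x| <= B) ->
  mu.-integrable D (EFin \o f).
Proof.
move=> f0 FB; apply/integrableP; split; first exact/measurable_EFinP.
have -> : (\int[mu]_(x in D) `|(EFin \o f) x| = \int[mu]_(x in D) (EFin \o f) x)%E.
  by apply: eq_integral => x; rewrite inE => Dx /=; rewrite ger0_norm// f0.
rewrite DE; apply: (@le_lt_trans _ _ (B + B)%:E); last exact: ltry.
have mfA n : measurable_fun (A n) (EFin \o f).
  by apply/measurable_EFinP; apply: measurable_funS mf => //; exact: AD.
have f0A n x : A n x -> (0 <= (EFin \o f) x)%E by move=> /AD /f0; rewrite lee_fin.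
have H : (\int[mu]_(x in A n) (EFin \o f) x)%E @[n --> \oo] -->
    (\int[mu]_(x in \bigcup_n A n) (EFin \o f) x)%E.
  exact: ge0_nondecreasing_set_cvg_integral.
rewrite -(cvg_lim _ H) //.
apply: lime_le.
  apply: ereal_nondecreasing_is_cvgn.
  exact: ge0_nondecreasing_set_nondecreasing_integral.
apply: nearW => n; rewrite exhaustion_FTC lee_fin.
rewrite (le_trans (ler_norm _))// (le_trans (ler_normB _ _))//.
by rewrite lerD// FB//; apply: (@AD n); rewrite /A /= in_itv/= lexx (ltW (ab n)).
Qed.

(** By dominated convergence, the absolute value of the integrand being the bound. *)
Lemma exhaustion_integral (L : R) : mu.-integrable D (EFin \o f) ->
  (F (b n) - F (a n)) @[n --> \oo] --> L -> (\int[mu]_(x in D) f x)%R = L.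
Proof.
move=> fi FL.
suff : (\int[mu]_(x in A n) (f x)%:E)%E @[n --> \oo] -->
       (\int[mu]_(x in D) (f x)%:E)%E.
  under eq_fun do rewrite exhaustion_FTC.
  move=> H; rewrite /Rintegral.
  have {}FL : (F (b n) - F (a n))%:E @[n --> \oo] --> L%:E by apply: cvg_EFin => //; exact: nearW.
  by rewrite (cvg_unique _ H FL).
rewrite [X in _ --> X]integral_mkcond.
under eq_fun do rewrite integral_mkcond.
apply: (@dominated_cvg _ _ _ mu _ _ _ _ ((abse \o EFin \o f) \_ D)) => //.
- move=> n; apply/(measurable_restrictT _ (mA n)) => //.
  by apply/measurable_EFinP; apply: measurable_funS mf => //; exact: AD.
- move=> x _; rewrite patchE; case: ifPn => [|/negP xD].
    rewrite inE {1}DE => -[N _ Nx].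
    apply: cvg_near_cst; near=> n.
    rewrite patchE mem_set//.
    have Nn : (N <= n)%N by near: n; exact: nbhs_infty_ge.
    by have := A_nd Nn; rewrite subsetEset; apply.
  apply: cvg_near_cst; apply: nearW => n; rewrite patchE memNset//.
  by move=> /AD /mem_set.
- by move=> x _; rewrite patchE; case: ifP.
- apply/integrable_restrict => //; rewrite setTI; exact: (integrable_abse fi).
- move=> n x _; rewrite !patchE; case: ifPn => [|_].
    by rewrite inE => /AD Dx; rewrite mem_set.
  by rewrite abse0; case: ifPn => // _; rewrite abse_ge0.
Unshelve. all: by end_near. Qed.

End exhaustion.

Section improper_integrals.
Context {R : realType}.
Notation mu := (@lebesgue_measure R).
Implicit Types (f F : R -> R).

Let invS n m : (m <= n)%N -> (n.+3%:R^-1 : R) <= m.+3%:R^-1.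
Proof. by move=> mn; rewrite lef_pV2 ?posrE ?ltr0n// ler_nat. Qed.

Let invS_cvg : (n.+3%:R^-1 : R) @[n --> \oo] --> (0 : R).
Proof.
have := @cvg_harmonic R; rewrite -(cvg_shiftn 2).
by under eq_fun do rewrite addn2.
Qed.

Let small_inv (e : R) : 0 < e -> exists n, n.+3%:R^-1 <= e.
Proof.
move=> e0; have := invS_cvg; move/cvgrPdist_le => /(_ e e0) [N _ HN].
by exists N; have := HN N (leqnn N); rewrite sub0r normrN ger0_norm.
Qed.

Let third n : (n.+3%:R^-1 : R) <= 3^-1.
Proof. by rewrite lef_pV2 ?posrE ?ltr0n// ler_nat. Qed.

Section bounded_interval.
Variables (a b : R).
Hypothesis ab : a < b.

(* [n + 3] keeps the two endpoints of each piece in the right order *)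
Let an n := a + (b - a) * n.+3%:R^-1.
Let bn n := b - (b - a) * n.+3%:R^-1.

Let anbn n : an n < bn n.
Proof.
rewrite /an /bn -subr_gt0.
have -> : b - (b - a) * n.+3%:R^-1 - (a + (b - a) * n.+3%:R^-1) =
  (b - a) * (1 - 2 * n.+3%:R^-1) by ring.
by rewrite mulr_gt0 ?subr_gt0//; move: (third n); set z := _.+3%:R^-1 => z3; lra.
Qed.

Let an_ni m n : (m <= n)%N -> an n <= an m.
Proof. by move=> mn; rewrite /an lerD2l ler_wpM2l ?subr_ge0 ?(ltW ab)// invS. Qed.

Let bn_nd m n : (m <= n)%N -> bn m <= bn n.
Proof. by move=> mn; rewrite /bn lerD2l lerN2 ler_wpM2l ?subr_ge0 ?(ltW ab)// invS. Qed.

Let itvE : `]a, b[%classic = \bigcup_n `[an n, bn n].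
Proof.
have ba0 : 0 < b - a by rewrite subr_gt0.
apply/seteqP; split => x /=.
  rewrite in_itv/= => /andP[ax xb].
  have [n hn] : exists n, n.+3%:R^-1 <= Num.min ((x - a) / (b - a)) ((b - x) / (b - a)).
    by apply: small_inv; rewrite lt_min !divr_gt0 ?subr_gt0.
  move: hn; rewrite le_min !ler_pdivlMr// => /andP[h1 h2].
  exists n => //=; rewrite in_itv/= /an /bn.
  by move: h1 h2; set z := _.+3%:R^-1 => h1 h2; apply/andP; split; lra.
move=> [n _ /=]; rewrite !in_itv/= /an /bn => /andP[h1 h2].
have n0 : (0 : R) < n.+3%:R^-1 by rewrite invr_gt0.
move: h1 h2 (mulr_gt0 ba0 n0); set z := _.+3%:R^-1 => h1 h2 z0; lra.
Qed.

Lemma integrable_oo f F (B : R) :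
  (forall x, a < x < b -> {for x, continuous f}) ->
  (forall x, a < x < b -> is_derive x 1 F (f x)) ->
  (forall x, a < x < b -> 0 <= f x) -> (forall x, a < x < b -> `|F x| <= B) ->
  mu.-integrable `]a, b[ (EFin \o f).
Proof.
move=> cf dF f0 FB.
by apply: (@bounded_antiderivative_integrable R _ an bn anbn an_ni bn_nd itvE f F _ _ B);
  move=> x; rewrite /= in_itv/=; first [exact: cf|exact: dF|exact: f0|exact: FB].
Qed.

Lemma FTC_oo f F (la lb : R) :
  (forall x, a < x < b -> {for x, continuous f}) ->
  (forall x, a < x < b -> is_derive x 1 F (f x)) ->
  mu.-integrable `]a, b[ (EFin \o f) ->
  F x @[x --> a^'+] --> la -> F x @[x --> b^'-] --> lb ->
  (\int[mu]_(x in `]a, b[) f x)%R = lb - la.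
Proof.
move=> cf dF fi Fa Fb.
have ba0 : 0 < b - a by rewrite subr_gt0.
have n0 n : (0 : R) < n.+3%:R^-1 by rewrite invr_gt0.
apply: (@exhaustion_integral R _ an bn anbn an_ni bn_nd itvE f F) => //;
  try by move=> x; rewrite /= in_itv/=; first [exact: cf|exact: dF].
have cinv : (b - a) * n.+3%:R^-1 @[n --> \oo] --> (0 : R).
  rewrite -[X in _ --> X](mulr0 (b - a)); apply: cvgM => //; exact: cvg_cst.
apply: cvgB.
  move/cvg_at_leftP : Fb; apply; split.
    by move=> n; rewrite /bn ltrBlDr ltrDl mulr_gt0.
  by rewrite -[X in _ --> X]subr0; apply: cvgB => //; exact: cvg_cst.
move/cvg_at_rightP : Fa; apply; split.
  by move=> n; rewrite /an ltrDl mulr_gt0.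
by rewrite -[X in _ --> X]addr0; apply: cvgD => //; exact: cvg_cst.
Qed.

End bounded_interval.

Section half_line.

Let an (n : nat) : R := n.+3%:R^-1.
Let bn (n : nat) : R := n.+3%:R.

Let anbn n : an n < bn n.
Proof.
rewrite /an /bn (@lt_le_trans _ _ 1)// ?ler1n// invf_lt1 ?ltr1n// ltr0n//.
Qed.

Let an_ni m n : (m <= n)%N -> an n <= an m. Proof. exact: invS. Qed.

Let bn_nd m n : (m <= n)%N -> bn m <= bn n.
Proof. by move=> mn; rewrite /bn ler_nat. Qed.

Let itvE : `]0, +oo[%classic = \bigcup_n `[an n, bn n].
Proof.
apply/seteqP; split => x /=.
  rewrite in_itv/= andbT => x0.
  have [n hn] := small_inv x0.
  have [m hm] : exists m : nat, x <= m%:R.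
    by exists (Num.truncn x).+1; rewrite ltW// truncnS_gt.
  exists (maxn n m) => //=; rewrite in_itv/=; apply/andP; split.
    by rewrite (le_trans _ hn)// invS// leq_maxl.
  by rewrite (le_trans hm)// /bn ler_nat (leq_trans (leq_maxr n m))// -addn3 leq_addr.
move=> [n _ /=]; rewrite !in_itv/= andbT => /andP[h _].
by apply: lt_le_trans h; rewrite /an invr_gt0.
Qed.

Lemma integrable_0y f F (B : R) :
  (forall x : R, 0 < x -> {for x, continuous f}) ->
  (forall x : R, 0 < x -> is_derive x 1 F (f x)) ->
  (forall x : R, 0 < x -> 0 <= f x) -> (forall x, 0 < x -> `|F x| <= B) ->
  mu.-integrable `]0, +oo[ (EFin \o f).
Proof.
move=> cf dF f0 FB.
by apply: (@bounded_antiderivative_integrable R _ an bn anbn an_ni bn_nd itvE f F _ _ B);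
  move=> x; rewrite /= in_itv/= andbT; first [exact: cf|exact: dF|exact: f0|exact: FB].
Qed.

Lemma FTC_0y f F (la lb : R) :
  (forall x : R, 0 < x -> {for x, continuous f}) ->
  (forall x : R, 0 < x -> is_derive x 1 F (f x)) ->
  mu.-integrable `]0, +oo[ (EFin \o f) ->
  F x @[x --> 0^'+] --> la -> F x @[x --> +oo%R] --> lb ->
  (\int[mu]_(x in `]0%R, +oo[) f x)%R = lb - la.
Proof.
move=> cf dF fi Fa Fb.
apply: (@exhaustion_integral R _ an bn anbn an_ni bn_nd itvE f F) => //;
  try by move=> x; rewrite /= in_itv/= andbT; first [exact: cf|exact: dF].
apply: cvgB.
  move/cvg_pinftyP : Fb; apply.
  have := @cvgr_idn R; rewrite -(cvg_shiftn 3); under eq_fun do rewrite addn3; exact.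
move/cvg_at_rightP : Fa; apply; split; last exact: invS_cvg.
by move=> n; rewrite /an invr_gt0.
Qed.

End half_line.

(** The logarithm is unbounded near zero. *)
Lemma invr_not_integrable (e : R) : 0 < e ->
  ~ mu.-integrable `]0, e[ (EFin \o (fun s => s^-1)).
Proof.
move=> e0 /integrableP[mf]; apply/negP; rewrite -leNgt.
rewrite leye_eq; apply/eqP/eqyP => A A0.
(* [a] is chosen so that the integral over [[a, e / 2]] is [A] *)
pose a := (e / 2) * expR (- A).
have e20 : 0 < e / 2 by rewrite divr_gt0.
have a0 : 0 < a by rewrite mulr_gt0// expR_gt0.
have aE : a < e / 2 by rewrite /a gtr_pMr// -expR0 ltr_expR oppr_lt0.
have -> : A = ln (e / 2) - ln a.
  have -> : ln a = ln (e / 2) - A by rewrite /a lnM ?posrE ?expR_gt0// expRK.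
  by ring.
rewrite EFinB -(@continuous_FTC2 _ (fun s => s^-1) (@ln R) _ _ aE).
- apply: (@le_trans _ _ (\int[mu]_(x in `[a, (e / 2)%R]) `|(EFin \o GRing.inv) x|)%E).
    apply: ge0_le_integral => //.
    + move=> x; rewrite /= in_itv/= => /andP[ax _].
      by rewrite lee_fin invr_ge0 ltW// (lt_le_trans a0).
    + apply: measurable_funS mf => // x; rewrite /= !in_itv/= => /andP[ax xe].
      by rewrite (lt_le_trans a0 ax)/= (le_lt_trans xe)//; lra.
    + apply/measurable_EFinP; apply: measurableT_comp => //.
      apply/measurable_EFinP.
      apply: measurable_funS mf => // x; rewrite /= !in_itv/= => /andP[ax xe].
      by rewrite (lt_le_trans a0 ax)/= (le_lt_trans xe)//; lra.
    + by move=> x _; rewrite lee_fin ler_norm.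
  apply: ge0_subset_integral => //.
    by apply: measurableT_comp.
  move=> x; rewrite /= !in_itv/= => /andP[ax xe].
  by rewrite (lt_le_trans a0 ax)/= (le_lt_trans xe)//; lra.
- apply: continuous_in_subspaceT => x; rewrite inE/= in_itv/= => /andP[ax _].
  by apply: inv_continuous; rewrite gt_eqF// (lt_le_trans a0).
- have cl x : a <= x -> {for x, continuous (@ln R)}.
    by move=> ax; apply: continuous_ln; exact: lt_le_trans ax.
  split.
  + move=> x; rewrite in_itv/= => /andP[ax _].
    by have [] := is_derive1_ln (lt_trans a0 ax).
  + exact/cvg_at_right_filter/cl.
  + exact/cvg_at_left_filter/cl/ltW.
- move=> x; rewrite in_itv/= => /andP[ax _]; rewrite derive1E.
  by have [_ ->] := is_derive1_ln (lt_trans a0 ax).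
Qed.

End improper_integrals.

(** * Scaling of the Lebesgue measure *)

Section scaling.
Context {R : realType}.
Notation mu := (@lebesgue_measure R).
Variable u : R.
Hypothesis u0 : 0 < u.

Let phi (v : R) : measurableTypeR R := u * v.

Let mphi : measurable_fun [set: R] phi.
Proof. exact: mulrl_measurable. Qed.

Let preimage_phi (a b : R) (x y : bool) :
  phi @^-1` [set` Interval (BSide x a) (BSide y b)] =
  [set` Interval (BSide x (a / u)) (BSide y (b / u))].
Proof.
apply/seteqP; split => v /=; rewrite !in_itv/= /phi;
  by rewrite !lteif_pdivrMr// !lteif_pdivlMr// (mulrC u).
Qed.

Let nu : measure (measurableTypeR R) R.
Proof. unshelve refine (pushforward mu phi); exact: mphi. Defined.

(** [nu] is the image measure of dilation by [u]; by uniqueness of the Lebesgue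
    measure it suffices to compare lengths of intervals. *)
Let lebesgue_measure_scale (A : set R) : measurable A ->
  mu A = mscale (NngNum (ltW u0)) nu A.
Proof.
move=> mA; apply/lebesgue_measure_unique => //= _ [[a b]] _ <-.
rewrite /mscale/= /pushforward preimage_phi !lebesgue_measure_itv/= !lte_fin.
rewrite ltr_pM2r ?invr_gt0//; case: ifPn => _; last by rewrite mule0.
by rewrite -EFinM -EFinB; congr EFin; field; rewrite gt_eqF.
Qed.

Lemma ge0_integral_scale (f : R -> \bar R) : measurable_fun `]0, u[ f ->
  (forall x : R, 0 < x < u -> (0 <= f x)%E) ->
  (\int[mu]_(s in `]0%R, u[) f s =
   u%:E * \int[mu]_(v in `]0%R, 1%R[) f (u * v)%R)%E.
Proof.
move=> mf f0.
rewrite (@eq_measure_integral _ _ _ _ (mscale (NngNum (ltW u0)) nu) _ f (fun A mA _ => lebesgue_measure_scale mA)).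
have f0' : forall x, `]0%R, u[%classic x -> (0 <= f x)%E.
  by move=> x; rewrite /= in_itv/=; exact: f0.
rewrite ge0_integral_mscale//.
congr (_ * _)%E; rewrite /nu ge0_integral_pushforward//; last first.
  by move=> x; rewrite inE; exact: f0'.
by rewrite preimage_phi mul0r mulfV ?gt_eqF.
Qed.

Lemma integral_scale (f : R -> R) : measurable_fun `]0, u[ f ->
  mu.-integrable `]0, 1[ (fun v => (f (u * v))%:E) ->
  mu.-integrable `]0, u[ (EFin \o f) /\
  (\int[mu]_(s in `]0%R, u[) f s = u * \int[mu]_(v in `]0%R, 1%R[) f (u * v))%R.
Proof.
move=> mf fi; have [mfu ifu] := integrableP _ _ _ fi.
have mef : measurable_fun `]0, u[ (EFin \o f) by exact/measurable_EFinP.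
split.
  apply/integrableP; split => //.
  rewrite ge0_integral_scale//; last exact: measurableT_comp.
  by rewrite lte_mul_pinfty// lee_fin ltW.
set If := (\int[mu]_(v in `]0%R, 1%R[) (f (u * v))%:E)%E.
have If_fin : If \is a fin_num by exact: integrable_fin_num.
suff -> : (\int[mu]_(s in `]0%R, u[) f s)%R = fine (u%:E * If)%E by rewrite fineM.
rewrite /Rintegral; congr fine; rewrite integralE.
rewrite ge0_integral_scale//; last exact: measurable_funepos.
rewrite ge0_integral_scale//; last exact: measurable_funeneg.
have -> : If = (\int[mu]_(v in `]0%R, 1%R[) (fun x => (f x)%:E)^\+ (u * v)%R -
    \int[mu]_(v in `]0%R, 1%R[) (fun x => (f x)%:E)^\- (u * v)%R)%E.
  rewrite /If [LHS]integralE.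
  by congr (_ - _)%E; apply: eq_integral => x _; rewrite ?funeposE ?funenegE.
apply/esym/muleBr => //.
apply: fin_num_adde_defl; rewrite fin_numN.
have := integrable_neg_fin_num _ fi; move=> /(_ (measurable_itv _)).
by congr (_ \is a fin_num); apply: eq_integral => x _; rewrite ?funenegE.
Qed.

End scaling.

(** * Mellin integrands *)

Section mellin.
Context {R : realType}.
Notation mu := (@lebesgue_measure R).
Implicit Types (phi : R -> R) (a b c s t x delta : R).

Let D : set R := `]0, +oo[%classic.
Let mD : measurable (D : set (measurableTypeR R)). Proof. exact: measurable_itv. Qed.

Let Dgt x : D x -> 0 < x. Proof. by rewrite /D /= in_itv/= andbT. Qed.

(** The exponential beats any power: concavity bounds the logarithm by a line. *)
Lemma expR_ln_bounded c K : 0 < c -> 0 < K ->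
  exists C, forall x, 0 < x -> K * ln (1 + x) - c * x <= C.
Proof.
move=> c0 K0; exists (c - K * ln (c / K)) => x x0.
have cK : 0 < c / K by rewrite divr_gt0.
have x1 : 0 < 1 + x by rewrite addr_gt0.
have H : ln (c / K) + ln (1 + x) < c / K * (1 + x).
  by rewrite -lnM ?posrE// ln_sublinear// mulr_gt0.
have : K * (ln (c / K) + ln (1 + x)) <= K * (c / K * (1 + x)).
  by rewrite ler_pM2l// ltW.
have -> : K * (c / K * (1 + x)) = c + c * x by field; rewrite gt_eqF.
by rewrite mulrDr => h; lra.
Qed.

Let is_derive_expR_comp (f : R -> R) t (df : R) : is_derive t 1 f df ->
  is_derive t 1 (fun s => expR (f s)) (df * expR (f t)).
Proof.
move=> Hf; have := @is_derive1_comp _ expR f t _ _ (is_derive_expR (f t)) Hf.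
by rewrite mulrC.
Qed.

(** [x ^ (s - 1) / (1 + x) ^ (s + 1)] has the bounded antiderivative
    [(x / (1 + x)) ^ s / s], and it dominates [x ^ (s - 1) * exp (- c x)]. *)
Lemma power_exp_integrable s c : 0 < s -> 0 < c ->
  mu.-integrable D (fun x => (expR ((s - 1) * ln x) * expR (- (c * x)))%:E).
Proof.
move=> s0 c0.
pose h x := expR ((s - 1) * ln x - (s + 1) * ln (1 + x)).
pose F x := s^-1 * expR (s * (ln x - ln (1 + x))).
have dln x : 0 < x -> is_derive x 1 (@ln R) x^-1 by move=> ?; exact: is_derive1_ln.
have dln1 x : 0 < x -> is_derive x 1 (fun x => ln (1 + x)) (1 + x)^-1.
  move=> x0; have x1 : 0 < 1 + x by rewrite addr_gt0.
  have H := is_derive_affine (1 : R) 1 x.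
  have -> : (fun x : R => ln (1 + x)) = @ln R \o (fun x => 1 * x + 1).
    by apply/funext => y /=; rewrite mul1r addrC.
  have Hl : is_derive (1 * x + 1) 1 (@ln R) (1 + x)^-1.
    by rewrite mul1r (addrC x); exact: dln.
  by have := @is_derive1_comp _ (@ln R) (fun x : R => 1 * x + 1) x _ _ Hl H; rewrite mulr1.
have dh x : 0 < x -> derivable h x 1.
  move=> x0; have H1 := dln x x0; have H2 := dln1 x x0.
  have : is_derive x 1 (fun x => (s - 1) * ln x - (s + 1) * ln (1 + x))
      ((s - 1) * x^-1 - (s + 1) * (1 + x)^-1).
    have -> : (fun x => (s - 1) * ln x - (s + 1) * ln (1 + x)) =
      ((s - 1) \*: @ln R) - ((s + 1) \*: (fun x => ln (1 + x))) by exact/funext.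
    exact: is_deriveB.
  by move=> /is_derive_expR_comp [].
have ch x : 0 < x -> {for x, continuous h}.
  by move=> x0; apply/differentiable_continuous/derivable1_diffP; exact: dh.
have dF x : 0 < x -> is_derive x 1 F (h x).
  move=> x0; have H1 := dln x x0; have H2 := dln1 x x0.
  have x1 : 0 < 1 + x by rewrite addr_gt0.
  have : is_derive x 1 (fun x => s * (ln x - ln (1 + x)))
      (s * (x^-1 - (1 + x)^-1)).
    have -> : (fun x => s * (ln x - ln (1 + x))) =
      s \*: (@ln R - (fun x => ln (1 + x))) by exact/funext.
    by apply: is_derive_eq.
  move=> /is_derive_expR_comp H.
  have -> : F = s^-1 \*: (fun x => expR (s * (ln x - ln (1 + x)))) by exact/funext.
  apply: is_derive_eq; rewrite /GRing.scale/= /h.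
  have -> : (s - 1) * ln x - (s + 1) * ln (1 + x) =
    s * (ln x - ln (1 + x)) - ln x - ln (1 + x) by ring.
  rewrite [in RHS]expRD [in RHS]expRD !expRN !lnK ?posrE//.
  by field; rewrite !gt_eqF.
have h0 x : 0 < x -> 0 <= h x by move=> _; exact: expR_ge0.
have FB x : 0 < x -> `|F x| <= s^-1.
  move=> x0; rewrite /F ger0_norm; last by rewrite mulr_ge0 ?expR_ge0// invr_ge0 ltW.
  rewrite ler_piMr ?invr_ge0 ?(ltW s0)// -expR0 ler_expR.
  rewrite mulr_ge0_le0 ?(ltW s0)// subr_le0 ler_ln ?posrE ?addr_gt0//.
  by rewrite lerDr.
have ih := integrable_0y ch dF h0 FB.
have [C HC] := expR_ln_bounded c0 (addr_gt0 s0 ltr01).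
have iCh : mu.-integrable D (fun x => (expR C * h x)%:E).
  exact: (integrableZl mD (expR C) ih).
apply: (le_integrable mD) iCh.
  apply/measurable_EFinP; apply: measurable_funM.
    apply: measurableT_comp => //; apply: measurable_funM => //.
    apply: measurable_funTS; exact: measurable_ln.
  by apply: measurableT_comp => //; apply: measurableT_comp.
move=> x /Dgt x0 /=; rewrite lee_fin !ger0_norm ?mulr_ge0 ?expR_ge0//.
rewrite /h -!expRD ler_expR; have := HC x x0; lra.
Qed.

(** [phi x = O (x ^ delta)] up to arbitrarily small powers of [x], at zero and
    at infinity, so that logarithms can be absorbed. *)
Record power_like delta phi : Prop := PowerLike {
  power_like_measurable : measurable_fun D phi ;
  power_like_bound : forall eta : R, 0 < eta -> exists C : R, forall x, 0 < x ->
    `|phi x| <= C * expR (delta * ln x) * (expR (eta * ln x) + expR (- eta * ln x)) }.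

Lemma power_like_bounded delta C phi : measurable_fun D phi ->
  (forall x, 0 < x -> `|phi x| <= C * expR (delta * ln x)) -> power_like delta phi.
Proof.
move=> mphi phiC; split => // eta eta0; exists `|C| => x x0.
apply: (le_trans (phiC x x0)).
apply: (@le_trans _ _ (`|C| * expR (delta * ln x))).
  by rewrite ler_wpM2r ?expR_ge0// ler_norm.
rewrite ler_peMr// ?mulr_ge0 ?expR_ge0// mulNr expRN.
have := expR_gt0 (eta * ln x); set y := expR _ => y0.
have : 0 <= (y - 1) ^+ 2 / y by rewrite mulr_ge0 ?sqr_ge0// invr_ge0 ltW.
have -> : (y - 1) ^+ 2 / y = y + y^-1 - 2 by field; rewrite gt_eqF.
lra.
Qed.

Lemma power_like_ln delta phi : power_like delta phi ->
  power_like delta (fun x => phi x * ln x).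
Proof.
move=> [mphi Hphi]; split.
  by apply: measurable_funM => //; apply: measurable_funTS; exact: measurable_ln.
move=> eta eta0; have e20 : 0 < eta / 2 by rewrite divr_gt0.
have [C HC] := Hphi _ e20; exists (`|C| * (4 / eta)) => x x0.
rewrite normrM.
set y := expR (eta / 2 * ln x).
have y0 : 0 < y by exact: expR_gt0.
have yV : expR (- (eta / 2) * ln x) = y^-1 by rewrite mulNr expRN.
have yy : expR (eta * ln x) = y ^+ 2.
  by rewrite /y expr2 -expRD; congr expR; field.
have yyV : expR (- eta * ln x) = y^-1 ^+ 2 by rewrite mulNr expRN yy exprVn.
have lnx : `|ln x| <= 2 / eta * (y + y^-1).
  have H1 : 1 + eta / 2 * ln x <= y by exact: expR_ge1Dx.
  have H2 : 1 - eta / 2 * ln x <= y^-1.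
    by rewrite -yV -mulNr; exact: expR_ge1Dx.
  have yV0 : 0 < y^-1 by rewrite invr_gt0.
  have H3 : `|eta / 2 * ln x| <= y + y^-1 by rewrite ler_norml; lra.
  rewrite -(@ler_pM2l _ (eta / 2))// mulrA.
  have -> : eta / 2 * (2 / eta) = 1 by field; rewrite gt_eqF.
  by rewrite mul1r; move: H3; rewrite normrM (gtr0_norm e20).
have H := HC x x0; rewrite yV -/y in H.
rewrite yy yyV.
set p := expR (delta * ln x) in H *.
have p0 : 0 < p by exact: expR_gt0.
have H' : `|phi x| <= `|C| * p * (y + y^-1).
  apply: (le_trans H); rewrite -!mulrA ler_wpM2r ?ler_norm//.
  by rewrite mulr_ge0 ?(ltW p0)// addr_ge0// ?invr_ge0 ltW.
apply: (le_trans (ler_pM _ _ H' lnx)) => //.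
have -> : `|C| * p * (y + y^-1) * (2 / eta * (y + y^-1)) =
  (`|C| * p * (2 / eta)) * (y + y^-1) ^+ 2 by ring.
have -> : `|C| * (4 / eta) * p * (y ^+ 2 + y^-1 ^+ 2) =
  (`|C| * p * (2 / eta)) * (2 * (y ^+ 2 + y^-1 ^+ 2)) by ring.
rewrite ler_wpM2l//.
  by rewrite mulr_ge0 ?divr_ge0 ?(ltW eta0)// mulr_ge0 ?(ltW p0).
by move: (y^-1) => w; have := sqr_ge0 (y - w); rewrite !expr2; lra.
Qed.

Section family.
Variables (a b : R).
Hypotheses (a0 : 0 < a) (b0 : 0 < b).

(** This is [phi x * x ^ (b t - 1) * exp (- a x)]; with the power written as an
    exponential it is smooth in [t], for every real [t]. *)
Definition mellin phi x t : R :=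
  phi x * (expR ((b * t - 1) * ln x) * expR (- (a * x))).

Let sandwich (c e t y : R) : c <= t <= e -> expR (t * y) <= expR (c * y) + expR (e * y).
Proof.
move=> /andP[ct te]; have [y0|y0] := leP 0 y.
  have : expR (t * y) <= expR (e * y) by rewrite ler_expR ler_wpM2r.
  have := expR_ge0 (c * y); lra.
have : expR (t * y) <= expR (c * y) by rewrite ler_expR ler_wnM2r// ltW.
have := expR_ge0 (e * y); lra.
Qed.

(** For [c <= t <= e] the power [x ^ (b t)] lies below the sum of its values at
    the two ends. The smallest exponent is [s0 = b c + delta > 0]; spending
    [eta = s0 / 2] on the slack allowed in [power_like] keeps every exponent
    positive, hence every bound integrable. *)
Lemma mellin_dominated delta phi : power_like delta phi ->
  dominated mu D (- (delta / b)) (mellin phi).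
Proof.
move=> [mphi Hphi] c e lc.
pose s0 := b * c + delta; pose s1 := b * (Num.max c e) + delta.
have s00 : 0 < s0.
  rewrite /s0 -(pmulr_rgt0 _ (_ : 0 < b^-1)) ?invr_gt0//.
  have -> : b^-1 * (b * c + delta) = c + delta / b by field; rewrite gt_eqF.
  by rewrite -ltrBlDr sub0r.
have s01 : s0 <= s1 by rewrite /s0 /s1 lerD2r ler_pM2l// le_max lexx.
pose eta := s0 / 2; have eta0 : 0 < eta by rewrite divr_gt0.
have [C HC] := Hphi _ eta0.
pose m s x := expR ((s - 1) * ln x) * expR (- (a * x)).
have im s : 0 < s -> mu.-integrable D (EFin \o m s).
  by move=> ?; exact: power_exp_integrable.
exists (fun x => `|C| * ((m (s0 + eta) x + m (s0 - eta) x) + (m (s1 + eta) x + m (s1 - eta) x))).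
  have im2 s : eta < s ->
      mu.-integrable D (fun x => (m (s + eta) x + m (s - eta) x)%:E).
    move=> es; have p1 : 0 < s + eta by lra.
    have p2 : 0 < s - eta by lra.
    exact: (integrableD mD (im _ p1) (im _ p2)).
  have es0 : eta < s0 by rewrite /eta; lra.
  have es1 : eta < s1 by lra.
  exact: (integrableZl mD `|C| (integrableD mD (im2 _ es0) (im2 _ es1))).
move=> x t /Dgt x0 cte; rewrite /mellin normrM [X in _ * X]ger0_norm; last first.
  by rewrite mulr_ge0 ?expR_ge0.
set ea := expR (- (a * x)).
have ea0 : 0 <= ea by exact: expR_ge0.
have H1 : expR (b * t * ln x) <= expR (b * c * ln x) + expR (b * Num.max c e * ln x).
  apply: sandwich; rewrite !ler_pM2l// le_max.
  by move/andP : cte => [-> ->]; rewrite orbT.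
have H2 := HC x x0.
have -> : expR ((b * t - 1) * ln x) = expR (b * t * ln x) * expR (- ln x).
  by rewrite -expRD; congr expR; ring.
set el := expR (- ln x); have el0 : 0 <= el by exact: expR_ge0.
have mE s r : m (b * s + delta + r) x =
    expR (delta * ln x) * expR (r * ln x) * (expR (b * s * ln x) * el * ea).
  by rewrite /m /el /ea -!expRD; congr expR; ring.
rewrite /s0 /s1 !mE//.
set p := expR (delta * ln x); have p0 : 0 <= p by exact: expR_ge0.
set q := expR (eta * ln x); have q0 : 0 <= q by exact: expR_ge0.
set q' := expR (- eta * ln x); have q'0 : 0 <= q' by exact: expR_ge0.
rewrite -/p -/q -/q' in H2.
set u := expR (b * c * ln x); set v := expR (b * Num.max c e * ln x).
rewrite -/u -/v in H1.
have H2' : `|phi x| <= `|C| * p * (q + q').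
  by apply: (le_trans H2); rewrite -!mulrA ler_wpM2r ?ler_norm// mulr_ge0// addr_ge0.
apply: (@le_trans _ _ (`|C| * p * (q + q') * ((u + v) * el * ea))).
  apply: ler_pM => //; first by rewrite !mulr_ge0 ?expR_ge0.
  by rewrite ler_wpM2r// ler_wpM2r.
by rewrite le_eqVlt; apply/orP; left; apply/eqP; ring.
Qed.

Lemma mellin_measurable delta phi t : power_like delta phi ->
  measurable_fun D (mellin phi ^~ t).
Proof.
move=> [mphi _]; apply: measurable_funM => //; apply: measurable_funM.
  apply: measurableT_comp => //; apply: measurable_funM => //.
  apply: measurable_funTS; exact: measurable_ln.
by apply: measurableT_comp => //; apply: measurableT_comp.
Qed.

Lemma mellin_is_derive phi x t :
  is_derive t 1 (mellin phi x) (mellin (fun x => b * (phi x * ln x)) x t).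
Proof.
have := is_derive_affine (b * ln x) (- ln x) t.
move=> /is_derive_expR_comp H.
have -> : mellin phi x = (phi x * expR (- (a * x))) \*:
    (fun s => expR (b * ln x * s + - ln x)).
  apply/funext => s; rewrite /mellin /GRing.scale/=.
  have -> : (b * s - 1) * ln x = b * ln x * s - ln x by ring.
  by rewrite /GRing.scale/=; ring.
apply: is_derive_eq; rewrite /GRing.scale/= /mellin.
have -> : (b * t - 1) * ln x = b * ln x * t - ln x by ring.
by ring.
Qed.

Lemma power_likeZ delta phi c : power_like delta phi ->
  power_like delta (fun x => c * phi x).
Proof.
move=> [mphi Hphi]; split; first exact: measurable_funM.
move=> eta eta0; have [C HC] := Hphi _ eta0; exists (`|c| * C) => x x0.
by rewrite normrM -!mulrA ler_wpM2l// mulrA HC.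
Qed.

(** Differentiating in [t] multiplies [phi] by [b * ln], which stays in the
    class of [power_like] functions. *)
Lemma mellin_family delta phi : power_like delta phi ->
  smooth_family mu D (- (delta / b)) (mellin phi).
Proof.
move=> Hphi; apply: (@family_coind _ _ _ mu D _
  (fun F => exists2 phi, power_like delta phi & F = mellin phi)).
- by move=> _ [psi Hpsi ->] t _; exact: mellin_measurable Hpsi.
- by move=> _ [psi Hpsi ->]; exact: mellin_dominated.
- move=> _ [psi Hpsi ->]; exists (mellin (fun x => b * (psi x * ln x))).
    eexists; last by [].
    by apply: power_likeZ; exact: power_like_ln.
  by move=> x t _ _; exact: mellin_is_derive.
- by exists phi.
Qed.

End family.

End mellin.

(** * The Gamma function *)

Section gamma_function.
Context {R : realType}.
Notation mu := (@lebesgue_measure R).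
Implicit Types (t x y : R).

Let D : set R := `]0, +oo[%classic.
Let mD : measurable (D : set (measurableTypeR R)). Proof. exact: measurable_itv. Qed.
Let Dgt x : D x -> 0 < x. Proof. by rewrite /D /= in_itv/= andbT. Qed.

Lemma power_like1 : power_like 0 (fun=> 1 : R).
Proof.
apply: (@power_like_bounded _ _ 1); first exact: measurable_cst.
move=> x x0.
by rewrite normr1 mul0r expR0 mul1r.
Qed.

Lemma GammaE t : Gamma t = (\int[mu]_(y in D) mellin 1 1 (fun=> 1) y t)%R.
Proof.
apply: eq_Rintegral => y; rewrite inE => /Dgt y0.
by rewrite /mellin !mul1r /powR gt_eqF.
Qed.

Lemma Gamma_family : smooth_family mu D 0 (mellin 1 1 (fun=> 1 : R)).
Proof.
have := @mellin_family R 1 1 ltr01 ltr01 _ _ power_like1.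
by rewrite mul0r oppr0.
Qed.

Lemma Gamma_smooth : smooth 0 (@Gamma R).
Proof.
by apply: smooth_eq (family_integral_smooth mD Gamma_family) => t _; rewrite GammaE.
Qed.

(** The integrand is bounded away from zero on [[1, 2]]. *)
Lemma Gamma_gt0 t : 0 < t -> 0 < Gamma t.
Proof.
move=> t0; rewrite GammaE.
set f := mellin _ _ _ ^~ t.
have f0 y : 0 <= f y by rewrite /f /mellin !mul1r mulr_ge0 ?expR_ge0.
have fi := family_integrable mD Gamma_family t0.
pose m := expR (- (`|t - 1| + 2)).
have m0 : 0 < m by exact: expR_gt0.
have fm y : `[1%R, 2%R]%classic y -> m <= f y.
  rewrite /= in_itv/= => /andP[y1 y2]; rewrite /f /mellin !mul1r -expRD ler_expR.
  have l0 : 0 <= ln y by rewrite ln_ge0.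
  have l1 : ln y <= 1.
    rewrite -[leRHS](expRK (1 : R)) ler_ln ?posrE ?expR_gt0 ?(lt_le_trans ltr01)//.
    by apply: (le_trans y2); have := @expR_ge1Dx R 1; rewrite -natr1.
  have : `|(t - 1) * ln y| <= `|t - 1|.
    by rewrite normrM ler_piMr// ger0_norm.
  by rewrite ler_norml => /andP[h1 h2]; lra.
rewrite -lte_fin /Rintegral fineK; last exact: (integrable_fin_num mD fi).
apply: (@lt_le_trans _ _ (\int[mu]_(y in `[1%R, 2%R]) (f y)%:E)%E); last first.
  apply: ge0_subset_integral => //.
  - by have [] := integrableP _ _ _ fi.
  - by move=> y _; rewrite lee_fin.
  - by move=> y; rewrite /D /= !in_itv/= => /andP[y1 _]; rewrite (lt_le_trans ltr01).
apply: (@lt_le_trans _ _ (\int[mu]_(y in `[1%R, 2%R]) (cst m%:E) y)%E).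
  rewrite integral_cst//= lebesgue_measure_itv/= lte_fin ltr1n -EFinB -EFinM lte_fin.
  by rewrite mulr_gt0// subr_gt0 ltr1n.
apply: ge0_le_integral => //.
- by move=> y _; rewrite lee_fin ltW.
- have [mf _] := integrableP _ _ _ fi; apply: measurable_funS mf => // y.
  by rewrite /D /= !in_itv/= => /andP[y1 _]; rewrite (lt_le_trans ltr01).
Qed.

(** Integration by parts: [t * y ^ (t - 1) * exp (- y) - y ^ t * exp (- y)] is
    the derivative of [y ^ t * exp (- y)], which vanishes at both ends. *)
Lemma GammaS t : 0 < t -> Gamma (t + 1) = t * Gamma t.
Proof.
move=> t0; have t10 : 0 < t + 1 by rewrite addr_gt0.
pose F y : R := expR (t * ln y + -1 * y).
have sF : smooth 0 F.
  apply: smooth_expR; apply: smooth_lin; last exact: smooth_id.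
  by apply: smoothM; [exact: smooth_cst|exact: smooth_ln].
have FE y : 0 < y -> derive1 F y =
    t * mellin 1 1 (fun=> 1) y t - mellin 1 1 (fun=> 1) y (t + 1).
  move=> y0; rewrite derive1E.
  have dl := is_derive1_ln y0.
  have dt : is_derive y 1 (fun y => t * ln y + -1 * y) (t * y^-1 - 1).
    have -> : (fun y => t * ln y + -1 * y) = (t \*: @ln R) - id.
      by apply/funext => x; rewrite fctE mulN1r.
    exact: is_deriveB.
  have := @is_derive1_comp _ expR _ y _ _ (is_derive_expR _) dt => -[_ ->].
  rewrite /mellin !mul1r.
  have -> : (t - 1) * ln y = t * ln y + - ln y by ring.
  have -> : (t + 1 - 1) * ln y = t * ln y by ring.
  by rewrite mulN1r !expRD expRN lnK ?posrE//; ring.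
have i1 := family_integrable mD Gamma_family t0.
have i2 := family_integrable mD Gamma_family t10.
have i3 : mu.-integrable D (fun y => (t * mellin 1 1 (fun=> 1) y t)%:E).
  exact: (integrableZl mD t i1).
suff : (\int[mu]_(y in D) (t * mellin 1 1 (fun=> 1) y t -
    mellin 1 1 (fun=> 1) y (t + 1)))%R = 0 - 0.
  rewrite RintegralB// RintegralZl// -!GammaE subrr => /eqP.
  by rewrite subr_eq0 => /eqP ->.
have -> : (\int[mu]_(y in D) (t * mellin 1 1 (fun=> 1) y t -
    mellin 1 1 (fun=> 1) y (t + 1)))%R = (\int[mu]_(y in D) derive1 F y)%R.
  by apply: eq_Rintegral => y; rewrite inE => /Dgt y0; rewrite FE.
apply: (FTC_0y (F := F)).
- by move=> y; exact: (smooth_continuous (smooth_derive1 sF)).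
- by move=> y; exact: (smooth_is_derive sF).
- apply: (eq_integrable mD (fun y => (t * mellin 1 1 (fun=> 1) y t -
    mellin 1 1 (fun=> 1) y (t + 1))%:E)).
    by move=> y; rewrite inE => /Dgt y0 /=; rewrite FE.
  exact: (integrableB mD i3 i2).
- have : (fun y => y `^ t * expR (- y)) y @[y --> 0^'+] --> 0 * expR (- 0).
    apply: cvgM; first exact: powR_cvg0.
    apply: cvg_at_right_filter; apply: continuous_comp; last exact: continuous_expR.
    exact: oppr_continuous.
  rewrite mul0r; apply: cvg_trans; apply: near_eq_cvg.
  near=> y; rewrite /F /powR gt_eqF; last by near: y; exact: nbhs_right_gt.
  by rewrite mulN1r expRD.
- have [C HC] := @expR_ln_bounded R 1 (t + 1) ltr01 t10.
  apply: (@squeeze_cvgr _ _ _ _ (fun=> 0) (fun y => expR C * y^-1)).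
  + near=> y; have y0 : 0 < y by near: y; exact: nbhs_pinfty_gt.
    rewrite expR_ge0/= -(lnK y0) -expRN -expRD (lnK y0) ler_expR.
    have := HC y y0.
    have : ln y <= ln (1 + y) by rewrite ler_ln ?posrE ?addr_gt0// lerDr.
    by rewrite -(ler_pM2l t10); lra.
  + exact: cvg_cst.
  + rewrite -[X in _ --> X](mulr0 (expR C)); apply: cvgM; first exact: cvg_cst.
    have y0 : \forall y \near +oo%R, (0 : R) < id y by exact: nbhs_pinfty_gt.
    by apply: (proj2 (gtr0_cvgV0 y0)); exact: cvg_id.
Unshelve. all: by end_near. Qed.

End gamma_function.

(** * The gamma densities *)

Section gamma_density.
Context {R : realType}.
Notation mu := (@lebesgue_measure R).
Implicit Types (t x y : R) (phi : R -> R).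
Variables (a b : R).
Hypotheses (a0 : 0 < a) (b0 : 0 < b).

Let D : set R := `]0, +oo[%classic.
Let mD : measurable (D : set (measurableTypeR R)). Proof. exact: measurable_itv. Qed.

Let bt0 t : 0 < t -> 0 < b * t. Proof. exact: mulr_gt0. Qed.

Lemma digamma_smooth : smooth 0 (@digamma R).
Proof.
apply: smoothM; first exact: smooth_derive1 Gamma_smooth.
apply: smoothV Gamma_smooth => t t0; by rewrite gt_eqF// Gamma_gt0.
Qed.

(** Logarithmic derivative of [Gamma (t + 1) = t * Gamma t]. *)
Lemma digammaS t : 0 < t -> digamma t = digamma (t + 1) - t^-1.
Proof.
move=> t0; have t10 : 0 < t + 1 by rewrite addr_gt0.
have dG := smooth_is_derive Gamma_smooth t0.
have dG1 : is_derive t 1 (fun s => Gamma (s + 1)) (derive1 (@Gamma R) (t + 1)).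
  have H := smooth_is_derive Gamma_smooth t10.
  have H1 := is_derive_affine (1 : R) 1 t.
  have -> : (fun s : R => Gamma (s + 1)) = @Gamma R \o (fun s => 1 * s + 1).
    by apply/funext => s /=; rewrite mul1r.
  have H' : is_derive (1 * t + 1) 1 (@Gamma R) (derive1 (@Gamma R) (t + 1)) by rewrite mul1r.
  by have := @is_derive1_comp _ (@Gamma R) (fun s : R => 1 * s + 1) t _ _ H' H1; rewrite mulr1.
have E : derive1 (@Gamma R) (t + 1) = Gamma t + t * derive1 (@Gamma R) t.
  have [_ <-] := dG1; rewrite -derive1E.
  rewrite (@derive1_eq _ 0 _ (fun s => s * Gamma s))//; last by move=> s s0; rewrite GammaS.
  rewrite (@derive1M _ 0 id)//; [|exact: smooth_id|exact: Gamma_smooth].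
  by rewrite derive1E derive_id mul1r.
have G0 : Gamma t != 0 by rewrite gt_eqF// Gamma_gt0.
rewrite /digamma E GammaS//; field.
by rewrite G0/= gt_eqF.
Qed.

(** The factor [a ^ (b t) / Gamma (b t)] of the density, in a form that
    continues smoothly through [t = 0], where it vanishes. *)
Definition density_coef t : R :=
  expR (b * ln a * t) * (b * t * (Gamma (b * t + 1))^-1).

Lemma density_coef0 : density_coef 0 = 0.
Proof. by rewrite /density_coef !mulr0 mul0r mulr0. Qed.

Lemma density_coefE t : 0 < t -> density_coef t = a `^ (b * t) / Gamma (b * t).
Proof.
move=> t0; rewrite /density_coef /powR gt_eqF// GammaS ?bt0//.
have -> : b * ln a * t = b * t * ln a by ring.
congr (_ * _); field; rewrite !gt_eqF// ?Gamma_gt0 ?bt0//.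
Qed.

Lemma density_coef_smooth : smooth (- (1 / b)) density_coef.
Proof.
have lb t : - (1 / b) < t -> 0 < b * t + 1.
  move=> lt; have -> : b * t + 1 = b * (t + 1 / b) by field; rewrite gt_eqF.
  by rewrite mulr_gt0//; lra.
apply: smoothM.
  apply: smooth_expR; apply: smoothM; [exact: smooth_cst|exact: smooth_id].
apply: smoothM; first by apply: smoothM; [exact: smooth_cst|exact: smooth_id].
apply: (@smoothV _ _ (fun t => Gamma (b * t + 1))).
  by move=> t lt; rewrite gt_eqF// Gamma_gt0// lb.
exact: smooth_affine lb Gamma_smooth.
Qed.

Lemma mellin_densityE phi x t : 0 < x -> 0 < t ->
  phi x * gamma_density a b x t = density_coef t * mellin a b phi x t.
Proof.
move=> x0 t0; rewrite /gamma_density -density_coefE// /mellin /powR (gt_eqF x0).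
by ring.
Qed.

(** The factor [1 / Gamma (b t + 1)] is smooth for [t > - 1 / b], which is no
    further restriction when [delta <= 1]. *)
Lemma density_family delta phi : delta <= 1 -> power_like delta phi ->
  smooth_family mu D (- (delta / b)) (fun x t => density_coef t * mellin a b phi x t).
Proof.
move=> d1 pphi; apply: familyM => //; last exact: mellin_family.
apply: smooth_widen density_coef_smooth.
by rewrite lerN2 ler_pM2r// invr_gt0.
Qed.

Lemma gamma_density_smooth x : 0 < x -> smooth 0 (gamma_density a b x).
Proof.
move=> x0; have Dx : D x by rewrite /D /= in_itv/= andbT.
have H := density_family ler01 (@power_like1 R); rewrite mul0r oppr0 in H.
apply: smooth_eq (family_smooth H Dx) => t t0 /=.
by rewrite -mellin_densityE// mul1r.
Qed.

Lemma derive1_gamma_density x t : 0 < x -> 0 < t ->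
  derive1 (gamma_density a b x) t =
  b * (ln a - digamma (b * t) + ln x) * gamma_density a b x t.
Proof.
move=> x0 t0.
pose c s : R := expR (b * ln a * s) * (Gamma (b * s))^-1.
have E s : 0 < s -> gamma_density a b x s = c s * mellin a b (fun=> 1) x s.
  move=> s0; rewrite -[LHS]mul1r (mellin_densityE (fun=> 1))// density_coefE//.
  rewrite /c /powR gt_eqF//; congr (_ / _ * _); congr expR; ring.
rewrite (derive1_eq E t0) E//.
have G0 : Gamma (b * t) != 0 by rewrite gt_eqF// Gamma_gt0// bt0.
have scale_b : is_derive t 1 (fun s : R => b * s) b.
  have -> : (fun s : R => b * s) = fun s => b * s + 0.
    by apply/funext => s; rewrite addr0.
  exact: is_derive_affine.
have de : is_derive t 1 (fun s => expR (b * ln a * s)) (b * ln a * expR (b * ln a * t)).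
  have H : is_derive t 1 (fun s : R => b * ln a * s) (b * ln a).
    have -> : (fun s : R => b * ln a * s) = fun s => b * ln a * s + 0.
      by apply/funext => s; rewrite addr0.
    exact: is_derive_affine.
  have := @is_derive1_comp _ expR (fun s : R => b * ln a * s) t _ _ (is_derive_expR _) H.
  by rewrite (mulrC (expR _)).
have dG : is_derive t 1 (fun s => Gamma (b * s)) (b * derive1 (@Gamma R) (b * t)).
  have := @is_derive1_comp _ (@Gamma R) (fun s : R => b * s) t _ _
    (smooth_is_derive Gamma_smooth (bt0 t0)) scale_b.
  by rewrite (mulrC _ b).
have dV := @is_deriveV _ (fun s : R => Gamma (b * s)) t _ 1 G0 dG.
have dm := mellin_is_derive a b (fun=> 1) x t.
rewrite derive1E.
have -> : (fun s => c s * mellin a b (fun=> 1) x s) =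
    ((fun s => expR (b * ln a * s)) * (fun s => (Gamma (b * s))^-1)) *
    mellin a b (fun=> 1) x by exact/funext.
rewrite derive_val /GRing.scale/= /c /digamma /mellin.
by rewrite /GRing.scale/= !fctE/=; field.
Qed.

End gamma_density.

(** * Fubini's theorem for a kernel dominated by a product *)

Section fubini_rectangle.
Context {R : realType} d1 d2 (X : measurableType d1) (Y : measurableType d2).
Variables (m1 : {sigma_finite_measure set X -> \bar R})
  (m2 : {sigma_finite_measure set Y -> \bar R}).
Variables (D : set X) (E : set Y) (K : X -> Y -> R) (G : X -> R) (W : Y -> R).
Hypotheses (mD : measurable D) (mE : measurable E).
Hypothesis mK : measurable_fun (D `*` E) (fun z => K z.1 z.2).
Hypothesis iG : m1.-integrable D (EFin \o G).
Hypothesis iW : m2.-integrable E (EFin \o W).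
Hypothesis KGW : forall x y, D x -> E y -> `|K x y| <= G x * W y.

Let f : X * Y -> \bar R := (fun z => (K z.1 z.2)%:E) \_ (D `*` E).

Let mf : measurable_fun setT f.
Proof.
apply/(measurable_restrictT _ (measurableX mD mE)).
exact/measurable_EFinP.
Qed.

Let f_in x y : D x -> f (x, y) = ((fun y => (K x y)%:E) \_ E) y.
Proof.
move=> Dx; rewrite /f !patchE; have [Ey|Ey] := pselect (E y).
  by rewrite !mem_set.
by rewrite !memNset// => -[].
Qed.

Let f_in2 x y : E y -> f (x, y) = ((fun x => (K x y)%:E) \_ D) x.
Proof.
move=> Ey; rewrite /f !patchE; have [Dx|Dx] := pselect (D x).
  by rewrite !mem_set.
by rewrite !memNset// => -[].
Qed.

Let f_out x y : ~ D x -> f (x, y) = 0%E.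
Proof. by move=> Dx; rewrite /f patchE memNset// => -[]. Qed.

Let f_out2 x y : ~ E y -> f (x, y) = 0%E.
Proof. by move=> Ey; rewrite /f patchE memNset// => -[]. Qed.

Let intE x : D x -> (\int[m2]_y f (x, y) = \int[m2]_(y in E) (K x y)%:E)%E.
Proof. by move=> Dx; rewrite [RHS]integral_mkcond; apply: eq_integral => y _; exact: f_in. Qed.

Let intD y : E y -> (\int[m1]_x f (x, y) = \int[m1]_(x in D) (K x y)%:E)%E.
Proof. by move=> Dx; rewrite [RHS]integral_mkcond; apply: eq_integral => x _; exact: f_in2. Qed.

Let mKx x : D x -> measurable_fun E (K x).
Proof.
move=> Dx; apply/measurable_EFinP/(measurable_restrictT _ mE).
apply: eq_measurable_fun (measurableT_comp mf (pair1_measurable x)) => y _ /=.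
exact: f_in.
Qed.

Let f_integrable : (m1 \x m2)%E.-integrable setT f.
Proof.
apply/integrable12ltyP => //.
pose IW := (\int[m2]_(y in E) `|(W y)%:E|)%E.
have IW0 : (0 <= IW)%E by exact: integral_ge0.
have IWoo : (IW < +oo)%E by have [_] := integrableP _ _ _ iW.
have [mG Goo] := integrableP _ _ _ iG.
have [mW _] := integrableP _ _ _ iW.
apply: (@le_lt_trans _ _ (\int[m1]_(x in D) (`|(G x)%:E| * IW))%E).
  rewrite [leRHS]integral_mkcond; apply: ge0_le_integral => //.
  - by move=> x _; exact: integral_ge0.
  - apply: (measurable_fun_fubini_tonelli_F (abse \o f)) => //=.
    exact: measurableT_comp.
  - apply/(measurable_restrictT _ mD); apply: emeasurable_funM => //.
    exact: measurableT_comp.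
  move=> x _; rewrite patchE; case: ifPn => [|/negP xD]; last first.
    rewrite integral0_eq// => y _; rewrite f_out ?abse0// => Dx.
    by apply: xD; rewrite inE.
  rewrite inE => Dx.
  rewrite -ge0_integralZl//; last exact: measurableT_comp.
  rewrite [leRHS]integral_mkcond; apply: ge0_le_integral => //.
  - apply: measurableT_comp => //.
    exact: (measurableT_comp mf (pair1_measurable x)).
  - apply/(measurable_restrictT _ mE); apply: emeasurable_funM => //.
    exact: measurableT_comp.
  move=> y _; rewrite f_in// !patchE; case: ifPn => [|_]; last by rewrite abse0.
  rewrite inE => Ey; rewrite -EFinM lee_fin; apply: (le_trans (KGW Dx Ey)).
  by rewrite -normrM ler_norm.
rewrite ge0_integralZr//; last exact: measurableT_comp.
rewrite lte_mul_pinfty// ?integral_ge0//.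
by rewrite ge0_fin_numE// integral_ge0.
Qed.

Lemma rectangle_integrable x : D x -> m2.-integrable E (fun y => (K x y)%:E).
Proof.
move=> Dx; apply: (@le_integrable _ _ _ m2 _ mE _ (fun y => (G x * W y)%:E)).
- by apply/measurable_EFinP; exact: mKx.
- move=> y Ey; rewrite lee_fin (le_trans (KGW Dx Ey))// ler_norm//.
- exact: (integrableZl mE (G x) iW).
Qed.

Let mKy y : E y -> measurable_fun D (K ^~ y).
Proof.
move=> Ey; apply/measurable_EFinP/(measurable_restrictT _ mD).
apply: eq_measurable_fun (measurableT_comp mf (pair2_measurable y)) => x _ /=.
exact: f_in2.
Qed.

Lemma rectangle_integrable2 y : E y -> m1.-integrable D (fun x => (K x y)%:E).
Proof.
move=> Ey; apply: (@le_integrable _ _ _ m1 _ mD _ (fun x => (W y * G x)%:E)).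
- by apply/measurable_EFinP; exact: mKy.
- move=> x Dx; rewrite lee_fin (le_trans (KGW Dx Ey))// mulrC ler_norm//.
- exact: (integrableZl mD (W y) iG).
Qed.

Lemma measurable_rectangle_integral :
  measurable_fun D (fun x => \int[m2]_(y in E) K x y)%R.
Proof.
apply: eq_measurable_fun (_ : measurable_fun D (fun x => fine (\int[m2]_y f (x, y))%E)).
  by move=> x; rewrite inE => Dx; rewrite intE.
apply: measurableT_comp => //; apply: measurable_funTS.
exact: (measurable_fubini_F f_integrable).
Qed.

Lemma rectangle_Fubini :
  (\int[m2]_(y in E) (\int[m1]_(x in D) K x y) =
   \int[m1]_(x in D) (\int[m2]_(y in E) K x y))%R.
Proof.
have H := Fubini f_integrable.
rewrite /Rintegral.
congr fine; transitivity (\int[m2]_y \int[m1]_x f (x, y))%E.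
  rewrite integral_mkcond; apply: eq_integral => y _; rewrite patchE.
  have [Ey|Ey] := pselect (E y); last first.
    by rewrite memNset// integral0_eq// => x _; exact: f_out2.
  rewrite mem_set// intD// fineK//; apply: integrable_fin_num => //.
  exact: rectangle_integrable2.
rewrite -H [RHS]integral_mkcond; apply: eq_integral => x _; rewrite patchE.
have [Dx|Dx] := pselect (D x); last first.
  by rewrite memNset// integral0_eq// => y _; exact: f_out.
rewrite mem_set// intE// fineK//; apply: integrable_fin_num => //.
exact: rectangle_integrable.
Qed.

End fubini_rectangle.

(** * Abel integrals *)

Section abel_integral.
Context {R : realType}.
Notation mu := (@lebesgue_measure R).
Implicit Types (f h om : R -> R) (l t u v : R).

Let I01 : set R := `]0%R, 1%R[%classic.
Let mI01 : measurable (I01 : set (measurableTypeR R)). Proof. exact: measurable_itv. Qed.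
Let I01P v : I01 v -> 0 < v < 1. Proof. by rewrite /I01 /= in_itv. Qed.

Variable beta : R.
Hypothesis beta01 : 0 < beta < 1.

Definition abel_weight v : R := (1 - v) `^ (- beta).

Let w := abel_weight.

Let w_ge0 v : 0 <= w v. Proof. exact: powR_ge0. Qed.

Let wE v : v < 1 -> w v = expR (- beta * ln (1 - v)).
Proof. by move=> v1; rewrite /w /abel_weight /powR gt_eqF// subr_gt0. Qed.

Let beta1 : 0 < 1 - beta. Proof. by case/andP : beta01; lra. Qed.

Let is_derive_power (e v : R) : v < 1 ->
  is_derive v 1 (fun v => expR (e * ln (1 - v))) (- e * (1 - v)^-1 * expR (e * ln (1 - v))).
Proof.
move=> v1; have v10 : 0 < 1 - v by rewrite subr_gt0.
have dl : is_derive v 1 (fun v : R => e * ln (1 - v)) (- e * (1 - v)^-1).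
  have H := is_derive_affine (- 1 : R) 1 v.
  have Hl : is_derive (- 1 * v + 1) 1 (@ln R) (1 - v)^-1.
    by rewrite mulN1r (addrC (- v)); exact: is_derive1_ln.
  have := @is_derive1_comp _ (@ln R) (fun v : R => - 1 * v + 1) v _ _ Hl H => Hc.
  have -> : (fun v : R => e * ln (1 - v)) = e \*: (@ln R \o (fun v : R => - 1 * v + 1)).
    by apply/funext => s /=; rewrite mulN1r (addrC (- s)).
  by apply: is_derive_eq; rewrite /GRing.scale/=; ring.
have := @is_derive1_comp _ expR _ v _ _ (is_derive_expR _) dl.
by rewrite [X in is_derive _ _ _ X -> _]mulrC.
Qed.

Let continuous_power (e v : R) : v < 1 ->
  {for v, continuous (fun v => expR (e * ln (1 - v)))}.
Proof.
move=> v1; apply/differentiable_continuous/derivable1_diffP.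
by have [] := is_derive_power e v1.
Qed.

Let w_continuous v : v < 1 -> {for v, continuous w}.
Proof.
move=> v1; have := @continuous_power (- beta) v v1.
rewrite /prop_for /continuous_at wE//; apply: cvg_trans; apply: near_eq_cvg.
near=> s; rewrite wE//; near: s; exact: lt_nbhsl.
Unshelve. all: by end_near. Qed.

Lemma abel_weight_integrable : mu.-integrable I01 (EFin \o w).
Proof.
pose F v := - (1 - beta)^-1 * expR ((1 - beta) * ln (1 - v)).
apply: (@integrable_oo R 0 1 ltr01 w F ((1 - beta)^-1)).
- by move=> v /andP[_ v1]; exact: w_continuous.
- move=> v /andP[_ v1]; have dp := is_derive_power (1 - beta) v1.
  have v10 : 0 < 1 - v by rewrite subr_gt0.
  have -> : F = (- (1 - beta)^-1) \*: (fun v => expR ((1 - beta) * ln (1 - v))) by exact/funext.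
  apply: is_derive_eq; rewrite /GRing.scale/= wE//.
  have -> : (1 - beta) * ln (1 - v) = ln (1 - v) + - beta * ln (1 - v) by ring.
  rewrite expRD lnK ?posrE//; field.
  by rewrite !gt_eqF.
- by [].
- move=> v /andP[v0 v1]; rewrite /F normrM normrN [X in _ * X]ger0_norm ?expR_ge0//.
  rewrite ger0_norm ?invr_ge0 ?(ltW beta1)// ler_piMr ?invr_ge0 ?(ltW beta1)//.
  rewrite -[leRHS]expR0 ler_expR mulr_ge0_le0 ?(ltW beta1)// ln_le0//; lra.
Qed.

Let mw : measurable_fun I01 w.
Proof. by have [/measurable_EFinP] := integrableP _ _ _ abel_weight_integrable. Qed.

Definition abel f u : R := (\int[mu]_(s in `]0%R, u[) (f s / (u - s) `^ beta))%R.

(** Scaling [s = u v] moves the endpoint [u] of the domain into the integrand,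
    where it can be differentiated. *)
Lemma abel_scale f (u M : R) : 0 < u -> measurable_fun `]0, u[ f ->
  (forall s : R, 0 < s < u -> `|f s| <= M) ->
  mu.-integrable `]0, u[ (fun s => (f s / (u - s) `^ beta)%:E) /\
  abel f u = u `^ (1 - beta) * (\int[mu]_(v in I01) (f (u * v) * w v))%R.
Proof.
move=> u0 mf fM.
have uv v : I01 v -> 0 < u * v < u.
  by move=> /I01P /andP[v0 v1]; rewrite mulr_gt0//= gtr_pMr.
have mfu : measurable_fun I01 (fun v => f (u * v)).
  apply: (measurable_comp (F := `]0%R, u[%classic)) => //.
  by move=> _ [v /uv uvu <-]; rewrite /= in_itv.
have ifw : mu.-integrable I01 (fun v => (f (u * v) * w v)%:E).
  apply: (@le_integrable _ _ _ mu _ mI01 _ (fun v => (M * w v)%:E)).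
  - by apply/measurable_EFinP; apply: measurable_funM.
  - move=> v Iv; rewrite lee_fin !normrM ler_wpM2r// (le_trans _ (ler_norm M))//.
    exact: fM (uv v Iv).
  - exact: (integrableZl mI01 M abel_weight_integrable).
have kE v : I01 v -> f (u * v) / (u - u * v) `^ beta =
    u `^ (- beta) * (f (u * v) * w v).
  move=> /I01P /andP[v0 v1]; rewrite /w /abel_weight !powRN.
  have -> : u - u * v = u * (1 - v) by ring.
  rewrite powRM ?(ltW u0) ?subr_ge0 ?(ltW v1)//.
  by rewrite invfM; ring.
have mk : measurable_fun `]0, u[ (fun s => f s / (u - s) `^ beta).
  apply: measurable_funM => //.
  have mp : measurable_fun `]0, u[ (fun s : R => (u - s) `^ (- beta)).
    by apply: (measurableT_comp (measurable_powR (- beta))); exact: measurable_funB.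
  by apply: eq_measurable_fun mp => s _; rewrite powRN.
have iuw : mu.-integrable I01 (fun v => (u `^ (- beta) * (f (u * v) * w v))%:E).
  exact: (integrableZl mI01 _ ifw).
have ik : mu.-integrable I01 (fun v => (f (u * v) / (u - u * v) `^ beta)%:E).
  by apply: (eq_integrable mI01 _ _ _ iuw) => v; rewrite inE => /kE ->.
have [H1 H2] := @integral_scale R u u0 (fun s => f s / (u - s) `^ beta) mk ik.
split => //; rewrite /abel H2.
have -> : (\int[mu]_(v in `]0, 1[) (f (u * v) / (u - u * v) `^ beta))%R =
    (\int[mu]_(v in I01) (u `^ (- beta) * (f (u * v) * w v)))%R.
  by apply: eq_Rintegral => v; rewrite inE => /kE.
rewrite RintegralZl// mulrA; congr (_ * _).
by rewrite powRD ?gt_eqF ?implybT// powRr1// ltW.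
Qed.

Let smooth_local_bound l f u : l < 0 -> smooth l f ->
  exists M : R, forall s : R, 0 <= s <= u -> `|f s| <= M.
Proof.
move=> l0 sf; have [M M0 fM] := continuous_bounded (smooth_continuous sf) u l0.
by exists M.
Qed.

Let smooth_measurable f u : smooth 0 f -> measurable_fun `]0, u[ f.
Proof.
move=> sf; apply: open_continuous_measurable_fun => //.
by move=> s; rewrite inE/= in_itv/= => /andP[s0 _]; exact: smooth_continuous sf _ s0.
Qed.

Lemma abelE l f u : l < 0 -> smooth l f -> 0 < u ->
  mu.-integrable `]0, u[ (fun s => (f s / (u - s) `^ beta)%:E) /\
  abel f u = u `^ (1 - beta) * (\int[mu]_(v in I01) (f (u * v) * w v))%R.
Proof.
move=> l0 sf u0; have [M fM] := smooth_local_bound u l0 sf.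
apply: (@abel_scale f u M) => //.
  by apply: smooth_measurable; exact: smooth_widen (ltW l0) sf.
by move=> s /andP[s0 su]; rewrite fM// !ltW.
Qed.

(** The derivatives in [u] of [f (u v)] are [v ^ i f^(i) (u v)], which stay
    bounded because [f] is smooth across [0]. *)
Lemma abel_family l f : l < 0 -> smooth l f ->
  smooth_family mu I01 0 (fun v u => f (u * v) * w v).
Proof.
move=> l0 sf.
pose A F := exists om h, [/\ measurable_fun I01 om, (forall v, I01 v -> `|om v| <= 1),
  smooth l h & F = fun v u => om v * (h (u * v) * w v)].
have mh h u : smooth l h -> 0 < u -> measurable_fun I01 (fun v => h (u * v)).
  move=> sh u0; apply: (measurable_comp (F := `]0%R, u[%classic)) => //.
  - move=> _ [v /I01P/andP[v0 v1] <-]; rewrite /= in_itv/= mulr_gt0//= gtr_pMr//.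
  - by apply: smooth_measurable; exact: smooth_widen (ltW l0) sh.
apply: (@family_eq _ _ _ mu _ _ (fun v u => 1 * (f (u * v) * w v))).
  by move=> v u _ _; rewrite mul1r.
apply: (@family_coind _ _ _ mu I01 0 A).
- move=> _ [om [h [mom _ sh ->]]] u u0.
  by apply: measurable_funM => //; apply: measurable_funM => //; exact: mh.
- move=> _ [om [h [mom om1 sh ->]]] c e c0.
  have [M hM] := smooth_local_bound e l0 sh.
  exists (fun v => M * w v).
    exact: (integrableZl mI01 M abel_weight_integrable).
  move=> v u Iv /andP[cu ue]; have /andP[v0 v1] := I01P Iv.
  rewrite normrM normrM (ger0_norm (w_ge0 v)).
  have u0 := lt_le_trans c0 cu.
  have hMv : `|h (u * v)| <= M.
    apply: hM; rewrite mulr_ge0 ?(ltW u0) ?(ltW v0)//=.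
    by rewrite (le_trans _ ue)// ler_piMr ?(ltW u0)// ltW.
  rewrite -[leRHS]mul1r ler_pM// ?mulr_ge0//; first exact: om1.
  by rewrite ler_wpM2r.
- move=> _ [om [h [mom om1 sh ->]]].
  exists (fun v u => (v * om v) * (derive1 h (u * v) * w v)).
    exists (fun v => v * om v), (derive1 h); split => //.
    + exact: measurable_funM.
    + move=> v Iv; have /andP[v0 v1] := I01P Iv.
      by rewrite normrM gtr0_norm// mulr_ile1 ?(ltW v0) ?(ltW v1)// om1.
    + exact: smooth_derive1.
  move=> v u Iv u0; have /andP[v0 v1] := I01P Iv.
  have uv0 : l < v * u by rewrite (lt_le_trans l0)// mulr_ge0// ltW.
  have dh := smooth_is_derive sh uv0.
  have da : is_derive u 1 (fun s : R => v * s) v.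
    have -> : (fun s : R => v * s) = fun s => v * s + 0.
      by apply/funext => s; rewrite addr0.
    exact: is_derive_affine.
  have dc := @is_derive1_comp _ h (fun s : R => v * s) u _ _ dh da.
  have -> : (fun u => om v * (h (u * v) * w v)) =
      (om v * w v) \*: (h \o (fun s : R => v * s)).
    by apply/funext => s; rewrite fctE/= /GRing.scale/= (mulrC s); ring.
  by apply: is_derive_eq; rewrite /GRing.scale/= (mulrC u); ring.
- by exists (fun=> 1), f; split => // v _; rewrite normr1.
Qed.

Lemma abel_smooth l f : l < 0 -> smooth l f -> smooth 0 (abel f).
Proof.
move=> l0 sf.
apply: (@smooth_eq _ _ (fun u => u `^ (1 - beta) *
    (\int[mu]_(v in I01) (f (u * v) * w v))%R)).
  by move=> u u0; have [_ ->] := abelE l0 sf u0.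
apply: smoothM; first exact: smooth_powR.
exact: (family_integral_smooth mI01 (abel_family l0 sf)).
Qed.

(** Integration by parts against [(1 - v) ^ (1 - beta)]; the value [f 0 = 0]
    removes the boundary term. *)
Lemma derive1_abel l f : l < 0 -> smooth l f -> f 0 = 0 ->
  forall u, 0 < u -> derive1 (abel f) u = abel (derive1 f) u.
Proof.
move=> l0 sf f0 u u0; have sf' := smooth_derive1 sf.
pose V u := (\int[mu]_(v in I01) (f (u * v) * w v))%R.
pose V1 u := (\int[mu]_(v in I01) (derive1 f (u * v) * w v))%R.
pose Vv u := (\int[mu]_(v in I01) (v * (derive1 f (u * v) * w v)))%R.
have fam := abel_family l0 sf; have fam' := abel_family l0 sf'.
have i0 := family_integrable mI01 fam u0.
have i1 := family_integrable mI01 fam' u0.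
have iv : mu.-integrable I01 (fun v => (v * (derive1 f (u * v) * w v))%:E).
  apply: (le_integrable mI01) i1.
    have := family_measurable fam' u0 => m1.
    by apply/measurable_EFinP; exact: measurable_funM.
  move=> v /I01P/andP[v0 v1]; rewrite lee_fin normrM ler_piMl//.
  by rewrite gtr0_norm// ltW.
have D1 v : I01 v -> derive1 (fun u => f (u * v) * w v) u = v * (derive1 f (u * v) * w v).
  move=> /I01P/andP[v0 v1].
  have uv0 : l < v * u by rewrite (lt_le_trans l0)// mulr_ge0// ltW.
  have dh := smooth_is_derive sf uv0.
  have da : is_derive u 1 (fun s : R => v * s) v.
    have -> : (fun s : R => v * s) = fun s => v * s + 0.
      by apply/funext => s; rewrite addr0.
    exact: is_derive_affine.
  have dc := @is_derive1_comp _ f (fun s : R => v * s) u _ _ dh da.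
  have -> : (fun u => f (u * v) * w v) = (w v) \*: (f \o (fun s : R => v * s)).
    by apply/funext => s; rewrite fctE/= /GRing.scale/= (mulrC s); ring.
  by rewrite derive1E derive_val /GRing.scale/= (mulrC u); ring.
have dV : derive1 V u = Vv u.
  rewrite derive1E; have [_ ->] := family_integral_is_derive mI01 fam u0.
  by apply: eq_Rintegral => v; rewrite inE => /D1.
have dpow : derive1 (fun u : R => u `^ (1 - beta)) u = (1 - beta) * u `^ (- beta).
  have [_ E] := @is_derive1_powR R (1 - beta) u u0.
  by rewrite derive1E E; congr (_ * _ `^ _); ring.
have sV : smooth 0 V := family_integral_smooth mI01 fam.
have abelV t : 0 < t -> abel f t = t `^ (1 - beta) * V t.
  by move=> t0; have [_ ->] := abelE l0 sf t0.
rewrite (derive1_eq abelV u0) (@derive1M _ 0)//; last exact: smooth_powR.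
rewrite dpow dV; have [_ ->] := abelE l0 sf' u0; rewrite -/(V1 u).
(* the derivative of [f (u v) * (1 - v) ^ (1 - beta)] in [v] integrates to [0] *)
have P : u * V1 u - u * Vv u - (1 - beta) * V u = 0.
  have iu1 : mu.-integrable I01 (fun v => (u * (derive1 f (u * v) * w v))%:E).
    exact: (integrableZl mI01 u i1).
  have iuv : mu.-integrable I01 (fun v => (u * (v * (derive1 f (u * v) * w v)))%:E).
    exact: (integrableZl mI01 u iv).
  have ib0 : mu.-integrable I01 (fun v => ((1 - beta) * (f (u * v) * w v))%:E).
    exact: (integrableZl mI01 (1 - beta) i0).
  have i12 : mu.-integrable I01 (fun v => (u * (derive1 f (u * v) * w v) -
      u * (v * (derive1 f (u * v) * w v)))%:E).
    exact: (integrableB mI01 iu1 iuv).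
  have i123 : mu.-integrable I01 (fun v => (u * (derive1 f (u * v) * w v) -
      u * (v * (derive1 f (u * v) * w v)) - (1 - beta) * (f (u * v) * w v))%:E).
    exact: (integrableB mI01 i12 ib0).
  have E1 : u * V1 u = (\int[mu]_(v in I01) (u * (derive1 f (u * v) * w v)))%R.
    by rewrite RintegralZl.
  have E2 : u * Vv u = (\int[mu]_(v in I01) (u * (v * (derive1 f (u * v) * w v))))%R.
    by rewrite RintegralZl.
  have E3 : (1 - beta) * V u = (\int[mu]_(v in I01) ((1 - beta) * (f (u * v) * w v)))%R.
    by rewrite RintegralZl.
  rewrite E1 E2 E3 -RintegralB// -RintegralB//.
  pose g v := expR ((1 - beta) * ln (1 - v)).
  have cfu x : l < u * x -> {for x, continuous (fun v => f (u * v))}.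
    move=> lx; have cm : {for x, continuous (fun v : R => u * v)}.
      exact: mulrl_continuous.
    by apply: continuous_comp cm _; exact: smooth_continuous sf _ lx.
  rewrite -[RHS](subrr 0).
  apply: (@FTC_oo R 0 1 ltr01 _ (fun v => f (u * v) * g v)) => //.
  - move=> v /andP[v0 v1].
    have uv0 : l < u * v by rewrite (lt_le_trans l0)// mulr_ge0// ltW.
    have cm : {for v, continuous (fun v : R => u * v)} by exact: mulrl_continuous.
    have c1 : {for v, continuous (fun v => derive1 f (u * v) * w v)}.
      apply: continuousM; last exact: w_continuous.
      by apply: continuous_comp cm _; exact: smooth_continuous sf' _ uv0.
    have c2 : {for v, continuous (fun v => f (u * v) * w v)}.
      apply: continuousM; last exact: w_continuous.
      by apply: continuous_comp cm _; exact: smooth_continuous sf _ uv0.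
    apply: continuousB; last by apply: continuousM => //; exact: cvg_cst.
    apply: continuousB; first by apply: continuousM => //; exact: cvg_cst.
    apply: continuousM; first exact: cvg_cst.
    by apply: continuousM => //; exact: cvg_id.
  - move=> v /andP[v0 v1].
    have v10 : 0 < 1 - v by rewrite subr_gt0.
    have uv0 : l < u * v by rewrite (lt_le_trans l0)// mulr_ge0// ltW.
    have dh := smooth_is_derive sf uv0.
    have da : is_derive v 1 (fun s : R => u * s) u.
      have -> : (fun s : R => u * s) = fun s => u * s + 0.
        by apply/funext => s; rewrite addr0.
      exact: is_derive_affine.
    have dc := @is_derive1_comp _ f (fun s : R => u * s) v _ _ dh da.
    have dg := is_derive_power (1 - beta) v1; rewrite -/g in dg.
    have -> : (fun v => f (u * v) * g v) = (f \o (fun s : R => u * s)) * g by exact/funext.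
    apply: is_derive_eq; rewrite /GRing.scale/= wE//.
    have -> : (1 - beta) * ln (1 - v) = ln (1 - v) + - beta * ln (1 - v) by ring.
    rewrite /g; have -> : (1 - beta) * ln (1 - v) = ln (1 - v) + - beta * ln (1 - v) by ring.
    rewrite expRD lnK ?posrE//; field.
    by rewrite gt_eqF.
  - apply: cvg_at_right_filter.
    have := cvgM (cfu 0 _) (@continuous_power (1 - beta) 0 ltr01).
    by rewrite mulr0 f0 mul0r; apply.
  - rewrite -[X in _ --> X](mulr0 (f (u * 1))); apply: cvgM.
      by apply: cvg_at_left_filter; apply: cfu; rewrite mulr1 (lt_trans l0).
    have : (fun s : R => s `^ (1 - beta)) (1 - v) @[v --> 1^'-] --> (0:R).
      apply: (@cvg_comp _ _ _ _ (fun s : R => s `^ (1 - beta)) _ (0^'+)); last exact: powR_cvg0.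
      move=> B [e /= e0 eB]; near=> v; apply: eB => /=.
        rewrite sub0r normrN gtr0_norm; last first.
          by rewrite subr_gt0; near: v; exact: nbhs_left_lt.
        rewrite ltrBlDr -ltrBlDl; near: v; apply: nbhs_left_gt.
        by rewrite ltrBlDr ltrDl.
      by rewrite subr_gt0; near: v; exact: nbhs_left_lt.
    apply: cvg_trans; apply: near_eq_cvg; near=> v.
    by rewrite /g /powR gt_eqF// subr_gt0; near: v; exact: nbhs_left_lt.
have -> : (1 - beta) * u `^ (- beta) * V u + u `^ (1 - beta) * Vv u =
   u `^ (- beta) * ((1 - beta) * V u + u * Vv u).
  have -> : u `^ (1 - beta) = u * u `^ (- beta).
    by rewrite powRD ?gt_eqF ?implybT// powRr1// ltW.
  ring.
have -> : (1 - beta) * V u + u * Vv u = u * V1 u by lra.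
have -> : u `^ (1 - beta) = u * u `^ (- beta).
  by rewrite powRD ?gt_eqF ?implybT// powRr1// ltW.
ring.
Unshelve. all: by end_near. Qed.

Section exchange.
Context {d : measure_display} {Y : measurableType d}.
Variables (m : {sigma_finite_measure set Y -> \bar R}) (D : set Y) (l : R).
Variable H : Y -> R -> R.
Hypotheses (mD : measurable D) (l0 : l < 0) (famH : smooth_family m D l H).
Hypothesis mH : measurable_fun (D `*` (`]0%R, +oo[%classic : set (measurableTypeR R)))
  (fun z => H z.1 z.2).

Let mK u : 0 < u -> measurable_fun (D `*` (I01 : set (measurableTypeR R)))
  (fun z => H z.1 (u * z.2) * w z.2).
Proof.
move=> u0; apply: measurable_funM.
  apply: (measurable_comp (F := D `*` (`]0%R, +oo[%classic : set (measurableTypeR R))) (f := fun z => H z.1 z.2)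
    (g := fun z : Y * measurableTypeR R => (z.1, u * z.2))) => //.
  - by apply: measurableX.
  - move=> _ [[x v] [/= Dx /I01P/andP[v0 _]] <-]; split => //=.
    by rewrite in_itv/= andbT mulr_gt0.
  - apply: measurable_funTS; apply/measurable_fun_pairP; split => /=.
      exact: measurable_fst.
    exact: (measurableT_comp (mulrl_measurable u) measurable_snd).
apply: (measurable_comp (F := I01)) => //.
  by move=> _ [[x v] [/= _ Iv] <-].
exact: measurable_funTS measurable_snd.
Qed.

Let bound i e : exists2 G : Y -> R, m.-integrable D (EFin \o G) &
  forall x t, D x -> 0 <= t <= e -> `|derive1n i (H x) t| <= G x.
Proof.
by case: famH => _ _ dH; exact: (dH i 0 e l0).
Qed.

Let rect u : 0 < u -> exists2 G : Y -> R, m.-integrable D (EFin \o G) &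
  forall x v, D x -> I01 v -> `|H x (u * v) * w v| <= G x * w v.
Proof.
move=> u0; have [G iG GH] := bound 0 u; exists G => // x v Dx /I01P/andP[v0 v1].
rewrite normrM (ger0_norm (w_ge0 v)) ler_wpM2r// GH//.
by rewrite mulr_ge0 ?(ltW u0) ?(ltW v0)//= ler_piMr ?(ltW u0)// ltW.
Qed.

Let V x u : R := (\int[mu]_(v in I01) (H x (u * v) * w v))%R.

Let V_measurable u : 0 < u -> measurable_fun D (V ^~ u).
Proof.
move=> u0; have [G iG GH] := rect u0.
exact: (measurable_rectangle_integral mD mI01 (mK u0) iG abel_weight_integrable GH).
Qed.

Let derive1n_integrand x i u v : D x -> 0 < u -> I01 v ->
  derive1n i (fun u => H x (u * v) * w v) u =
  v ^+ i * derive1n i (H x) (u * v) * w v.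
Proof.
move=> Dx u0 /I01P/andP[v0 v1]; have sH := family_smooth famH Dx.
have ll t : 0 < t -> l < v * t.
  by move=> t0; rewrite (lt_le_trans l0)// mulr_ge0// ltW.
have sv : smooth 0 (fun u => H x (v * u)).
  apply: (@smooth_eq _ _ (fun u => H x (v * u + 0))) => [t _|]; first by rewrite addr0.
  by apply: smooth_affine sH => t t0; rewrite addr0 ll.
have -> : (fun u => H x (u * v) * w v) = (fun u => w v * H x (v * u)).
  by apply/funext => t; rewrite mulrC (mulrC t).
by rewrite (@derive1nZ _ 0)// (derive1n_scale ll sH)// (mulrC v u) [RHS]mulrC.
Qed.

Let V_family : smooth_family m D 0 V.
Proof.
split; first exact: V_measurable.
- move=> x Dx.
  exact: (family_integral_smooth mI01 (abel_family l0 (family_smooth famH Dx))).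
- move=> i c e c0; have [G iG GH] := bound i e.
  pose B := (\int[mu]_(v in I01) w v)%R.
  exists (fun x => B * G x); first exact: (integrableZl mD B iG).
  move=> x u Dx /andP[cu ue]; have u0 := lt_le_trans c0 cu.
  have sH := family_smooth famH Dx.
  have le_w v : I01 v -> `|v ^+ i * derive1n i (H x) (u * v) * w v| <= G x * w v.
    move=> /I01P/andP[v0 v1].
    rewrite normrM (ger0_norm (w_ge0 v)) ler_wpM2r// normrM.
    have h : `|derive1n i (H x) (u * v)| <= G x.
      apply: GH => //; rewrite mulr_ge0 ?(ltW u0) ?(ltW v0)//=.
      by rewrite (le_trans _ ue)// ler_piMr ?(ltW u0)// ltW.
    rewrite -[leRHS]mul1r ler_pM// ger0_norm ?exprn_ge0 ?(ltW v0)//.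
    by rewrite exprn_ile1// ltW.
  have mv : measurable_fun I01 (fun v => v ^+ i * derive1n i (H x) (u * v) * w v).
    apply: eq_measurable_fun (family_measurable_derive1n (abel_family l0 sH) i u0).
    by move=> v; rewrite inE => Iv; exact: derive1n_integrand.
  have iGw : mu.-integrable I01 (fun v => (G x * w v)%:E).
    exact: (integrableZl mI01 (G x) abel_weight_integrable).
  have iv : mu.-integrable I01 (fun v => (v ^+ i * derive1n i (H x) (u * v) * w v)%:E).
    apply: (le_integrable mI01) iGw; first exact/measurable_EFinP.
    by move=> v Iv; rewrite lee_fin (le_trans (le_w v Iv))// ler_norm.
  have -> : derive1n i (V x) u =
      (\int[mu]_(v in I01) (v ^+ i * derive1n i (H x) (u * v) * w v))%R.
    rewrite (derive1n_family_integral mI01 (abel_family l0 sH) i u0).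
    by apply: eq_Rintegral => v; rewrite inE => Iv; exact: derive1n_integrand.
  apply: (le_trans (le_normr_Rintegral _ iv)) => //.
  have -> : B * G x = (\int[mu]_(v in I01) (G x * w v))%R.
    by rewrite mulrC RintegralZl//; exact: abel_weight_integrable.
  by apply: le_Rintegral => //; exact: integrable_norm iv.
Qed.

(** The bounds of [H] on [[0, e]] are bounds of its Abel integrals after
    multiplication by the total weight; this uses that [H] is dominated across
    the time [0]. *)
Lemma abel_smooth_family : smooth_family m D 0 (fun x => abel (H x)).
Proof.
apply: (@family_eq _ _ _ m D 0 (fun x u => u `^ (1 - beta) * V x u)).
  by move=> x u Dx u0; have [_ ->] := abelE l0 (family_smooth famH Dx) u0.
by apply: familyM => //; exact: smooth_powR.
Qed.

Lemma abel_exchange u : 0 < u ->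
  abel (fun t => \int[m]_(x in D) H x t)%R u = (\int[m]_(x in D) abel (H x) u)%R.
Proof.
move=> u0; have [_ ->] := abelE l0 (family_integral_smooth mD famH) u0.
have -> : (\int[m]_(x in D) abel (H x) u)%R =
    (\int[m]_(x in D) (u `^ (1 - beta) * V x u))%R.
  apply: eq_Rintegral => x; rewrite inE => Dx.
  by have [_ ->] := abelE l0 (family_smooth famH Dx) u0.
rewrite RintegralZl//; last exact: (family_integrable mD V_family u0).
congr (_ * _); have [G iG GH] := rect u0.
rewrite -(rectangle_Fubini mD mI01 (mK u0) iG abel_weight_integrable GH).
apply: eq_Rintegral => v; rewrite inE => Iv; have /andP[v0 v1] := I01P Iv.
rewrite RintegralZr//; apply: (family_integrable mD famH).
by rewrite (lt_le_trans l0)// mulr_ge0// ltW.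
Qed.

End exchange.

End abel_integral.

(** * Processes with right-constant paths at a random time *)

Section discretization.
Context {R : realType}.
Implicit Types (x t : R).

(** The points [rnd m x] lie strictly to the right of [x] and decrease to it
    like [1 / (m + 1)], while taking countably many values. *)
Definition rnd_idx (m : nat) x : nat := Num.truncn (m.+1%:R * x).

Definition rnd_val (m j : nat) : R := j.+1%:R / m.+1%:R.

Definition rnd (m : nat) x : R := rnd_val m (rnd_idx m x).

Lemma rnd_val_gt0 m j : 0 < rnd_val m j.
Proof. by rewrite divr_gt0. Qed.

Lemma lt_rnd m x : x < rnd m x.
Proof. by rewrite /rnd /rnd_val ltr_pdivlMr// mulrC truncnS_gt. Qed.

Lemma rnd_le m x : 0 <= x -> rnd m x <= x + m.+1%:R^-1.
Proof.
move=> x0; rewrite /rnd /rnd_val ler_pdivrMr// mulrDl mulVf ?pnatr_eq0//.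
by rewrite -natr1 lerD2r mulrC truncn_le mulr_ge0.
Qed.

Lemma rnd_near (Q : R -> Prop) x : 0 <= x -> (\forall s \near x^'+, Q s) ->
  \forall m \near \oo, Q (rnd m x).
Proof.
move=> x0 [e /= e0 He].
have [N HN] : exists N, (N.+1%:R^-1 : R) < e.
  have := @cvg_harmonic R; move/cvgrPdist_lt => /(_ e e0) [N _ HN].
  by exists N; have := HN N (leqnn N); rewrite /harmonic/= sub0r normrN ger0_norm.
exists N => // m /= Nm; apply: He; last exact: lt_rnd.
rewrite /= ler0_norm ?subr_le0 ?(ltW (lt_rnd _ _))// opprB ltrBlDl.
apply: (le_lt_trans (rnd_le m x0)); rewrite ltrD2l.
by apply: le_lt_trans HN; rewrite lef_pV2 ?posrE// ler_nat.
Qed.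

Lemma measurable_rnd_idx m j : measurable [set x : R | rnd_idx m x = j].
Proof.
have mlt (c : R) : measurable [set x : R | m.+1%:R * x < c].
  have -> : [set x : R | m.+1%:R * x < c] = `]-oo, (c / m.+1%:R)[%classic.
    by apply/seteqP; split => x /=; rewrite in_itv/= ltr_pdivlMr// mulrC.
  exact: measurable_itv.
case: j => [|j].
  have -> : [set x : R | rnd_idx m x = 0%N] = [set x | m.+1%:R * x < 1].
    apply/seteqP; split => x /=; rewrite /rnd_idx -(truncn_le_nat _ 0) leqn0.
      by move=> ->.
    by move/eqP.
  exact: mlt.
have -> : [set x : R | rnd_idx m x = j.+1] =
    [set x | m.+1%:R * x < j.+2%:R] `\` [set x | m.+1%:R * x < j.+1%:R].
  apply/seteqP; split => x /=; rewrite /rnd_idx -!truncn_le_nat.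
    by move=> ->; rewrite leqnn ltnn.
  by move=> [h1 /negP]; rewrite -ltnNge => h2; apply/eqP; rewrite eqn_leq h1.
exact: measurableD.
Qed.

End discretization.

Section right_constant.
Context {d : measure_display} {T : measurableType d} {R : realType}.
Implicit Types (F : R -> T -> R) (tau : T -> R).

(** The form that right continuity takes for paths with values in a discrete
    set. *)
Definition right_constant {U : Type} (F : R -> T -> U) :=
  forall w t, 0 <= t -> \forall s \near t^'+, F s w = F t w.

Lemma measurable_select (N : T -> nat) (F : nat -> T -> R) :
  (forall j, measurable [set w | N w = j]) ->
  (forall j, measurable_fun setT (F j)) ->
  measurable_fun setT (fun w => F (N w) w).
Proof.
move=> mN mF _ B mB; rewrite setTI.
have -> : (fun w => F (N w) w) @^-1` B =
    \bigcup_j ([set w | N w = j] `&` (F j @^-1` B)).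
  apply/seteqP; split => [w /= Bw|w [j _ [/= -> //]]].
  by exists (N w).
apply: bigcup_measurable => j _; apply: measurableI => //.
by rewrite -[X in measurable X]setTI; exact: mF.
Qed.

Lemma measurable_preimage tau (B : set R) : measurable_fun setT tau ->
  measurable B -> measurable (tau @^-1` B).
Proof. by move=> mt mB; rewrite -[X in measurable X]setTI; exact: mt. Qed.

(** [tau] is approached from the right by times with countably many values,
    along which the process is eventually constant. *)
Lemma measurable_random_time F tau : (forall t, 0 <= t -> measurable_fun setT (F t)) ->
  right_constant F -> measurable_fun setT tau -> (forall w, 0 <= tau w) ->
  measurable_fun setT (fun w => F (tau w) w).
Proof.
move=> mF rcF mt t0.
apply: (@measurable_fun_cvg _ _ _ _ (fun m w => F (rnd m (tau w)) w)) => //.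
  move=> m; apply: (@measurable_select (fun w => rnd_idx m (tau w))
      (fun j => F (rnd_val m j))).
    by move=> j; exact: (measurable_preimage mt (measurable_rnd_idx m j)).
  by move=> j; apply: mF; exact/ltW/rnd_val_gt0.
move=> w _; apply: cvg_near_cst.
exact: (rnd_near (Q := fun s => F s w = F (tau w) w) (t0 w) (rcF w _ (t0 w))).
Qed.

End right_constant.

Section mixture.
Context {d : measure_display} {T : measurableType d} {R : realType}.
Variable P : probability T R.
Implicit Types (F : R -> T -> R) (tau : T -> R).

(** Dominated convergence for the indicators. *)
Lemma probability_cvg (A : nat -> set T) (B : set T) :
  (forall m, measurable (A m)) -> measurable B ->
  (forall w, \forall m \near \oo, A m w <-> B w) ->
  P (A m) @[m --> \oo] --> P B.
Proof.
move=> mA mB AB.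
have indE (C : set T) : measurable C -> P C = (\int[P]_w (\1_C w)%:E)%E.
  by move=> mC; rewrite integral_indic// setIT.
rewrite indE//; under eq_fun do rewrite indE//.
apply: (@dominated_cvg _ _ _ P _ _ _ _ (cst 1%E)) => //.
- by move=> m; exact/measurable_EFinP/measurable_indic.
- move=> w _; apply: cvg_near_cst; near=> m.
  have E : A m w <-> B w by near: m; exact: AB.
  congr EFin; rewrite !indicE; congr (nat_of_bool _)%:R.
  by apply/idP/idP; rewrite !inE; apply E.
- exact: finite_measure_integrable_cst.
- by move=> m w _; rewrite /= lee_fin indicE; case: (_ \in _); rewrite ?normr1 ?normr0.
Unshelve. all: by end_near. Qed.

Variable F : R -> T -> R.
Hypothesis mF : forall t, 0 <= t -> measurable_fun setT (F t).
Hypothesis rcF : right_constant F.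
Variable n : int.

Let p x := pmf_at P (F x) n.

Let evt x : set T := [set w | F x w = n%:~R].

Let m_evt x : 0 <= x -> measurable (evt x).
Proof. by move=> x0; exact: (measurable_preimage (mF x0) (measurable_set1 n%:~R)). Qed.

Lemma pmf_atE x : 0 <= x -> (p x)%:E = P (evt x).
Proof. by move=> x0; rewrite /p /pmf_at fineK// fin_num_measure//; exact: m_evt. Qed.

Lemma pmf_at_01 x : 0 <= x -> 0 <= p x <= 1.
Proof.
move=> x0; rewrite -!lee_fin pmf_atE// measure_ge0/=.
by apply: probability_le1; exact: m_evt.
Qed.

Lemma pmf_at_cvg x : 0 <= x -> p (rnd m x) @[m --> \oo] --> p x.
Proof.
move=> x0.
have H : P (evt (rnd m x)) @[m --> \oo] --> P (evt x).
  apply: probability_cvg.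
  - by move=> m; apply: m_evt; rewrite (le_trans x0)// ltW// lt_rnd.
  - exact: m_evt.
  - move=> w; have := rnd_near x0 (rcF w x0).
    by apply: filterS => m; rewrite /evt /= => ->.
apply: fine_cvg.
by rewrite -/(p x) fineK ?pmf_atE//; rewrite fin_num_measure//; exact: m_evt.
Qed.

Lemma measurable_pmf_at : measurable_fun (`]0%R, +oo[%classic : set R) p.
Proof.
apply: (@measurable_fun_cvg _ _ _ _ (fun m x => p (rnd m x))).
  move=> m; apply: measurable_funTS.
  by apply: (@measurable_select _ _ _ (rnd_idx m) (fun j _ => p (rnd_val m j)));
    move=> j; [exact: measurable_rnd_idx|exact: measurable_cst].
by move=> x; rewrite /= in_itv/= andbT => x0; apply: pmf_at_cvg; exact: ltW.
Qed.

(** Conditioning on an independent time [tau]: for the discretized times this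
    is a countable sum, and the discretization is then removed. *)
Lemma pmf_at_random_time tau (g : R -> R) (G : set (set T)) :
  independent_sigma_algebras P (family_sigma_algebra [set t | 0 <= t] F) G ->
  measurable_fun setT tau -> (forall w, 0 <= tau w) ->
  (forall B, measurable B -> G (tau @^-1` B)) ->
  measurable_fun (`]0%R, +oo[%classic : set R) g -> (forall x, 0 < x -> 0 <= g x) ->
  has_density_on_pos P tau g ->
  pmf_at P (fun w => F (tau w) w) n =
  (\int[lebesgue_measure]_(x in `]0%R, +oo[) (p x * g x))%R.
Proof.
move=> ind mt t0 Gt mg g0 dens.
pose D : set R := `]0, +oo[%classic.
have mD : measurable (D : set (measurableTypeR R)) by exact: measurable_itv.
have Dgt x : D x -> 0 < x by rewrite /D /= in_itv/= andbT.
have ig : lebesgue_measure.-integrable D (EFin \o g).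
  apply/integrableP; split; first exact/measurable_EFinP.
  have := dens setT measurableT; rewrite setTI => H.
  have -> : (\int[lebesgue_measure]_(x in D) `|(EFin \o g) x| =
      \int[lebesgue_measure]_(x in D) (g x)%:E)%E.
    by apply: eq_integral => x; rewrite inE => /Dgt x0 /=; rewrite ger0_norm// g0.
  rewrite -[X in (X < _)%E]H.
  have -> : [set w | [set: R] (tau w)] = setT by apply/seteqP; split.
  by rewrite probability_setT ltry.
pose cell m j : set R := [set x | rnd_idx m x = j].
have mcell m j : measurable (cell m j) by exact: measurable_rnd_idx.
pose E m := [set w | F (rnd m (tau w)) w = n%:~R].
have EU m : E m = \bigcup_j (evt (rnd_val m j) `&` tau @^-1` (cell m j)).
  apply/seteqP; split => w /=.
    by move=> Ew; exists (rnd_idx m (tau w)) => //; split.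
  by move=> [j _ [/= Ew tj]]; rewrite /E /= /rnd tj.
have mpiece m j : measurable (evt (rnd_val m j) `&` tau @^-1` (cell m j)).
  apply: measurableI; first exact/m_evt/ltW/rnd_val_gt0.
  exact: measurable_preimage.
have mE m : measurable (E m) by rewrite EU; exact: bigcup_measurable.
have mpr m : measurable_fun D (fun x => p (rnd m x)).
  apply: measurable_funTS.
  by apply: (@measurable_select _ _ _ (rnd_idx m) (fun j _ => p (rnd_val m j)));
    move=> j; [exact: measurable_rnd_idx|exact: measurable_cst].
have mprg m : measurable_fun D (fun x => (p (rnd m x) * g x)%:E).
  by apply/measurable_EFinP; apply: measurable_funM.
have p0 x : 0 <= x -> 0 <= p x by move=> x0; have /andP[] := pmf_at_01 x0.
have p1 x : 0 <= x -> p x <= 1 by move=> x0; have /andP[] := pmf_at_01 x0.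
have rnd0 m (x : R) : 0 < x -> 0 <= rnd m x by move=> x0; rewrite (le_trans (ltW x0))// ltW// lt_rnd.
have cellD m : D = \bigcup_j (cell m j `&` D).
  rewrite -setI_bigcupl; apply/seteqP; split => [x Dx|x []//].
  by split => //; exists (rnd_idx m x).
have mcellD m j : measurable (cell m j `&` D : set (measurableTypeR R)).
  by apply: measurableI => //; exact: mcell.
have PE m : P (E m) = (\int[lebesgue_measure]_(x in D) (p (rnd m x) * g x)%:E)%E.
  rewrite [in RHS](cellD m) ge0_integral_bigcup//; last 3 first.
  - by rewrite -(cellD m); exact: mprg.
  - move=> x [j _ [_ /Dgt x0]].
    by rewrite lee_fin mulr_ge0 ?g0 ?p0 ?rnd0.
  - apply/trivIsetP => i j _ _ /eqP ij.
    by rewrite -subset0 => x [[xi _] [xj _]]; apply: ij; rewrite -xi -xj.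
  rewrite EU measure_bigcup//; last first.
    apply/trivIsetP => i j _ _ /eqP ij.
    by rewrite -subset0 => w [[_ xi] [_ xj]]; apply: ij; rewrite -xi -xj.
  rewrite (@eq_eseriesl _ _ xpredT); last by move=> j; rewrite in_setT.
  apply: eq_eseriesr => j _.
  have Fevt : family_sigma_algebra [set t | 0 <= t] F (evt (rnd_val m j)).
    apply: sub_sigma_algebra; exists (rnd_val m j); split; first exact/ltW/rnd_val_gt0.
    by exists [set n%:~R]; split.
  rewrite [LHS](ind _ _ Fevt (Gt _ (mcell m j))).
  rewrite dens// -pmf_atE; last exact/ltW/rnd_val_gt0.
  rewrite -ge0_integralZl//; last 3 first.
  - by apply/measurable_EFinP; apply: measurable_funS mg => // x [].
  - by move=> x [_ /Dgt x0]; rewrite lee_fin g0.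
  - by rewrite lee_fin p0// ltW// rnd_val_gt0.
  by apply: eq_integral => x; rewrite inE => -[/= cx Dx]; rewrite /rnd cx EFinM.
have H1 : P (E m) @[m --> \oo] --> P [set w | F (tau w) w = n%:~R].
  apply: probability_cvg => //.
    have mFt := measurable_random_time mF rcF mt t0.
    exact: (measurable_preimage mFt (measurable_set1 n%:~R)).
  move=> w; have := rnd_near (t0 w) (rcF w (t0 w)).
  by apply: filterS => m; rewrite /E /= => ->.
have H2 : (\int[lebesgue_measure]_(x in D) (p (rnd m x) * g x)%:E)%E @[m --> \oo] -->
    (\int[lebesgue_measure]_(x in D) (p x * g x)%:E)%E.
  apply: (@dominated_cvg _ _ _ lebesgue_measure _ _ _ _ (EFin \o g)) => //.
  - move=> x /Dgt x0; apply: cvg_EFin; first exact: nearW.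
    by apply: cvgM; [exact: pmf_at_cvg (ltW x0)|exact: cvg_cst].
  - move=> m x /Dgt x0; rewrite lee_fin normrM (ger0_norm (g0 _ x0)).
    by rewrite ler_piMl ?g0// ger0_norm ?p0 ?p1 ?rnd0.
rewrite /pmf_at /Rintegral; congr fine.
have H3 : P (E m) @[m --> \oo] -->
    (\int[lebesgue_measure]_(x in D) (p x * g x)%:E)%E.
  by under eq_fun do rewrite PE.
by rewrite (cvg_unique _ H1 H3).
Qed.

End mixture.

(** * The Skellam process near time zero *)

Lemma nbhs_right_ge0 {R : realType} (t : R) : 0 <= t -> \forall s \near t^'+, 0 <= s.
Proof. by move=> t0; near=> s; apply: (le_trans t0); apply: ltW; near: s; exact: nbhs_right_gt.
Unshelve. all: by end_near. Qed.

Section counting.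
Context {d : measure_display} {T : measurableType d} {R : realType}.
Variable P : probability T R.

(** The event [J t] stands for a jump of the driving Poisson processes before
    [t]. It is recorded in place of [S t != 0] because it increases with [t],
    so that it also controls [S] at a random time not exceeding [t]. *)
Record slow_start (S : R -> T -> R) (c : R) (J : R -> set T) : Prop := SlowStart {
  slow_measurable : forall t, 0 <= t -> measurable_fun setT (S t) ;
  slow_right_constant : right_constant S ;
  slow_event : forall t, 0 <= t -> measurable (J t) ;
  slow_event_mono : forall s t, 0 <= s -> s <= t -> J s `<=` J t ;
  slow_event_small : forall t, 0 < t -> (P (J t) <= (c * t)%:E)%E ;
  slow_rest : forall t w, 0 <= t -> ~ J t w -> S t w = 0 }.

Lemma measurable_nat_level (N : T -> nat) (j : nat) : measurable_fun setT N ->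
  measurable [set w | N w = j].
Proof.
move=> mN; have := mN measurableT [set j] I; rewrite setTI.
by congr (measurable _); apply/seteqP; split.
Qed.

Lemma measurable_natr (N : T -> nat) : measurable_fun setT N ->
  measurable_fun setT (fun w => (N w)%:R : R).
Proof.
move=> mN; apply: (@measurable_select _ _ _ N (fun j _ => j%:R)) => //.
by move=> j; exact: measurable_nat_level.
Qed.

Lemma natr_dist_lt1 (i j : nat) : `|i%:R - j%:R| < 1 :> R -> j = i.
Proof.
suff H (x y : nat) : (y < x)%N -> ~ (`|x%:R - y%:R| < 1 :> R).
  by case: (ltngtP i j) => // [/H|/H //]; rewrite distrC.
move=> yx; rewrite -natrB ?(ltnW yx)// normr_nat -[1]/(1%:R) ltr_nat ltnS leqn0 subn_eq0.
by rewrite leqNgt yx.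
Qed.

Lemma PPoK_slow_start (k : nat) (lam : R) M : (1 <= k)%N -> 0 < lam ->
  PPoK P k lam M -> exists J, slow_start M (k%:R * lam) J.
Proof.
move=> k1 lam0 [N [X [[mN subN lawN] unifX _ _ ME]]].
have klam0 : 0 < k%:R * lam by rewrite mulr_gt0// ltr0n.
have rcN : right_constant N.
  move=> w t t0; have := @subordinator_right_continuous _ _ _ _ _ subN w t t0.
  by move/cvgrPdist_lt => /(_ 1 ltr01); apply: filterS => s /natr_dist_lt1.
have monoN w s t : 0 <= s -> s <= t -> (N s w <= N t w)%N.
  by move=> s0 st; have := subordinator_monotone subN w s0 st; rewrite ler_nat.
exists (fun t => [set w | N t w != 0%N]).
have mJ t : 0 <= t -> measurable [set w | N t w != 0%N].
  move=> t0; have := measurableC (measurable_nat_level 0 (mN t t0)).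
  by congr (measurable _); apply/seteqP; split => w /= /eqP.
split => //.
- move=> t t0.
  have : measurable_fun setT (fun w => \sum_(i < N t w) (X i w)%:R : R).
    apply: (@measurable_select _ _ _ (N t) (fun j w => \sum_(i < j) (X i w)%:R)).
      by move=> j; apply: measurable_nat_level; exact: mN.
    move=> j; apply: measurable_sum => i; apply: measurable_natr.
    by have [] := unifX i.
  by apply: eq_measurable_fun => w _; rewrite ME.
- move=> w t t0; near=> s.
  have Ns : N s w = N t w by near: s; exact: rcN.
  have s0 : 0 <= s by near: s; exact: nbhs_right_ge0.
  by rewrite !ME ?Ns.
- move=> s t s0 st w /=; rewrite -!lt0n => h.
  by apply: leq_trans h _; exact: monoN.
- move=> t t0.
  have -> : [set w | N t w != 0%N] = ~` [set w | N t w = 0%N].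
    by apply/seteqP; split => w /= /eqP.
  rewrite probability_setC; last exact: measurable_nat_level (mN _ (ltW t0)).
  rewrite lawN// /poisson_pmf mulr_gt0// expr0 fact0 invr1 !mul1r -EFinB lee_fin.
  by have := expR_ge1Dx (- (k%:R * lam * t)); lra.
- move=> t w t0 /= /negP; rewrite negbK => /eqP N0.
  by rewrite ME// N0 big_ord0.
Unshelve. all: by end_near. Qed.

Lemma SPoK_slow_start (k : nat) (lam1 lam2 : R) S : (1 <= k)%N ->
  0 < lam1 -> 0 < lam2 -> SPoK P k lam1 lam2 S ->
  exists J, slow_start S (k%:R * lam1 + k%:R * lam2) J.
Proof.
move=> k1 l1 l2 [M1 [M2 [PM1 PM2 _ SE]]].
have [J1 [m1 r1 e1 u1 p1 s1]] := PPoK_slow_start k1 l1 PM1.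
have [J2 [m2 r2 e2 u2 p2 s2]] := PPoK_slow_start k1 l2 PM2.
exists (fun t => J1 t `|` J2 t); split.
- move=> t t0; have := measurable_funB (m1 t t0) (m2 t t0).
  by apply: eq_measurable_fun => w _; rewrite SE.
- move=> w t t0; near=> s.
  have h1 : M1 s w = M1 t w by near: s; exact: r1.
  have h2 : M2 s w = M2 t w by near: s; exact: r2.
  have s0 : 0 <= s by near: s; exact: nbhs_right_ge0.
  by rewrite !SE ?h1 ?h2.
- by move=> t t0; apply: measurableU; [exact: e1|exact: e2].
- by move=> s t s0 st w [/(u1 _ _ s0 st)|/(u2 _ _ s0 st)]; [left|right].
- move=> t t0; apply: (@le_trans _ _ (P (J1 t) + P (J2 t))%E).
    by apply: measureU2; [exact: e1 (ltW t0)|exact: e2 (ltW t0)].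
  by rewrite mulrDl EFinD leeD// ?p1// p2.
- move=> t w t0 nJ; rewrite SE// s1 ?s2 ?subrr// => Jt; apply: nJ; by [left|right].
Unshelve. all: by end_near. Qed.

End counting.

(** * The inverse of a subordinator *)

Lemma measurable_le_level {d : measure_display} {T : measurableType d} {R : realType}
    (X : T -> R) (c : R) : measurable_fun setT X -> measurable [set w | X w <= c].
Proof.
move=> mX; have := measurable_preimage mX (measurable_itv (Interval -oo%O (BRight c))).
by congr (measurable _); apply/seteqP; split => w /=; rewrite in_itv.
Qed.

Section first_passage.
Context {d : measure_display} {T : measurableType d} {R : realType}.
Variables (P : probability T R) (D : R -> T -> R).
Hypothesis subD : subordinator P D.
Implicit Types (t : R) (w : T).

Let hit t w : set R := [set r | 0 <= r /\ t < D r w].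

Let hit_lbound t w : lbound (hit t w) 0.
Proof. by move=> r []. Qed.

Lemma path_inverse_ge0 t w : 0 <= path_inverse D t w.
Proof.
rewrite /path_inverse -/(hit t w).
have [->|/set0P ne] := eqVneq (hit t w) set0; first by rewrite inf0.
by apply: lb_le_inf => //; exact: hit_lbound.
Qed.

Lemma path_inverse_le t r w : 0 <= r -> t < D r w -> path_inverse D t w <= r.
Proof. by move=> r0 tr; apply: ge_inf; [exists 0; exact: hit_lbound|split]. Qed.

(** The default value of the infimum enters when the path never exceeds [t]. *)
Lemma path_inverse_lt t c w : 0 < c -> path_inverse D t w < c <->
  (forall j : nat, D j%:R w <= t) \/
  exists m j, rnd_val m j < c /\ t < D (rnd_val m j) w.
Proof.
move=> c0; split.
  move=> Yc; have [e|/set0P ne] := eqVneq (hit t w) set0.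
    left => j; rewrite leNgt; apply/negP => tj.
    by have : hit t w j%:R by []; rewrite e.
  right; have [r [r0 tr] rc] : exists2 r, hit t w r & r < c.
    by apply: inf_lt.
  have : \forall s \near r^'+, s < c by exact: nbhs_right_lt.
  move=> /(rnd_near (Q := fun s => s < c) r0) [m _ /(_ m (leqnn m)) h].
  exists m, (rnd_idx m r); split => //; apply: (lt_le_trans tr).
  exact: (subordinator_monotone subD w r0 (ltW (lt_rnd m r))).
case=> [e|[m [j [jc tj]]]].
  suff h0 : hit t w = set0 by rewrite /path_inverse -/(hit t w) h0 inf0.
  rewrite -subset0 => r [r0 tr]; have := e (Num.truncn r).+1.
  rewrite leNgt => /negP; apply; apply: (lt_le_trans tr).
  exact: (subordinator_monotone subD w r0 (ltW (truncnS_gt r))).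
by apply: le_lt_trans jc; apply: path_inverse_le => //; exact/ltW/rnd_val_gt0.
Qed.

Lemma measurable_path_inverse t : 0 <= t -> measurable_fun setT (path_inverse D t).
Proof.
move=> t0.
have mle r : 0 <= r -> measurable [set w | D r w <= t].
  by move=> r0; exact/measurable_le_level/(subordinator_measurable subD).
have mlt r : 0 <= r -> measurable [set w | t < D r w].
  move=> r0; have := measurableC (mle r r0); congr (measurable _).
  by apply/seteqP; split => w /=; rewrite ltNge => /negP.
apply: (measurability _ (RGenInftyO.measurableE R)) => //.
move=> _ [_ [c ->] <-]; rewrite setTI.
have [c0|c0] := ltP 0 c; last first.
  suff -> : path_inverse D t @^-1` `]-oo, c[ = set0 by exact: measurable0.
  rewrite -subset0 => w /=; rewrite in_itv/= ltNge => /negP; apply.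
  by apply: (le_trans c0); exact: path_inverse_ge0.
have -> : path_inverse D t @^-1` `]-oo, c[ =
    (\bigcap_j [set w | D j%:R w <= t]) `|`
    \bigcup_m \bigcup_j ([set w | rnd_val m j < c] `&` [set w | t < D (rnd_val m j) w]).
  apply/seteqP; split => w /=; rewrite in_itv/=.
    move=> /(path_inverse_lt _ _ c0) [h|[m [j [h1 h2]]]]; [left => j _; exact: h|].
    by right; exists m => //; exists j.
  case=> [h|[m _ [j _ [h1 h2]]]]; apply/(path_inverse_lt _ _ c0).
    by left => j; exact: h.
  by right; exists m, j.
apply: measurableU.
  by apply: bigcap_measurable => // j _; exact: mle.
apply: bigcup_measurable => m _; apply: bigcup_measurable => j _.
apply: measurableI; last exact/mlt/ltW/rnd_val_gt0.
case: (rnd_val m j < c); last by rewrite (_ : mkset _ = set0) //; apply/seteqP; split.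
by rewrite (_ : mkset _ = setT) //; apply/seteqP; split.
Qed.

(** Right continuity of the inverse. Its values at later times are moreover not
    smaller, so composition with right-constant paths is right constant; when
    the path never exceeds [t], the infimum is [0] from [t] on. *)
Lemma path_inverse_right t w (e : R) : 0 <= t -> 0 < e ->
  \forall s \near t^'+, path_inverse D t w <= path_inverse D s w < path_inverse D t w + e.
Proof.
move=> t0 e0.
have sub s : t < s -> hit s w `<=` hit t w.
  by move=> ts r [r0 sr]; split => //; exact: lt_trans sr.
have [h0|/set0P ne] := eqVneq (hit t w) set0.
  near=> s.
  have ts : t < s by near: s; exact: nbhs_right_gt.
  have hs : hit s w = set0 by rewrite -subset0 -h0; exact: sub.
  by rewrite /path_inverse -/(hit t w) -/(hit s w) h0 hs inf0 lexx add0r.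
have [r [r0 tr] re] : exists2 r, hit t w r & r < path_inverse D t w + e.
  by apply: inf_lt => //; rewrite ltrDl.
near=> s.
have ts : t < s by near: s; exact: nbhs_right_gt.
have sr : s < D r w by near: s; exact: nbhs_right_lt.
apply/andP; split; last exact: le_lt_trans (path_inverse_le r0 sr) re.
apply: lb_le_inf; first by exists r.
move=> r' /(sub _ ts) hr'; apply: ge_inf => //.
by exists 0; exact: hit_lbound.
Unshelve. all: by end_near. Qed.

End first_passage.

(** * The fractional Skellam process near time zero *)

Section fractional_time.
Context {d : measure_display} {T : measurableType d} {R : realType}.
Variable P : probability T R.

(** Chernoff bound: small values of a stable variable are unlikely. *)
Lemma stable_small (alpha : R) (D : R -> T -> R) (r x : R) :
  stable_subordinator P alpha D -> 0 < r -> 0 < x ->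
  (P [set w | (D r w <= x)%R] <= (expR 1 * (x `^ alpha / r))%:E)%E.
Proof.
move=> [subD lap] r0 x0.
have mD := subordinator_measurable subD (ltW r0).
have mB : measurable [set w | D r w <= x] by exact: measurable_le_level.
have ix0 : 0 < x^-1 by rewrite invr_gt0.
have := lap _ _ ix0 (ltW r0); rewrite unlock => E.
have : ((expR (-1))%:E * P [set w | (D r w <= x)%R] <= (expR (- (r * x^-1 `^ alpha)))%:E)%E.
  rewrite -E -[X in (_ * P X)%E]setIT -integral_indic// -ge0_integralZl//; last first.
    exact/measurable_EFinP/measurable_indic.
  apply: ge0_le_integral => //.
  - by apply/measurable_EFinP/measurable_funM => //; exact: measurable_indic.
  - apply/measurable_EFinP; apply: measurableT_comp => //; apply: measurableT_comp => //.
    exact: measurable_funM.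
  - move=> w _; rewrite -EFinM lee_fin indicE.
    have [|_] := boolP (w \in _); last by rewrite mulr0 expR_ge0.
    rewrite inE/= mulr1 ler_expR lerN2 => h.
    by rewrite mulrC ler_pdivrMr// mul1r.
have PB := @fin_num_measure _ _ _ P _ mB.
rewrite -(fineK PB) -EFinM !lee_fin => h.
have y0 : 0 < r * x^-1 `^ alpha by rewrite mulr_gt0// powR_gt0.
have hy : expR (- (r * x^-1 `^ alpha)) <= x `^ alpha / r.
  have -> : x `^ alpha / r = (r * x^-1 `^ alpha)^-1.
    by rewrite -[x^-1]powR_inv1 ?ltW// -powRrM mulN1r powRN invfM invrK mulrC.
  rewrite expRN lef_pV2 ?posrE ?expR_gt0//.
  by have := expR_ge1Dx (r * x^-1 `^ alpha); lra.
have := le_trans h hy; rewrite expRN mulrC ler_pdivrMr ?expR_gt0//.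
by rewrite mulrC.
Qed.

(** For [alpha < 1] compare the random clock at [x] with [r = x ^ (alpha / 2)].
    If the clock is still below [r], then a nonzero value requires a jump before
    [r], of probability [O (r)]; the clock exceeds [r] with probability
    [O (x ^ alpha / r)] by [stable_small]. This [r] balances the two terms. *)
Lemma FSPoK_regular (k : nat) (lam1 lam2 alpha : R) FS : (1 <= k)%N ->
  0 < lam1 -> 0 < lam2 -> 0 < alpha <= 1 -> FSPoK P k lam1 lam2 alpha FS ->
  [/\ forall t, 0 <= t -> measurable_fun setT (FS t), right_constant FS &
      exists delta C, 0 < delta <= 1 /\ forall x, 0 < x ->
        (P [set w | FS x w != 0%R] <= (C * expR (delta * ln x))%:E)%E].
Proof.
move=> k1 l1 l2 /andP[al0 al1] hF.
have mne (X : T -> R) : measurable_fun setT X -> measurable [set w | X w != 0].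
  move=> mX; have := measurableC (measurable_preimage mX (measurable_set1 0)).
  by congr (measurable _); apply/seteqP; split => w /= /eqP.
have imp x (X : T -> R) (A : set T) : measurable_fun setT X -> measurable A ->
    (forall w, ~ A w -> X w = 0) -> (P A <= x)%E -> (P [set w | X w != 0%R] <= x)%E.
  move=> mX mA h; apply: le_trans; apply: le_measure; rewrite ?inE; [exact: mne|by []|].
  by move=> w /= /eqP X0; apply: contrapT => /h.
case: hF => [[_ sF]|[al01 [S [D [sS stD _ FE]]]]].
  have [J [m r eJ u pJ s]] := SPoK_slow_start k1 l1 l2 sF.
  split => //; exists 1, (k%:R * lam1 + k%:R * lam2); split; first by rewrite ltr01 lexx.
  move=> x x0; rewrite mul1r lnK ?posrE//.
  by apply: (imp _ _ (J x)) => //; [exact: m (ltW x0)|exact: eJ (ltW x0)|move=> w; exact: s (ltW x0)|exact: pJ].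
have [J [m r eJ u pJ s]] := SPoK_slow_start k1 l1 l2 sS.
have subD : subordinator P D by case: stD.
have Y0 t w := path_inverse_ge0 D t w.
have mF t : 0 <= t -> measurable_fun setT (FS t).
  move=> t0; have := measurable_random_time m r (measurable_path_inverse subD t0) (Y0 t).
  by apply: eq_measurable_fun => w _; rewrite FE.
split => //.
  move=> w t t0.
  have [e /= e0 He] := r w _ (Y0 t w).
  near=> q.
  have q0 : 0 <= q by near: q; exact: nbhs_right_ge0.
  rewrite !FE//.
  have /andP[] : path_inverse D t w <= path_inverse D q w < path_inverse D t w + e.
    by near: q; exact: path_inverse_right.
  rewrite le_eqVlt => /orP[/eqP <- //|lt1 lt2].
  apply: He => //=; rewrite distrC ger0_norm ?subr_ge0 ?ltW//.
  by rewrite ltrBlDl.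
exists (alpha / 2), (k%:R * lam1 + k%:R * lam2 + expR 1); split.
  by rewrite divr_gt0//=; lra.
move=> x x0.
set c := k%:R * lam1 + k%:R * lam2.
have -> : expR (alpha / 2 * ln x) = x `^ (alpha / 2) by rewrite /powR gt_eqF.
set rr := x `^ (alpha / 2).
have rr0 : 0 < rr by exact: powR_gt0.
have mD : measurable [set w | D rr w <= x].
  exact/measurable_le_level/(subordinator_measurable subD)/ltW.
apply: (imp _ _ (J rr `|` [set w | D rr w <= x])).
- exact: mF (ltW x0).
- by apply: measurableU => //; exact: eJ (ltW rr0).
- move=> w nA; rewrite FE ?(ltW x0)//; apply: s => // Jw; apply: (nA); left.
  apply: u Jw => //; apply: path_inverse_le; first exact: ltW.
  by rewrite ltNge; apply/negP => h; apply: nA; right.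
- apply: (@le_trans _ _ (P (J rr) + P [set w | (D rr w <= x)%R])%E).
    by apply: measureU2 => //; exact: eJ (ltW rr0).
  rewrite mulrDl EFinD leeD ?pJ//.
  have := stable_small stD rr0 x0; congr (_ <= (_ * _)%:E)%E.
  rewrite /rr -powRN -powRD; last by rewrite (gt_eqF x0) implybT.
  by congr (_ `^ _); lra.
Unshelve. all: by end_near. Qed.

End fractional_time.

(** * Mixtures of the gamma densities *)

Section density_mixture.
Context {R : realType}.
Notation mu := (@lebesgue_measure R).
Implicit Types (t x : R) (phi : R -> R).
Variables (a b : R).
Hypotheses (a0 : 0 < a) (b0 : 0 < b).

Let D : set R := `]0, +oo[%classic.
Let mD : measurable (D : set (measurableTypeR R)). Proof. exact: measurable_itv. Qed.
Let Dgt x : D x -> 0 < x. Proof. by rewrite /D /= in_itv/= andbT. Qed.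

(** The mixture of [phi] against the gamma densities, written so that it makes
    sense, and stays smooth, for some negative [t] when [phi] vanishes at [0]. *)
Definition mixture phi t : R :=
  (\int[mu]_(x in D) (density_coef a b t * mellin a b phi x t))%R.

Lemma mixtureE phi t : 0 < t ->
  (\int[mu]_(x in D) (phi x * gamma_density a b x t))%R = mixture phi t.
Proof.
move=> t0; apply: eq_Rintegral => x; rewrite inE => /Dgt x0.
exact: mellin_densityE.
Qed.

Lemma mixture0 phi : mixture phi 0 = 0.
Proof.
rewrite /mixture; under eq_Rintegral do rewrite density_coef0 mul0r.
by rewrite Rintegral_cst// mul0r.
Qed.

Lemma mellin_smooth l phi x : smooth l (mellin a b phi x).
Proof.
apply: smoothM; first exact: smooth_cst.
apply: smoothM; last exact: smooth_cst.
apply: smooth_expR; apply: smoothM; last exact: smooth_cst.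
apply: smoothD; last exact: smooth_cst.
by apply: smoothM; [exact: smooth_cst|exact: smooth_id].
Qed.

Section power_like_weight.
Variables (delta : R) (phi : R -> R).
Hypotheses (d01 : 0 <= delta <= 1) (pphi : power_like delta phi).

Let d1 : delta <= 1. Proof. by case/andP: d01. Qed.

Let l : R := - (delta / b).

Let l0 : l <= 0.
Proof. by rewrite oppr_le0 divr_ge0 ?(ltW b0)//; case/andP: d01. Qed.

Lemma mixture_smooth : smooth (- (delta / b)) (mixture phi).
Proof. exact: (family_integral_smooth mD (density_family a0 b0 d1 pphi)). Qed.

(** Differentiate the density under the integral sign; its logarithmic
    derivative in [t] is [b (log a - psi (b t) + log x)]. *)
Lemma derive1_mixture t : 0 < t -> derive1 (mixture phi) t =
  b * ((ln a - digamma (b * t)) * mixture phi t) + b * mixture (fun x => phi x * ln x) t.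
Proof.
move=> t0.
have fam := family_widen l0 (density_family a0 b0 d1 pphi).
have faml := family_widen l0 (density_family a0 b0 d1 (power_like_ln pphi)).
have [_] := family_integral_is_derive mD fam t0.
rewrite -derive1E => ->.
set c := ln a - digamma (b * t).
rewrite mulrA /mixture -RintegralZl//; last exact: family_integrable fam _ t0.
rewrite -RintegralZl//; last exact: family_integrable faml _ t0.
rewrite -RintegralD//; last 2 first.
- exact: (integrableZl mD _ (family_integrable mD fam t0)).
- exact: (integrableZl mD _ (family_integrable mD faml t0)).
apply: eq_Rintegral => x; rewrite inE => /Dgt x0.
rewrite (@derive1_eq _ 0 _ (fun t => phi x * gamma_density a b x t))//; last first.
  by move=> s s0; rewrite mellin_densityE.
have dg := smooth_is_derive (gamma_density_smooth a0 b0 x0) t0.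
have -> : (fun t => phi x * gamma_density a b x t) = phi x \*: gamma_density a b x.
  exact/funext.
rewrite derive1E derive_val derive1_gamma_density// /GRing.scale/=.
by rewrite -!mellin_densityE// /c; ring.
Qed.

(** The same equation with the mixtures moved to the right, which shows that
    [(log a - psi (b t)) * mixture phi t] continues smoothly through [t = 0]
    although [psi] has a pole there. *)
Definition digamma_mixture t : R :=
  b^-1 * derive1 (mixture phi) t - mixture (fun x => phi x * ln x) t.

Lemma digamma_mixtureE t : 0 < t ->
  (ln a - digamma (b * t)) * mixture phi t = digamma_mixture t.
Proof.
by move=> t0; rewrite /digamma_mixture derive1_mixture//; field; rewrite gt_eqF.
Qed.

End power_like_weight.

Lemma digamma_mixture_smooth delta phi : 0 <= delta <= 1 -> power_like delta phi ->
  smooth (- (delta / b)) (digamma_mixture phi).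
Proof.
move=> d01 pphi.
apply: (@smooth_eq _ _ (fun t => b^-1 * derive1 (mixture phi) t +
    (-1) * mixture (fun x => phi x * ln x) t)).
  by move=> t _; rewrite mulN1r.
apply: smooth_lin; last exact: mixture_smooth d01 (power_like_ln pphi).
apply: smoothM; first exact: smooth_cst.
exact/smooth_derive1/(mixture_smooth d01).
Qed.

Lemma measurable_density_mellin phi : measurable_fun D phi ->
  measurable_fun ((D : set (measurableTypeR R)) `*` (D : set (measurableTypeR R)))
    (fun z => density_coef a b z.2 * mellin a b phi z.1 z.2).
Proof.
move=> mphi.
have mDD : measurable ((D : set (measurableTypeR R)) `*` (D : set (measurableTypeR R))).
  exact: measurableX.
apply: measurable_funM.
  apply: (measurable_comp (F := (D : set (measurableTypeR R)))) => //.
  - by move=> _ [z [_ Dz] <-].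
  - apply: open_continuous_measurable_fun; first exact: interval_open.
    move=> s; rewrite inE => /Dgt s0; apply: (smooth_continuous (density_coef_smooth a b0)).
    by rewrite (le_lt_trans _ s0)// oppr_le0 divr_ge0// ltW.
  - exact: measurable_funTS measurable_snd.
have m1 : measurable_fun ((D : set (measurableTypeR R)) `*` (D : set (measurableTypeR R))) fst.
  exact: measurable_funTS measurable_fst.
have m2 : measurable_fun ((D : set (measurableTypeR R)) `*` (D : set (measurableTypeR R))) snd.
  exact: measurable_funTS measurable_snd.
apply: measurable_funM.
  apply: (measurable_comp (F := (D : set (measurableTypeR R)))) => //.
  by move=> _ [z [Dz _] <-].
apply: measurable_funM.
  apply: measurableT_comp => //; apply: measurable_funM.
    by apply: measurable_funB => //; exact: measurable_funM.
  by apply: (measurableT_comp (@measurable_ln R)).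
apply: measurableT_comp => //; apply: measurableT_comp => //; exact: measurable_funM.
Qed.

End density_mixture.

(** * Riemann-Liouville derivatives through Abel integrals *)

Section riemann_liouville_orders.
Context {R : realType}.
Implicit Types (f : R -> R) (m : nat) (beta gam : R).

Lemma RL_derive_nat m f t : RL_derive m%:R f t = derive1n m f t.
Proof. by rewrite /RL_derive natr_nat natrK. Qed.

Lemma RL_derivable_nat m f : RL_derivable m%:R f <-> nsmooth 0 m f.
Proof. by rewrite /RL_derivable natr_nat natrK. Qed.

Lemma order_decomposition gam : 1 <= gam ->
  (exists m, gam = m.+1%:R) \/
  exists m beta, 0 < beta < 1 /\ gam = m.+1%:R + beta.
Proof.
move=> gam1; have gam0 : 0 <= gam by exact: le_trans gam1.
have /andP[lo hi] := truncn_itv gam0.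
have : (0 < Num.truncn gam)%N by rewrite truncn_gt0.
case E : (Num.truncn gam) lo hi => [//|m] lo hi _.
have [gm|gm] := eqVneq gam m.+1%:R; first by left; exists m.
right; exists m, (gam - m.+1%:R); split; last by rewrite addrC subrK.
rewrite subr_gt0 lt_neqAle eq_sym gm lo/= ltrBlDr addrC.
by rewrite natr1.
Qed.

Lemma abel_eq beta f g : (forall t, 0 < t -> f t = g t) -> abel beta f = abel beta g.
Proof.
move=> fg; apply/funext => u; apply: eq_Rintegral => s.
by rewrite inE/= in_itv/= => /andP[s0 _]; rewrite fg.
Qed.

Section fractional_order.
Variables (m : nat) (beta : R).
Hypothesis beta01 : 0 < beta < 1.

Let truncE : Num.truncn (m%:R + beta) = m.
Proof.
have /andP[b0 b1] := beta01; apply: truncn_def.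
by rewrite lerDl (ltW b0)/= -natr1 ltrD2l.
Qed.

Lemma fractional_order_not_nat : (m%:R + beta \is a Num.nat) = false.
Proof.
have /andP[b0 b1] := beta01; apply/negP; rewrite natrEtruncn truncE.
by rewrite -subr_eq0 opprD addrA subrr sub0r oppr_eq0 gt_eqF.
Qed.

Let expE : m%:R + beta + 1 - m.+1%:R = beta.
Proof. by rewrite -natr1; ring. Qed.

Lemma RL_kernel_frac f u s : RL_kernel (m%:R + beta) f u s = f s / (u - s) `^ beta.
Proof. by rewrite /RL_kernel truncE expE. Qed.

Lemma RL_integral_frac f : RL_integral (m%:R + beta) f = abel beta f.
Proof.
apply/funext => u; apply: eq_Rintegral => s _; exact: RL_kernel_frac.
Qed.

Lemma RL_derive_frac f t :
  RL_derive (m%:R + beta) f t = (Gamma (1 - beta))^-1 * derive1n m.+1 (abel beta f) t.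
Proof.
have e : m.+1%:R - (m%:R + beta) = 1 - beta by rewrite -natr1; ring.
by rewrite /RL_derive fractional_order_not_nat truncE RL_integral_frac e.
Qed.

Lemma RL_derivable_frac f : RL_derivable (m%:R + beta) f <->
  (forall u, 0 < u -> lebesgue_measure.-integrable `]0%R, u[
     (fun s => (f s / (u - s) `^ beta)%:E)) /\ nsmooth 0 m.+1 (abel beta f).
Proof.
rewrite /RL_derivable fractional_order_not_nat truncE RL_integral_frac.
have E u : (fun s => (RL_kernel (m%:R + beta) f u s)%:E) =
    (fun s => (f s / (u - s) `^ beta)%:E).
  by apply/funext => s; rewrite RL_kernel_frac.
by split=> -[h1 h2]; split=> // u u0; have := h1 u u0; rewrite E.
Qed.

(** The fractional integrals only see positive times, where [f] can be replaced
    by [g]. *)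
Lemma RL_derivable_smooth l f g : l < 0 -> smooth l g ->
  (forall t, 0 < t -> f t = g t) -> RL_derivable (m%:R + beta) f.
Proof.
move=> l0 sg fg; apply/RL_derivable_frac; rewrite (abel_eq _ fg); split.
  move=> u u0; have [ig _] := abelE beta01 l0 sg u0.
  apply: eq_integrable ig => // s.
  by rewrite inE/= in_itv/= => /andP[s0 _]; rewrite fg.
by move=> i t _ t0; apply: (derivable_derive1n (l := 0)) => //; exact: abel_smooth l0 sg.
Qed.

End fractional_order.

Lemma abel_lin beta l f g (c e : R) : 0 < beta < 1 -> l < 0 -> smooth l f -> smooth l g ->
  forall u, 0 < u -> abel beta (fun t => c * f t + e * g t) u =
    c * abel beta f u + e * abel beta g u.
Proof.
move=> beta01 l0 sf sg u u0.
have [jf _] := abelE beta01 l0 sf u0; have [jg _] := abelE beta01 l0 sg u0.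
rewrite /abel -RintegralZl// -RintegralZl// -RintegralD//; last 2 first.
- exact: (integrableZl _ c jf).
- exact: (integrableZl _ e jg).
by apply: eq_Rintegral => s _; ring.
Qed.

End riemann_liouville_orders.

(** * The equation, and where its terms are defined *)

Section differential_equation.
Context {R : realType}.
Notation mu := (@lebesgue_measure R).
Implicit Types (t x u : R) (p f : R -> R).
Variables (a b : R).
Hypotheses (a0 : 0 < a) (b0 : 0 < b).

Let D : set R := `]0, +oo[%classic.
Let mD : measurable (D : set (measurableTypeR R)). Proof. exact: measurable_itv. Qed.
Let Dgt x : D x -> 0 < x. Proof. by rewrite /D /= in_itv/= andbT. Qed.

Let h f t : R := (ln a - digamma (b * t)) * f t.

Let q gam p t x : R := p x * ln x * RL_derive gam (gamma_density a b x) t.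

(** Here [gam] is the order on the right-hand side, one less than the order of
    the equation. *)
Definition terms_defined gam p f : Prop :=
  [/\ RL_derivable gam (h f),
      forall x, 0 < x -> RL_derivable gam (gamma_density a b x) &
      forall t, 0 < t -> mu.-integrable `]0%R, +oo[ (fun x => (q gam p t x)%:E)].

Definition solves_equation gam p f : Prop :=
  RL_derivable (gam + 1) f /\ forall t, 0 < t ->
    RL_derive (gam + 1) f t = b * RL_derive gam (h f) t +
      b * (\int[mu]_(x in `]0%R, +oo[) q gam p t x)%R.

Let family_derive1n_integrable (l : R) (F : R -> R -> R) : smooth_family mu D l F ->
  forall i t, l < t -> mu.-integrable D (fun x => (derive1n i (F x) t)%:E).
Proof.
move=> sF i; elim: i F sF => [|i IH] F sF t lt; first exact: family_integrable sF _ lt.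
by under eq_fun do rewrite derive1Sn; apply: IH => //; exact: family_derive1.
Qed.

Section integer_order.
Variables (p f : R -> R).
Hypothesis pp : power_like 0 p.
Hypothesis fE : forall t, 0 < t -> f t = mixture a b p t.

Let d01 : 0 <= (0 : R) <= 1. Proof. by rewrite lexx ler01. Qed.

Let fam : smooth_family mu D 0
  (fun x t => density_coef a b t * mellin a b (fun x => p x * ln x) x t).
Proof.
by have := density_family a0 b0 ler01 (power_like_ln pp); rewrite mul0r oppr0.
Qed.

Let mixture_sm : smooth 0 (mixture a b p).
Proof. by have := mixture_smooth a0 b0 d01 pp; rewrite mul0r oppr0. Qed.

Let hE t : 0 < t -> h f t = digamma_mixture a b p t.
Proof.
by move=> t0; rewrite /h fE// (digamma_mixtureE a0 b0 d01 pp t0).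
Qed.

Let dm_sm : smooth 0 (digamma_mixture a b p).
Proof. by have := digamma_mixture_smooth a0 b0 d01 pp; rewrite mul0r oppr0. Qed.

Let lnm_sm : smooth 0 (mixture a b (fun x => p x * ln x)).
Proof. by have := mixture_smooth a0 b0 d01 (power_like_ln pp); rewrite mul0r oppr0. Qed.

Let qE m t x : 0 < t -> D x -> q m%:R p t x =
  derive1n m (fun t => density_coef a b t * mellin a b (fun x => p x * ln x) x t) t.
Proof.
move=> t0 /Dgt x0; rewrite /q RL_derive_nat.
rewrite -(derive1nZ _ (gamma_density_smooth a0 b0 x0))//.
apply: derive1n_eq t0 => s s0.
exact: (mellin_densityE a0 b0 (fun x => p x * ln x) x0 s0).
Qed.

(** For integer orders everything happens at positive times, where a bounded
    [p] is enough: differentiate [derive1_mixture] [m] more times, under the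
    integral sign for its last term. *)
Lemma equation_integer_order m : terms_defined m%:R p f /\ solves_equation m%:R p f.
Proof.
have fderiv : smooth 0 f by apply: smooth_eq mixture_sm => t t0; rewrite fE.
split; split.
- apply/RL_derivable_nat => i t _ t0; apply: (derivable_derive1n (l := 0)) => //.
  by apply: smooth_eq dm_sm => s s0; rewrite hE.
- move=> x x0; apply/RL_derivable_nat => i t _ t0.
  by apply: (derivable_derive1n (l := 0)) => //; exact: gamma_density_smooth.
- move=> t t0; apply: (eq_integrable mD _ _ _ (family_derive1n_integrable fam m t0)).
  by move=> x; rewrite inE => Dx; rewrite qE.
- by rewrite natr1; apply/RL_derivable_nat => i t _ t0; apply: (derivable_derive1n (l := 0)).
- move=> t t0; rewrite natr1 !RL_derive_nat derive1Sn.
  have -> : (\int[mu]_(x in D) q m%:R p t x)%R =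
      derive1n m (mixture a b (fun x => p x * ln x)) t.
    rewrite (derive1n_family_integral mD fam)//.
    by apply: eq_Rintegral => x; rewrite inE => Dx; rewrite qE.
  have E s : 0 < s -> derive1 f s =
      b * digamma_mixture a b p s + b * mixture a b (fun x => p x * ln x) s.
    move=> s0; rewrite (derive1_eq fE s0) (derive1_mixture a0 b0 d01 pp s0).
    by rewrite (digamma_mixtureE a0 b0 d01 pp s0).
  rewrite (derive1n_eq E)// (derive1n_eq hE)//.
  have sb := smoothM (smooth_cst 0 b) dm_sm.
  by rewrite (derive1n_lin b sb lnm_sm m t0) (derive1nZ b dm_sm m t0).
Qed.

End integer_order.

Section fractional_order.
Variables (delta : R) (p f : R -> R).
Hypotheses (d01 : 0 < delta <= 1) (pp : power_like delta p).
Hypothesis fE : forall t, 0 < t -> f t = mixture a b p t.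
Variable beta : R.
Hypothesis beta01 : 0 < beta < 1.

Let d01' : 0 <= delta <= 1. Proof. by have /andP[/ltW -> ->] := d01. Qed.

Let l : R := - (delta / b).

Let l0 : l < 0. Proof. by rewrite oppr_lt0 divr_gt0//; have /andP[] := d01. Qed.

Let H x t : R := density_coef a b t * mellin a b (fun x => p x * ln x) x t.

Let fam : smooth_family mu D l H.
Proof. by apply: density_family => //; [case/andP: d01|exact: power_like_ln]. Qed.

Let mH : measurable_fun ((D : set (measurableTypeR R)) `*` (D : set (measurableTypeR R)))
  (fun z => H z.1 z.2).
Proof. by apply: measurable_density_mellin => //; have [] := power_like_ln pp. Qed.

Let mixture_sm : smooth l (mixture a b p). Proof. exact: mixture_smooth. Qed.

Let dm_sm : smooth l (digamma_mixture a b p). Proof. exact: digamma_mixture_smooth. Qed.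

Let lnm_sm : smooth l (mixture a b (fun x => p x * ln x)).
Proof. exact: (mixture_smooth a0 b0 d01' (power_like_ln pp)). Qed.

Let hE t : 0 < t -> h f t = digamma_mixture a b p t.
Proof.
by move=> t0; rewrite /h fE// (digamma_mixtureE a0 b0 d01' pp t0).
Qed.

Let G x t : R := density_coef a b t * mellin a b (fun=> 1) x t.

Let GE x t : 0 < x -> 0 < t -> gamma_density a b x t = G x t.
Proof. by move=> x0 t0; rewrite /G -mellin_densityE// mul1r. Qed.

Let G_sm x : smooth (- (1 / b)) (G x).
Proof. by apply: smoothM; [exact: density_coef_smooth|exact: mellin_smooth]. Qed.

Let b1 : - (1 / b) < 0. Proof. by rewrite oppr_lt0 divr_gt0. Qed.

Let qE m t x : 0 < t -> D x -> q (m%:R + beta) p t x =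
  (Gamma (1 - beta))^-1 * derive1n m.+1 (abel beta (H x)) t.
Proof.
move=> t0 /Dgt x0; rewrite /q RL_derive_frac// mulrCA; congr (_ * _).
rewrite (abel_eq beta (@GE x ^~ x0)).
rewrite -(@derive1nZ _ 0 _ _ (abel_smooth beta01 b1 (G_sm x)) m.+1 t t0).
apply: derive1n_eq t0 => u u0; have := abel_lin (p x * ln x) 0 beta01 b1 (G_sm x) (G_sm x) u0.
rewrite mul0r addr0 => <-; congr (abel _ _ _); apply/funext => s.
by rewrite mul0r addr0 /H /G /mellin; ring.
Qed.

(** As [p] vanishes at [0] like a power, the mixture continues smoothly to
    [t > - delta / b] with value [0] at [0]. Hence the first of the [m + 2]
    derivatives passes inside the Abel integral without boundary term and
    [derive1_mixture] applies; the Abel integral of the last term is then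
    exchanged with the integral over [x]. *)
Lemma equation_fractional_order m :
  terms_defined (m%:R + beta) p f /\ solves_equation (m%:R + beta) p f.
Proof.
pose C := (Gamma (1 - beta))^-1.
have afam := abel_smooth_family beta01 mD l0 fam mH.
split; split.
- exact: (RL_derivable_smooth m beta01 l0 dm_sm hE).
- by move=> x x0; exact: (RL_derivable_smooth m beta01 b1 (G_sm x) (@GE x ^~ x0)).
- move=> t t0; apply: (eq_integrable mD _ _ _
    (integrableZl mD C (family_derive1n_integrable afam m.+1 t0))).
  by move=> x; rewrite inE => Dx; rewrite qE.
- have -> : m%:R + beta + 1 = m.+1%:R + beta by rewrite -natr1; ring.
  exact: (RL_derivable_smooth _ beta01 l0 mixture_sm fE).
- move=> t t0; have -> : m%:R + beta + 1 = m.+1%:R + beta by rewrite -natr1; ring.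
  rewrite !RL_derive_frac// derive1Sn (abel_eq _ fE) (abel_eq _ hE).
  have -> : (\int[mu]_(x in D) q (m%:R + beta) p t x)%R =
      C * derive1n m.+1 (abel beta (mixture a b (fun x => p x * ln x))) t.
    rewrite (@derive1n_eq _ 0 _ (fun u => \int[mu]_(x in D) abel beta (H x) u)%R)//; last first.
      by move=> u u0; rewrite -(abel_exchange beta01 mD l0 fam mH).
    rewrite (derive1n_family_integral mD afam)// -RintegralZl//; last first.
      exact: family_derive1n_integrable afam _ _ t0.
    by apply: eq_Rintegral => x; rewrite inE => Dx; rewrite qE.
  have E u : 0 < u -> derive1 (abel beta (mixture a b p)) u =
      b * abel beta (digamma_mixture a b p) u +
      b * abel beta (mixture a b (fun x => p x * ln x)) u.
    move=> u0; rewrite (derive1_abel beta01 l0 mixture_sm (mixture0 _ _ _))//.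
    rewrite -(abel_lin _ _ beta01 l0)//; congr (abel _ _ _); apply/funext => s.
    by rewrite /digamma_mixture; field; rewrite gt_eqF.
  have s1 := abel_smooth beta01 l0 dm_sm.
  have s2 := abel_smooth beta01 l0 lnm_sm.
  have sb := smoothM (smooth_cst 0 b) s1.
  rewrite (derive1n_eq E)// (derive1n_lin b sb s2 _ t0) (derive1nZ b s1 _ t0).
  by rewrite -/C !mulrDr; congr (_ + _); rewrite mulrCA.
Qed.

End fractional_order.

(** Near [0] the factor [log a - psi (b s)] is at least [1 / (2 b s)], because
    of the pole of the digamma function, so the kernel of the fractional
    integral is at least [1 / (4 b s)], which is not integrable. *)
Lemma terms_undefined m beta p f : 0 < beta < 1 ->
  (\forall s \near 0^'+, 1 / 2 <= f s) -> ~ terms_defined (m%:R + beta) p f.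
Proof.
move=> beta01 [e /= e0 fe] [/(RL_derivable_frac _ beta01)[ih _] _ _].
have /andP[beta0 beta1] := beta01.
have [M M0 HM] : exists2 M : R, 0 <= M & forall s, 0 <= s <= 1 -> `|ln a - digamma (b * s + 1)| <= M.
  have sd : smooth (- (1 / b)) (fun s => digamma (b * s + 1)).
    apply: smooth_affine (@digamma_smooth R) => s lt.
    have -> : b * s + 1 = b * (s + 1 / b) by field; rewrite gt_eqF.
    by rewrite mulr_gt0//; lra.
  have sl := smooth_lin (-1) (smooth_cst _ (ln a)) sd.
  have lt0 : - (1 / b) < 0 by rewrite oppr_lt0 divr_gt0.
  have [M M0 HM] := continuous_bounded (smooth_continuous sl) 1 lt0.
  by exists M => // s s01; have := HM s s01; rewrite mulN1r.
(* below [r]: [f >= 1 / 2], the time is less than [1], and half of the pole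
   [1 / (b s)] absorbs the bounded part [M] *)
pose r := Num.min (Num.min e (1 / 2)) (2 * b * (M + 1))^-1.
have bM : 0 < 2 * b * (M + 1) by rewrite !mulr_gt0//; lra.
have r0 : 0 < r by rewrite !lt_min invr_gt0 bM e0 divr_gt0.
have mr : measurable (`]0%R, r[%classic : set (measurableTypeR R)).
  exact: measurable_itv.
have m01 : measurable (`]0%R, 1%R[%classic : set (measurableTypeR R)).
  exact: measurable_itv.
apply: (invr_not_integrable r0).
have r1 : `]0%R, r[%classic `<=` (`]0%R, 1%R[%classic : set R).
  move=> s /=; rewrite !in_itv/= => /andP[-> sr]/=.
  move: sr; rewrite !lt_min => /andP[/andP[_]]; lra.
have ihr := integrableS m01 mr r1 (ih 1 ltr01).
apply: (le_integrable mr _ _ (integrableZl mr (4 * b) ihr)).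
  apply/measurable_EFinP; apply: open_continuous_measurable_fun => //.
  move=> s; rewrite inE/= in_itv/= => /andP[s0 _].
  by apply: inv_continuous; rewrite gt_eqF.
move=> s /=; rewrite in_itv/= => /andP[s0].
rewrite !lt_min => /andP[/andP[se s2 sM]].
rewrite lee_fin ger0_norm ?invr_ge0 ?(ltW s0)// (le_trans _ (ler_norm _))//.
have fs : 1 / 2 <= f s.
  by apply: fe => //=; rewrite sub0r normrN gtr0_norm.
have As := HM s _; rewrite /h digammaS ?mulr_gt0//.
set A := ln a - digamma (b * s + 1) in As *.
have {}As : `|A| <= M by apply: As; rewrite (ltW s0)/=; lra.
have -> : s^-1 = b * (b * s)^-1 by field; rewrite !gt_eqF.
set x := (b * s)^-1.
have x0 : 0 < x by rewrite invr_gt0 mulr_gt0.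
have xM : 2 * (M + 1) <= x.
  rewrite /x -[leLHS]invrK lef_pV2 ?posrE ?invr_gt0 ?mulr_gt0//; last lra.
  move: sM; rewrite -mulrA mulrCA invfM -(ltr_pM2l b0) mulrA mulfV ?gt_eqF// mul1r.
  exact: ltW.
have -> : ln a - (digamma (b * s + 1) - x) = A + x by rewrite /A; ring.
have Ax : x / 2 <= A + x by move: As; rewrite ler_norml => /andP[h1 _]; lra.
set w := ((1 - s) `^ beta)^-1.
have w1 : 1 <= w.
  rewrite /w invf_ge1 ?powR_gt0 ?subr_gt0//; last lra.
  have : (1 - s) `^ beta <= 1 `^ beta.
    by apply: ge0_ler_powR; rewrite ?nnegrE ?(ltW beta0)//; lra.
  by rewrite powR1.
have H1 : x / 4 <= (A + x) * f s.
  have -> : x / 4 = x / 2 * (1 / 2) by field.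
  by rewrite ler_pM// ?divr_ge0// ltW.
have H2 : x / 4 <= (A + x) * f s * w.
  by apply: (le_trans H1); rewrite ler_peMr// (le_trans _ H1)// divr_ge0// ltW.
have -> : b * x = 4 * b * (x / 4) by field.
by rewrite ler_pM2l// mulr_gt0.
Qed.

End differential_equation.

Local Open Scope ring_scope.

Theorem theorem3p3 (d : measure_display) (T : measurableType d)
    (R : realType) (P : probability T R)
    (k : nat) (lam1 lam2 alpha a b gam : R) (FS Z : R -> T -> R)
    (hk : (1 <= k)%N) (hlam1 : 0 < lam1) (hlam2 : 0 < lam2)
    (halpha : 0 < alpha <= 1) (ha : 0 < a) (hb : 0 < b) (hgam : 1 <= gam)
    (hFS : FSPoK P k lam1 lam2 alpha FS)
    (hZ : gamma_subordinator P a b Z)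
    (hg : forall t, 0 < t ->
       has_density_on_pos P (Z t) (fun x => gamma_density a b x t))
    (hFSZ : independent_processes P FS Z)
    (n : int) :
  let p (x : R) : R := pmf_at P (FS x) n in
  let pf (t : R) : R := pmf_at P (fun w => FS (Z t w) w) n in
  let h (t : R) : R := (ln a - digamma (b * t)) * pf t in
  let q (t x : R) : R :=
    p x * ln x * RL_derive (gam - 1) (gamma_density a b x) t in
  let rhs_defined : Prop :=
    [/\ RL_derivable (gam - 1) h,
        forall x, 0 < x -> RL_derivable (gam - 1) (gamma_density a b x) &
        forall t, 0 < t ->
          lebesgue_measure.-integrable `]0%R, +oo[ (fun x => (q t x)%:E)] in
  (rhs_defined ->
     RL_derivable gam pf /\
     forall t, 0 < t ->
       RL_derive gam pf t =
         b * RL_derive (gam - 1) h t +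
         b * (\int[lebesgue_measure]_(x in `]0%R, +oo[) q t x)%R) /\
  (n <> 0 \/ gam \is a Num.nat -> rhs_defined).
Proof.
move=> p pf h q rhs_defined.
have [mF rcF [delta [C [d01 bd]]]] := FSPoK_regular hk hlam1 hlam2 halpha hFS.
have [subZ _] := hZ.
have Z0 t w : 0 <= t -> 0 <= Z t w.
  by move=> t0; rewrite -(subordinator_start subZ w); exact: (subordinator_monotone subZ).
have mp : measurable_fun (`]0%R, +oo[%classic : set R) p := measurable_pmf_at P mF rcF n.
have p01 x : 0 < x -> 0 <= p x <= 1 by move=> x0; exact: (pmf_at_01 P mF n (ltW x0)).
have p_bounded : power_like 0 p.
  apply: (@power_like_bounded _ _ 1) => // x /p01 /andP[q0 q1].
  by rewrite ger0_norm// mul0r expR0 mulr1.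
have gE x t : 0 < x -> 0 < t -> gamma_density a b x t =
    density_coef a b t * mellin a b (fun=> 1) x t.
  by move=> x0 t0; rewrite -mellin_densityE// mul1r.
have pfE t : 0 < t -> pf t = mixture a b p t.
  move=> t0; rewrite -mixtureE//.
  apply: (pmf_at_random_time mF rcF n hFSZ _ _ _ _ _ (hg t t0)).
  - exact: (subordinator_measurable subZ (ltW t0)).
  - by move=> w; exact: Z0 (ltW t0).
  - move=> B mB; apply: sub_sigma_algebra; exists t; split; first exact: ltW.
    by exists B.
  - have mm := measurable_funM (measurable_cst (density_coef a b t))
      (mellin_measurable a b t (@power_like1 R)).
    apply: eq_measurable_fun mm => x; rewrite inE/= in_itv/= andbT => x0.
    by rewrite gE.
  - move=> x x0; rewrite /gamma_density !mulr_ge0 ?powR_ge0 ?expR_ge0//.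
    by rewrite invr_ge0 ltW// Gamma_gt0// mulr_gt0.
have mnz x : 0 < x -> measurable [set w | FS x w != 0].
  move=> x0; have := measurableC (measurable_preimage (mF x (ltW x0)) (measurable_set1 0)).
  by congr (measurable _); apply/seteqP; split => w /= /eqP.
(* the order on the right-hand side is [gam - 1 = m], respectively [m + beta] *)
have [[m gamE]|[m [beta [beta01 gamE]]]] := order_decomposition hgam.
  have [dom sol] := equation_integer_order ha hb p_bounded pfE m.
  have e1 : gam - 1 = m%:R by rewrite gamE -natr1; ring.
  have e2 : gam = m%:R + 1 by rewrite gamE natr1.
  have dom' : rhs_defined by rewrite /rhs_defined /q e1; exact: dom.
  by split=> [_|_]; [rewrite /q e1 e2; exact: sol|exact: dom'].
have e1 : gam - 1 = m%:R + beta by rewrite gamE -natr1; ring.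
have e2 : gam = m%:R + beta + 1 by rewrite gamE -natr1; ring.
have [n0|n0] := eqVneq n 0; last first.
  have p_small : power_like delta p.
    apply: (@power_like_bounded _ _ C) => // x x0.
    have /andP[q0 _] := p01 x x0.
    rewrite ger0_norm// -lee_fin (pmf_atE P mF n (ltW x0)).
    apply: le_trans (bd x x0); apply: le_measure; rewrite ?inE.
    - exact: (measurable_preimage (mF x (ltW x0)) (measurable_set1 n%:~R)).
    - exact: mnz.
    - by move=> w /= ->; rewrite intr_eq0.
  have [dom sol] := equation_fractional_order ha hb d01 p_small pfE beta01 m.
  have dom' : rhs_defined by rewrite /rhs_defined /q e1; exact: dom.
  by split=> [_|_]; [rewrite /q e1 e2; exact: sol|exact: dom'].
(* the remaining case is vacuous: as [p] tends to [1] at [0], so does [pf] *)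
have undef : ~ rhs_defined.
  suff pf_near : \forall s \near 0^'+, 1 / 2 <= pf s.
    by rewrite /rhs_defined /q e1 => /(terms_undefined hb beta01 pf_near).
  pose r x := 1 - p x.
  have r_small : power_like delta r.
    apply: (@power_like_bounded _ _ C); first exact: measurable_funB.
    move=> x x0; have /andP[_ q1] := p01 x x0.
    rewrite ger0_norm ?subr_ge0// -lee_fin (le_trans _ (bd x x0))//.
    rewrite EFinB (pmf_atE P mF n (ltW x0)) -probability_setC; last first.
      exact: (measurable_preimage (mF x (ltW x0)) (measurable_set1 n%:~R)).
    rewrite le_eqVlt; apply/orP; left; apply/eqP; congr (P _).
    by rewrite n0; apply/seteqP; split => w /= /eqP.
  have d01' : 0 <= delta <= 1 by have /andP[/ltW -> ->] := d01.
  have r_cont : {for 0, continuous (mixture a b r)}.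
    apply: (smooth_continuous (mixture_smooth ha hb d01' r_small)).
    by rewrite oppr_lt0 divr_gt0//; have /andP[] := d01.
  have fam psi : power_like 0 psi -> smooth_family lebesgue_measure `]0%R, +oo[%classic 0
      (fun x t => density_coef a b t * mellin a b psi x t).
    by move=> /(density_family ha hb ler01); rewrite mul0r oppr0.
  have pfE' t : 0 < t -> pf t = 1 - mixture a b r t.
    move=> t0; rewrite pfE//.
    have -> : mixture a b r t = mixture a b (fun=> 1) t - mixture a b p t.
      rewrite /mixture -RintegralB//; last 2 first.
      - exact: (family_integrable _ (fam _ (@power_like1 R)) t0).
      - exact: (family_integrable _ (fam _ p_bounded) t0).
      by apply: eq_Rintegral => x _; rewrite /mellin /r; ring.
    suff -> : mixture a b (fun=> 1) t = 1 by rewrite subKr.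
    have := hg t t0 setT measurableT; rewrite setTI.
    have -> : [set w | [set: R] (Z t w)] = setT by apply/seteqP; split.
    rewrite probability_setT => mass.
    rewrite -mixtureE// /Rintegral; under eq_integral do rewrite mul1r.
    by rewrite -mass.
  near=> s.
  have s0 : 0 < s by near: s; exact: nbhs_right_gt.
  have : `|mixture a b r 0 - mixture a b r s| < 1 / 2.
    near: s; apply: cvg_within; move/cvgrPdist_lt : r_cont; apply.
    by rewrite divr_gt0.
  rewrite pfE'// mixture0 sub0r normrN => /ltr_normlW; lra.
split=> // -[/(_ n0)//|]; rewrite gamE.
by rewrite fractional_order_not_nat.
Unshelve. all: by end_near. Qed.
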